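(* Let $d\in\{2,3\}$, let $\Omega\subset\mathbb{R}^d$ be a bounded domain with sufficiently smooth boundary, and assume: (i) $J\in W^{1,1}(\mathbb{R}^d)$, $J(x)=J(-x)$, and $a(x):=\int_\Omega J(x-y)\,dy\ge 0$ for a.e. $x\in\Omega$; (ii) $\nu:\mathbb{R}\to\mathbb{R}$ is locally Lipschitz and there are $\nu_1,\nu_2>0$ with $\nu_1\le\nu(s)\le\nu_2$ for all $s\in\mathbb{R}$; (iii) $F\in C^{2,1}_{loc}(\mathbb{R})$ and there is $c_0>0$ with $F''(s)+a(x)\ge c_0$ for all $s\in\mathbb{R}$ and a.e. $x\in\Omega$; (iv) there are $c_3>0$, $c_4\ge 0$ and $p\in(1,2]$ with $|F'(s)|^p\le c_3|F(s)|+c_4$ for all $s\in\mathbb{R}$; (v) there are $c_7>0$, $c_8>0$, $q>0$ with $F''(s)+a(x)\ge c_7|s|^{2q}-c_8$ for all $s\in\mathbb{R}$ and a.e. $x\in\Omega$. Let $h\in L^2_{tb}(0,\infty;V_{div}')$. Then there are positive constants $k,K$, independent of the initial data, with $K$ depending on $\Omega,\nu_1,J,F$ and $\|h\|_{L^2_{tb}(0,\infty;V_{div}')}$, such that every weak solution $z=[u,\varphi]$ on $[0,\infty)$ of the nonlocal Cahn-Hilliard-Navier-Stokes system with external force $h$ and initial data $z_0=[u_0,\varphi_0]$ which fulfills the energy inequality $$\mathcal{E}(z(t))+\int_s^t\big(2\|\sqrt{\nu(\varphi)}Du\|^2+\|\nabla\mu\|^2\big)d\tau\le\mathcal{E}(z(s))+\int_s^t\langle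 h(\tau),u(\tau)\rangle\,d\tau$$ for a.e. $s\ge0$, including $s=0$, and every $t\ge s$, satisfies $$\mathcal{E}(z(t))\le\mathcal{E}(z_0)e^{-kt}+F(m_0)|\Omega|+K\qquad\text{for all }t\ge0,$$ where $m_0=\frac{1}{|\Omega|}(\varphi_0,1)$.
   Context: Function spaces: $H=L^2(\Omega)$ (also for vector/matrix valued functions), $V=H^1(\Omega)$, $G_{div}$ is the closure in $L^2(\Omega)^d$ of $\{u\in C_0^\infty(\Omega)^d:\mathrm{div}(u)=0\}$, $V_{div}=\{u\in H^1_0(\Omega)^d:\mathrm{div}(u)=0\}$ with scalar product $(\nabla u,\nabla v)$. $\|\cdot\|$ and $(\cdot,\cdot)$ are the $L^2$ norm and scalar product, $\langle\cdot,\cdot\rangle$ denotes duality pairings, primes on spaces denote duals. $2Du=\nabla u+(\nabla u)^{tr}$, $b(u,v,w)=\int_\Omega (u\cdot\nabla)v\cdot w$, $(J\ast\varphi)(x)=\int_\Omega J(x-y)\varphi(y)\,dy$. $h\in L^2_{tb}(0,\infty;V_{div}')$ means $\|h\|_{L^2_{tb}(0,\infty;V_{div}')}:=\big(\sup_{t\ge0}\int_t^{t+1}\|h(\tau)\|_{V_{div}'}^2d\tau\big)^{1/2}<\infty$. Weak solution. The system is $\varphi_t+u\cdot\nabla\varphi=\Delta\mu$, $\mu=a\varphi-J\ast\varphi+F'(\varphi)$, $u_t-\mathrm{div}(\nu(\varphi)2Du)+(u\cdot\nabla)u+\nabla\pi=\mu\nabla\varphi+h$, $\mathrm{div}(u)=0$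 in $\Omega$, with $\partial\mu/\partial n=0$, $u=0$ on $\partial\Omega$. For $u_0\in G_{div}$ and $\varphi_0\in H$ with $F(\varphi_0)\in L^1(\Omega)$, $[u,\varphi]$ is a weak solution on $(0,T)$ with initial data $[u_0,\varphi_0]$ if: $u\in L^\infty(0,T;G_{div})\cap L^2(0,T;V_{div})$; $\varphi\in L^\infty(0,T;H)\cap L^2(0,T;V)$; $u_t\in L^{4/3}(0,T;V_{div}')$ and $\varphi_t\in L^{4/3}(0,T;V')$ if $d=3$; $u_t\in L^{2-\gamma}(0,T;V_{div}')$ and $\varphi_t\in L^{2-\delta}(0,T;V')$ for all $\gamma,\delta\in(0,1)$ if $d=2$; $\varphi\in L^\infty(0,T;L^{2+2q}(\Omega))$; $\mu:=a\varphi-J\ast\varphi+F'(\varphi)\in L^2(0,T;V)$; for every $\psi\in V$, $v\in V_{div}$ and a.e. $t\in(0,T)$, $$\langle\varphi_t,\psi\rangle+(\nabla\mu,\nabla\psi)=(u,\varphi\nabla\psi),\qquad \langle u_t,v\rangle+(\nu(\varphi)2Du,Dv)+b(u,u,v)=-(v,\varphi\nabla\mu)+\langle h,v\rangle;$$ and $u(0)=u_0$, $\varphi(0)=\varphi_0$. A weak solution on $[0,\infty)$ is one whose restriction to $(0,T)$ is a weak solution for every $T>0$. Values $z(t)=[u(t),\varphi(t)]$ refer to the weakly continuous representatives $u\in C_w([0,\infty);G_{div})$, $\varphi\in C_w([0,\infty);H)$. Energy: $\mathcal{E}(z(t))=\frac12\|u(t)\|^2+\frac14\int_\Omega\int_\Omega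 J(x-y)(\varphi(x,t)-\varphi(y,t))^2dx\,dy+\int_\Omega F(\varphi(t))$, and $\mathcal{E}(z_0)$ is the same expression evaluated at $[u_0,\varphi_0]$. *)

(* Defs.v *)
From HB Require Import structures.
From mathcomp Require Import all_boot all_order all_algebra.
From mathcomp Require Import all_classical all_reals all_analysis.
Set Implicit Arguments. Unset Strict Implicit. Unset Printing Implicit Defensive.
Import Order.TTheory GRing.Theory Num.Theory.
Import numFieldNormedType.Exports.
Local Open Scope classical_set_scope.
Local Open Scope ring_scope.

Fact rV_display : measure_display. Proof. exact: default_measure_display. Qed.
(* 'rV[R]_n carries the product sigma-algebra, generated by the coordinates. *)
Section rV_measurable.
Variables (R : realType) (n : nat).
Let coord (i : 'I_n) (x : 'rV[R]_n) : R := x ord0 i.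
Let rV_set0 : g_sigma_preimage coord set0.
Proof. exact: sigma_algebra0. Qed.

Let rV_setC A : g_sigma_preimage coord A -> g_sigma_preimage coord (~` A).
Proof. exact: sigma_algebraC. Qed.

Let rV_bigcup (F : (set 'rV[R]_n)^nat) : (forall i, g_sigma_preimage coord (F i)) ->
  g_sigma_preimage coord (\bigcup_i (F i)).
Proof. exact: sigma_algebra_bigcup. Qed.

HB.instance Definition _ := @isMeasurable.Build rV_display
  'rV[R]_n (g_sigma_preimage coord) rV_set0 rV_setC rV_bigcup.

Lemma measurable_coord (i : 'I_n) :
  measurable_fun [set: 'rV[R]_n] (fun x : 'rV[R]_n => x ord0 i).
Proof.
move=> _ Y mY; rewrite setTI; apply: sub_sigma_algebra => /=.
rewrite -bigcup_seq/=; exists i => /=; first by rewrite mem_index_enum.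
by exists Y => //; rewrite setTI.
Qed.

Lemma measurable_rV d (T : measurableType d) (f : T -> 'rV[R]_n) :
  (forall i, measurable_fun [set: T] (fun t => f t ord0 i)) ->
  measurable_fun [set: T] f.
Proof.
move=> mf.
suff H : g_sigma_preimage (fun i => coord i \o f) `<=` measurable.
  move=> _ A mA; rewrite setTI; apply: H.
  by rewrite g_sigma_preimage_comp; exists A => //; rewrite setTI.
apply: smallest_sub; first exact: sigma_algebra_measurable.
move=> A; rewrite -bigcup_seq/= => -[i _ [B mB <-]].
exact: mf.
Qed.
End rV_measurable.

Section rV_cons.
Variables (R : realType) (n : nat).

Definition rV_cons (p : R * 'rV[R]_n) : 'rV[R]_n.+1 :=
  \row_i oapp (p.2 ord0) p.1 (unlift ord0 i).
Definition rV_uncons (x : 'rV[R]_n.+1) : R * 'rV[R]_n :=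
  (x ord0 ord0, \row_i x ord0 (lift ord0 i)).

Lemma measurable_rV_cons : measurable_fun setT rV_cons.
Proof.
apply: measurable_rV => i.
case: (unliftP ord0 i) => [j|] ->.
- rewrite (_ : (fun _ => _) = (fun x : 'rV[R]_n => x ord0 j) \o snd).
    exact: (measurableT_comp (measurable_coord j) measurable_snd).
  by apply/funext => p; rewrite !mxE liftK.
- rewrite (_ : (fun _ => _) = fst); first exact: measurable_fst.
  by apply/funext => p; rewrite !mxE unlift_none.
Qed.

Lemma measurable_rV_uncons : measurable_fun setT rV_uncons.
Proof.
apply: measurable_fun_pair; first exact: measurable_coord.
apply: measurable_rV => i.
rewrite (_ : (fun _ => _) = (fun x : 'rV[R]_n.+1 => x ord0 (lift ord0 i))).
  exact: measurable_coord.
by apply/funext => p; rewrite !mxE.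
Qed.

Lemma rV_consK : cancel rV_cons rV_uncons.
Proof.
move=> [a x]; congr pair; rewrite /rV_cons /= ?mxE ?unlift_none//.
by apply/rowP => i; rewrite !mxE liftK.
Qed.
Lemma rV_unconsK : cancel rV_uncons rV_cons.
Proof.
move=> x; apply/rowP => i; rewrite !mxE.
by case: (unliftP ord0 i) => [j|] ->; rewrite ?liftK ?unlift_none /= ?mxE.
Qed.

Variable m : {sigma_finite_measure set 'rV[R]_n -> \bar R}.
Definition mcons : set 'rV[R]_n.+1 -> \bar R :=
  pushforward ((@lebesgue_measure R) \x m)%E rV_cons.
Let mcons0 : mcons set0 = 0%E.
Proof. by rewrite /mcons /pushforward preimage_set0 measure0. Qed.
Let mcons_ge0 A : (0 <= mcons A)%E.
Proof. by rewrite /mcons /pushforward; apply: measure_ge0. Qed.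
Let mcons_sigma_additive : semi_sigma_additive mcons.
Proof.
move=> F mF tF mUF; rewrite /mcons /pushforward preimage_bigcup.
apply: measure_semi_sigma_additive.
- by move=> k; rewrite -[X in measurable X]setTI; exact: measurable_rV_cons.
- apply/trivIsetP => /= i j _ _ ij; rewrite -preimage_setI.
  by move/trivIsetP : tF => /(_ _ _ _ _ ij) ->//; rewrite preimage_set0.
- by rewrite -preimage_bigcup -[X in measurable X]setTI; exact: measurable_rV_cons.
Qed.
HB.instance Definition _ := isMeasure.Build _ _ _ mcons mcons0 mcons_ge0 mcons_sigma_additive.
Let mcons_sigma_finite : sigma_finite setT mcons.
Proof.
have /sigma_finiteP[F [TF ndF Foo]] := sigma_finiteT (@lebesgue_measure R).
have /sigma_finiteP[G [TG ndG Goo]] := sigma_finiteT m.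
exists (fun k => rV_uncons @^-1` (F k `*` G k)) => [|k].
  rewrite -preimage_bigcup (_ : \bigcup_k _ = setT) ?preimage_setT//.
  rewrite -setXTT TF TG predeqE => -[x y]; split=> [[k _ []/= ? ?]|].
    by split; exists k.
  move=> [/= [i _ Fix] [j _ Gjy]]; exists (maxn i j) => //; split.
  - by move: x Fix; exact/subsetPset/ndF/leq_maxl.
  - by move: y Gjy; exact/subsetPset/ndG/leq_maxr.
have [mF lF] := Foo k; have [mG lG] := Goo k.
have mFG : measurable (F k `*` G k) by exact: measurableX.
split.
  by rewrite -[X in measurable X]setTI; exact: measurable_rV_uncons.
rewrite /mcons /pushforward -comp_preimage (_ : _ \o _ = id); last first.
  by apply/funext => x; exact: rV_consK.
by rewrite preimage_id product_measure1E// lte_mul_pinfty// ge0_fin_numE.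
Qed.
HB.instance Definition _ := Measure_isSigmaFinite.Build _ _ _ mcons mcons_sigma_finite.
End rV_cons.

(* n-dimensional Lebesgue measure, as the n-fold product of the one-dimensional
   one transported to row vectors. *)
Fixpoint leb (R : realType) (n : nat) : {sigma_finite_measure set 'rV[R]_n -> \bar R} :=
  match n return {sigma_finite_measure set 'rV[R]_n -> \bar R} with
  | 0 => @dirac _ 'rV[R]_0 0 R
  | n'.+1 => mcons (leb R n')
  end.

(* Frobenius product; for row vectors, the Euclidean scalar product. *)
Definition mxdot (R : realType) (m n : nat) (A B : 'M[R]_(m, n)) : R :=
  \tr (A *m B^T).

Definition enorm (R : realType) (m n : nat) (A : 'M[R]_(m, n)) : R :=
  Num.sqrt (mxdot A A).

Section classical_calculus.
Variables (R : realType) (d : nat).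
Local Notation pt := 'rV[R]_d.
Implicit Types (f : pt -> R) (Omega : set pt).

Definition partial (i : 'I_d) f : pt -> R :=
  fun x => 'D_(delta_mx ord0 i : pt) f x.

Definition iter_partial (s : seq 'I_d) f : pt -> R := foldr partial f s.

Definition Ck (k : nat) f : Prop :=
  forall s : seq 'I_d,
    ((size s <= k)%N -> continuous (iter_partial s f)) /\
    ((size s < k)%N -> forall x i,
        derivable (iter_partial s f) x (delta_mx ord0 i : pt)).

Definition smooth f : Prop := forall k, Ck k f.

(* C_0^oo(Omega) *)
Definition test_function Omega : set (pt -> R) :=
  [set f | [/\ smooth f,
    compact (closure [set x | f x != 0]) &
    closure [set x | f x != 0] `<=` Omega]].

Definition component (u : pt -> pt) (i : 'I_d) : pt -> R := fun x => u x ord0 i.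

(* A bounded domain whose boundary is of class C^1, i.e. Omega is locally the
   sublevel set of a C^1 function with nonvanishing gradient. *)
Definition C1_bounded_domain Omega : Prop :=
  [/\ open Omega, connected Omega, Omega !=set0, bounded_set Omega &
    forall x0, closure Omega x0 -> ~ Omega x0 ->
      exists2 r : R, 0 < r & exists rho : pt -> R,
        [/\ Ck 1 rho, exists i, partial i rho x0 != 0 &
          forall x, ball x0 r x -> (Omega x <-> rho x < 0)]].

End classical_calculus.

Section spaces.
Variables (R : realType) (d : nat) (Omega : set 'rV[R]_d).
Local Notation pt := 'rV[R]_d.
Local Notation lam := (leb R d).
Implicit Types (f g : pt -> R) (u v w : pt -> pt).

Definition Lp_norm (p : \bar R) f : \bar R := 'N[lam]_p[(EFin \o f) \_ Omega]%E.

Definition Lp (p : \bar R) : set (pt -> R) :=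
  [set f | measurable_fun Omega f /\ (Lp_norm p f < +oo)%E].

(* Elements of function spaces are functions, not classes modulo a.e. equality. *)
Definition L2 : set (pt -> R) := Lp 2%:E.

Definition L2v : set (pt -> pt) := [set u | forall i, L2 (component u i)].

Definition L2v_norm (m n : nat) (u : pt -> 'M[R]_(m, n)) : \bar R :=
  Lp_norm 2%:E (enorm (n := n) \o u).

Definition ip f g : R := \int[lam]_(x in Omega) (f x * g x).

Definition ipm (m n : nat) (u v : pt -> 'M[R]_(m, n)) : R :=
  \int[lam]_(x in Omega) mxdot (u x) (v x).

Definition locally_integrable_on f : Prop :=
  forall K : set pt, compact K -> K `<=` Omega -> lam.-integrable K (EFin \o f).

Definition is_weak_partial (i : 'I_d) f g : Prop :=
  [/\ locally_integrable_on f, locally_integrable_on g &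
    forall eta, test_function Omega eta -> ip f (partial i eta) = - ip g eta].

Definition W1p (p : \bar R) : set (pt -> R) :=
  [set f | Lp p f /\ forall i, exists2 g, is_weak_partial i f g & Lp p g].

(* A chosen representative of the weak derivative; 0 if there is none. *)
Definition wpartial (i : 'I_d) f : pt -> R := xget 0 (is_weak_partial i f).

Definition wgrad f : pt -> pt := fun x => \row_i wpartial i f x.

(* (vgrad u)_ij = d_i u_j, so that (w . nabla) u = w *m vgrad u. *)
Definition vgrad u : pt -> 'M[R]_d :=
  fun x => \matrix_(i, j) wpartial i (component u j) x.

Definition symgrad u : pt -> 'M[R]_d :=
  fun x => 2^-1 *: (vgrad u x + (vgrad u x)^T).

Definition H1 : set (pt -> R) := W1p 2%:E.

Definition H1_norm f : \bar R :=
  ((Lp_norm 2%:E f ^+ 2 + L2v_norm (wgrad f) ^+ 2) `^ 2^-1)%E.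

Definition H10 : set (pt -> R) :=
  [set f | H1 f /\ forall e : R, 0 < e ->
    exists2 eta, test_function Omega eta & (H1_norm (f - eta)%R < e%:E)%E].

Definition Gdiv : set (pt -> pt) :=
  [set u | L2v u /\ forall e : R, 0 < e ->
    exists w, [/\ forall i, test_function Omega (component w i),
      forall x, \sum_i partial i (component w i) x = 0 &
      (L2v_norm (u - w)%R < e%:E)%E]].

Definition Vdiv : set (pt -> pt) :=
  [set u | (forall i, H10 (component u i)) /\
    \forall x \ae lam, Omega x -> \tr (vgrad u x) = 0].

Definition Vdiv_norm u : \bar R := L2v_norm (vgrad u).

(* b(u,v,w) *)
Definition trilinear u v w : R :=
  \int[lam]_(x in Omega) mxdot (u x *m vgrad v x) (w x).

End spaces.

(* A normed space is given by a subset X of an lmodType E and a (semi)norm N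
   on it.  Functionals are total functions on E, of which only the values on X
   matter. *)
Section dual_and_Bochner_spaces.
Variables (R : realType) (E : lmodType R) (X : set E) (N : E -> \bar R).

Definition dual_norm (l : E -> R) : \bar R :=
  ereal_sup [set `|l x|%:E | x in [set x | X x /\ (N x <= 1)%E]].

Definition dual : set (E -> R) :=
  [set l | (forall (c : R) x y, X x -> X y -> l (c *: x + y) = c * l x + l y) /\
    exists C : R, forall x, X x -> (`|l x|%:E <= C%:E * N x)%E].

Local Notation lam1 := (@lebesgue_measure R).

Definition strongly_measurable (D : set R) (f : R -> E) : Prop :=
  exists s : nat -> R -> E,
    [/\ forall n, finite_set (range (s n)),
      forall n y, measurable (s n @^-1` [set y]),
      forall n t, X (s n t) &
      \forall t \ae lam1, D t ->
        (fun n => N (s n t - f t)) @ \oo --> (0 : \bar R)].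

(* L^p(D; X) *)
Definition Bochner_Lp (D : set R) (p : \bar R) : set (R -> E) :=
  [set f | [/\ \forall t \ae lam1, D t -> X (f t),
    strongly_measurable D f &
    ('N[lam1]_p[(fun t => N (f t)) \_ D] < +oo)%E]].

Definition test_function1 (T : R) : set (R -> R) :=
  [set eta | (forall n (t : R), derivable (derive1n n eta) t 1) /\
    exists a b : R, [/\ 0 < a, b < T & forall t, eta t != 0 -> a <= t <= b]].

(* g : (0,T) -> X' is the distributional time derivative of f, where f(t) is
   identified with the functional pr (f t) on X. *)
Definition is_time_derivative (T : R) (pr : E -> E -> R)
    (f : R -> E) (g : R -> E -> R) : Prop :=
  forall v, X v -> forall eta, test_function1 T eta ->
    \int[lam1]_(t in `]0, T[) (pr (f t) v * derive1 eta t) =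
    - \int[lam1]_(t in `]0, T[) (g t v * eta t).

(* C_w([0,oo); X) *)
Definition weakly_continuous (pr : E -> E -> R) (f : R -> E) : Prop :=
  (forall t, 0 <= t -> X (f t)) /\
  forall v, X v -> {within `[0, +oo[, continuous (fun t => pr (f t) v)}.

End dual_and_Bochner_spaces.

Section model.
Variables (R : realType) (d : nat) (Omega : set 'rV[R]_d).
Local Notation pt := 'rV[R]_d.
Local Notation lam := (leb R d).
Local Notation lam1 := (@lebesgue_measure R).

Definition locally_lipschitz (f : R -> R) : Prop :=
  forall s : R, exists2 A, nbhs s A & [lipschitz f x | x in A].

Definition afun (J : pt -> R) (x : pt) : R := \int[lam]_(y in Omega) J (x - y).

Definition conv (J f : pt -> R) (x : pt) : R :=
  \int[lam]_(y in Omega) (J (x - y) * f y).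

Definition kernel_assumption (J : pt -> R) : Prop :=
  [/\ W1p setT 1%E J, \forall x \ae lam, J x = J (- x) &
    \forall x \ae lam, Omega x -> 0 <= afun J x].

Definition viscosity_assumption (nu1 : R) (nu : R -> R) : Prop :=
  [/\ locally_lipschitz nu, 0 < nu1 &
    exists2 nu2, 0 < nu2 & forall s, nu1 <= nu s <= nu2].

(* F in C^{2,1}_loc *)
Definition C21loc (F : R -> R) : Prop :=
  [/\ forall s : R, derivable F s 1, forall s : R, derivable (derive1 F) s 1 &
    locally_lipschitz (derive1n 2 F)].

Definition convexity_assumption (J : pt -> R) (F : R -> R) : Prop :=
  C21loc F /\ exists2 c0 : R, 0 < c0 &
    forall s : R, \forall x \ae lam, Omega x -> c0 <= derive1n 2 F s + afun J x.

Definition growth_assumption (F : R -> R) : Prop :=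
  exists c3 c4 p : R, [/\ 0 < c3, 0 <= c4, 1 < p <= 2 &
    forall s : R, `|derive1 F s| `^ p <= c3 * `|F s| + c4].

Definition coercivity_assumption (J : pt -> R) (F : R -> R) (q : R) : Prop :=
  0 < q /\ exists c7 c8 : R, [/\ 0 < c7, 0 < c8 &
    forall s : R, \forall x \ae lam, Omega x ->
      c7 * `|s| `^ (2 * q) - c8 <= derive1n 2 F s + afun J x].

Definition Vdiv_dual_norm : ((pt -> pt) -> R) -> \bar R :=
  dual_norm (Vdiv Omega) (Vdiv_norm Omega).

Definition tb_norm (h : R -> (pt -> pt) -> R) : \bar R :=
  ((ereal_sup [set \int[lam1]_(s in `[t, (t + 1)%R]) (Vdiv_dual_norm (h s) ^+ 2)
              | t in `[0%R, +oo[]) `^ 2^-1)%E.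

(* L^2_tb(0,oo; Vdiv') *)
Definition L2tb : set (R -> (pt -> pt) -> R) :=
  [set h | [/\ \forall t \ae lam1, 0 <= t -> dual (Vdiv Omega) (Vdiv_norm Omega) (h t),
    strongly_measurable (dual (Vdiv Omega) (Vdiv_norm Omega)) Vdiv_dual_norm
      `[0, +oo[ h &
    (tb_norm h < +oo)%E]].

Definition chemical_potential (J : pt -> R) (F : R -> R) (phi : pt -> R) : pt -> R :=
  fun x => afun J x * phi x - conv J phi x + derive1 F (phi x).

(* The part involving F may a priori be +oo. *)
Definition energy (J : pt -> R) (F : R -> R) (u : pt -> pt) (phi : pt -> R) : \bar R :=
  ((2^-1 * ipm Omega u u +
    4^-1 * \int[lam]_(x in Omega) \int[lam]_(y in Omega)
             (J (x - y) * (phi x - phi y) ^+ 2))%R%:E +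
   \int[lam]_(x in Omega) (F (phi x))%:E)%E.

Section solution.
Variables (J : pt -> R) (nu F : R -> R) (q : R) (h : R -> (pt -> pt) -> R).
Variables (u0 : pt -> pt) (phi0 : pt -> R).
Variables (u : R -> pt -> pt) (phi : R -> pt -> R).
Let mu t := chemical_potential J F (phi t).

Record initial_data : Prop := {
  initial_velocity : Gdiv Omega u0;
  initial_phase : L2 Omega phi0;
  initial_potential : lam.-integrable Omega (fun x => (F (phi0 x))%:E) }.

(* u and phi stand for their weakly continuous representatives, so that
   u 0 and phi 0 are meaningful; see global_weak_solution. *)
Record weak_solution (T : R) : Prop := {
  ws_u_Linf : Bochner_Lp (Gdiv Omega) (@L2v_norm R d Omega 1 d) `]0, T[ +oo%E u;
  ws_u_L2 : Bochner_Lp (Vdiv Omega) (Vdiv_norm Omega) `]0, T[ 2%:E u;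
  ws_phi_Linf : Bochner_Lp (L2 Omega) (Lp_norm Omega 2%:E) `]0, T[ +oo%E phi;
  ws_phi_L2 : Bochner_Lp (H1 Omega) (H1_norm Omega) `]0, T[ 2%:E phi;
  ws_phi_Lq : Bochner_Lp (Lp Omega (2 + 2 * q)%:E) (Lp_norm Omega (2 + 2 * q)%:E)
                `]0, T[ +oo%E phi;
  ws_mu_L2 : Bochner_Lp (H1 Omega) (H1_norm Omega) `]0, T[ 2%:E mu;
  ws_equations : exists (ut : R -> (pt -> pt) -> R) (phit : R -> (pt -> R) -> R),
    let ut_in p := Bochner_Lp (dual (Vdiv Omega) (Vdiv_norm Omega)) Vdiv_dual_norm
                     `]0, T[ p%:E ut in
    let phit_in p := Bochner_Lp (dual (H1 Omega) (H1_norm Omega))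
                     (dual_norm (H1 Omega) (H1_norm Omega)) `]0, T[ p%:E phit in
    [/\ is_time_derivative (Vdiv Omega) T (@ipm R d Omega 1 d) u ut,
        is_time_derivative (H1 Omega) T (ip Omega) phi phit,
        d = 3 -> ut_in (4 / 3) /\ phit_in (4 / 3),
        d = 2 -> forall gamma delta : R, 0 < gamma < 1 -> 0 < delta < 1 ->
                   ut_in (2 - gamma) /\ phit_in (2 - delta) &
        forall psi v, H1 Omega psi -> Vdiv Omega v -> \forall t \ae lam1, 0 < t < T ->
          phit t psi + ipm Omega (wgrad Omega (mu t)) (wgrad Omega psi) =
            ipm Omega (u t) (fun x => phi t x *: wgrad Omega psi x) /\
          ut t v
          + ipm Omega (fun x => (nu (phi t x) * 2) *: symgrad Omega (u t) x) (symgrad Omega v)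
          + trilinear Omega (u t) (u t) v =
            - ipm Omega v (fun x => phi t x *: wgrad Omega (mu t) x) + h t v];
  ws_u_initial : \forall x \ae lam, Omega x -> u 0 x = u0 x;
  ws_phi_initial : \forall x \ae lam, Omega x -> phi 0 x = phi0 x }.

Definition global_weak_solution : Prop :=
  [/\ weakly_continuous (Gdiv Omega) (@ipm R d Omega 1 d) u,
    weakly_continuous (L2 Omega) (ip Omega) phi &
    forall T, 0 < T -> weak_solution T].

Definition energy_inequality_from (s : R) : Prop :=
  forall t, s <= t ->
    (energy J F (u t) (phi t) +
     \int[lam1]_(r in `[s, t])
       (2 * ipm Omega (fun x => Num.sqrt (nu (phi r x)) *: symgrad Omega (u r) x)
                  (fun x => Num.sqrt (nu (phi r x)) *: symgrad Omega (u r) x) +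
        ipm Omega (wgrad Omega (mu r)) (wgrad Omega (mu r)))%R%:E
     <= energy J F (u s) (phi s) + \int[lam1]_(r in `[s, t]) (h r (u r))%:E)%E.

Definition energy_inequality : Prop :=
  energy_inequality_from 0 /\
  \forall s \ae lam1, 0 <= s -> energy_inequality_from s.

End solution.
End model.

(* Main.v *)
(* Testing mu against phi - m0, where m0 is the (conserved) mean of phi, and using
   F m >= F s + F' s (m - s) + L (m - s)^2 - C_L for L large (F'' tends to
   infinity), the kernel terms being absorbed by L |phi - m0|^2 and the product
   (mu, phi - m0) by the Poincare-Wirtinger inequality for mu, one finds
     E <= A + |u|^2 / 2 + |nabla mu|^2 / 2,   A = F(m0) |Omega| + C.
   With the Poincare and Korn inequalities for u, half of the viscous dissipation
   absorbs the force and the rest of the dissipation controls k' (E - A)^+, so that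
     E(t) + k' int_s^t (E - A)^+ <= E(s) + int_s^t |h|^2 / (2 nu1)
   for almost every s. A Gronwall argument with time steps of length at most 1,
   started at admissible times s, gives the exponential decay.

   For the Poincare-Wirtinger inequality, call A and B linked when
     int_A int_B |f x - f y|^2 <= C int_Omega |nabla f|^2
   for all f. Sets that see each other along segments in Omega are linked, by
   Fubini and a bound on difference quotients; linkedness is transitive through
   sets of positive measure; near a boundary point, Omega is linked to a box
   inside Omega. Connectedness and compactness then link Omega to itself.

   Energies and dissipations are not assumed to be measurable in time: only the
   monotonicity and the superadditivity of the lower integral of nonnegative
   functions are used for them. *)

Require Import Defs.
From HB Require Import structures.
From mathcomp Require Import all_boot all_order all_algebra.
From mathcomp Require Import all_classical all_reals all_analysis.
From mathcomp Require Import measurable_realfun ring lra.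
Set Implicit Arguments. Unset Strict Implicit. Unset Printing Implicit Defensive.
Import Order.TTheory GRing.Theory Num.Theory.
Import numFieldNormedType.Exports.
Local Open Scope classical_set_scope.
Local Open Scope ring_scope.

(** * Lebesgue measure on row vectors *)

(** The constants must be uniform in the initial data, while the mass m0 is arbitrary: hence a
    tangent inequality for F whose constant depends on L alone, so that m0 survives only in
    F(m0)|Omega|. Since E(z0) - A may be negative, passing from the decay of (E - A)^+ to the stated
    bound also takes lower bounds for E and F.

    The Poincare-Wirtinger inequality is reached without Rellich compactness and without extending
    functions across the boundary; only segments inside Omega and the translation invariance of the
    measure enter.

    A weak derivative is a representative picked by choice, so even its linearity holds only almost
    everywhere and rests on uniqueness, that is, on the du Bois-Reymond lemma. That lemma is proved
    with cutoffs that are products of one-variable functions, for which smoothness, support and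
    commutation of derivatives are explicit. The measure is an iterated product along the first
    coordinate, so its invariance goes by induction on the dimension.

    A real integral is 0 by default when the extended one is infinite; integrability therefore
    precedes every splitting of a real integral. *)

Section boxes.
Variables (R : realType) (n : nat).
Local Notation pt := 'rV[R]_n.

Definition obox (c : pt) (r : R) : set pt :=
  [set y | forall i, `|y ord0 i - c ord0 i| < r].

Definition cbox (c : pt) (r : R) : set pt :=
  [set y | forall i, `|y ord0 i - c ord0 i| <= r].

Lemma ball_rV (c : pt) r : 0 < r -> ball c r = obox c r.
Proof.
move=> r0; rewrite predeqE => y; split.
  by move=> [_ h] i; rewrite distrC; exact: (h ord0 i).
move=> h; split=> // i j; rewrite (ord1 i) /ball /= distrC; exact: h.
Qed.

Lemma obox_open (c : pt) r : open (obox c r).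
Proof.
have [r0|r0] := ltP 0 r; first by rewrite -ball_rV//; exact: ball_open.
(* For r <= 0 the box is empty, except in dimension 0, where the condition on the coordinates is
   vacuous. *)
have [i _|n0] := pickP 'I_n; last first.
  rewrite (_ : obox c r = setT); first exact: openT.
  by rewrite predeqE => y; split => // _ i; have := n0 i.
rewrite (_ : obox c r = set0); first exact: open0.
rewrite predeqE => y; split => // /(_ i) h.
by have := lt_le_trans h r0; rewrite ltNge normr_ge0.
Qed.

(** A countable base of boxes, with rational center and radius 1/(k+1): unions and almost-everywhere
    statements indexed by it stay countable. *)
Definition ratbox (p : 'rV[rat]_n * nat) : pt * R :=
  (map_mx ratr p.1, p.2.+1%:R^-1).

Lemma ratboxP (U : set pt) x : open U -> U x ->
  exists2 p, obox (ratbox p).1 (ratbox p).2 x &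
    cbox (ratbox p).1 (ratbox p).2 `<=` U.
Proof.
move=> oU Ux; have : nbhs x U by exact: open_nbhs_nbhs.
move=> /nbhs_ballP[e /= e0 he].
(* The factor 2: x is within one radius of the rational center, and a point of the closed box within
   another. *)
have [k ke] : exists k : nat, 2 * k.+1%:R^-1 < e.
  have : 0 < e / 2 by rewrite divr_gt0.
  move=> e20; exists (Num.trunc ((e / 2)^-1)).
  rewrite -ltr_pdivlMl// invf_plt ?posrE// mulrC//.
  by rewrite truncnS_gt.
have k0 : 0 < k.+1%:R^-1 :> R by rewrite invr_gt0.
have /choice[c hc] : forall i, exists c : rat, `|x ord0 i - ratr c| < k.+1%:R^-1.
  move=> i; have [|q] := @rat_in_itvoo R (x ord0 i - k.+1%:R^-1) (x ord0 i + k.+1%:R^-1).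
    by rewrite ltrBlDr -addrA ltrDl addr_gt0.
  rewrite in_itv/= => /andP[q1 q2]; exists q.
  by rewrite distrC ltr_distl q1 q2.
exists (\row_i c i, k).
  by move=> i; rewrite !mxE.
move=> y hy; apply: he; rewrite ball_rV//= => i.
have := hy i; have := hc i; rewrite !mxE /= => h1 h2.
rewrite -(subrKA (ratr (c i))).
apply: (le_lt_trans (ler_normD _ _)); rewrite distrC in h1.
by apply: lt_trans ke; rewrite mulrDl mul1r; exact: ler_ltD.
Qed.

Lemma obox_measurable c r : measurable (obox c r).
Proof.
rewrite (_ : obox c r = \bigcap_(i in [set: 'I_n]) ((fun y : pt => `|y ord0 i - c ord0 i|) @^-1` `]-oo, r[)).
  apply: fin_bigcap_measurable => // i _; rewrite -[X in measurable X]setTI.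
  suff : measurable_fun setT (fun y : pt => `|y ord0 i - c ord0 i|) by exact.
  apply: measurableT_comp => //; apply: measurable_funB => //.
  exact: measurable_coord.
rewrite predeqE => y; split=> [h i _ /=|h i]; first by rewrite in_itv/=; exact: h.
by have := h i I; rewrite /= in_itv.
Qed.

Lemma cbox_measurable c r : measurable (cbox c r).
Proof.
rewrite (_ : cbox c r = \bigcap_(i in [set: 'I_n]) ((fun y : pt => `|y ord0 i - c ord0 i|) @^-1` `]-oo, r])).
  apply: fin_bigcap_measurable => // i _; rewrite -[X in measurable X]setTI.
  suff : measurable_fun setT (fun y : pt => `|y ord0 i - c ord0 i|) by exact.
  apply: measurableT_comp => //; apply: measurable_funB => //.
  exact: measurable_coord.
rewrite predeqE => y; split=> [h i _ /=|h i]; first by rewrite in_itv/=; exact: h.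
by have := h i I; rewrite /= in_itv.
Qed.

Lemma obox_sub_cbox c r : obox c r `<=` cbox c r.
Proof. by move=> y h i; apply/ltW/h. Qed.

Lemma open_ratboxE (U : set pt) : open U ->
  U = \bigcup_p (if `[< cbox (ratbox p).1 (ratbox p).2 `<=` U >]
                 then obox (ratbox p).1 (ratbox p).2 else set0).
Proof.
move=> oU; rewrite predeqE => x; split.
  move=> Ux; have [p h1 h2] := ratboxP oU Ux; exists p => //.
  by case: ifPn => //; move/asboolPn.
by move=> [p _]; case: ifPn => // /asboolP h /obox_sub_cbox /h.
Qed.

(** The sigma-algebra is generated by the coordinates, the topology by the max norm; they match
    because an open set is a countable union of rational boxes. *)
Lemma open_measurable_rV (U : set pt) : open U -> measurable U.
Proof.
move=> oU; rewrite (open_ratboxE oU); apply: countable_bigcupT_measurable.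
  exact: countableP.
by move=> p; case: ifPn => _; [exact: obox_measurable|exact: measurable0].
Qed.

Lemma closed_measurable_rV (U : set pt) : closed U -> measurable U.
Proof.
by move=> cU; rewrite -[U]setCK; apply: measurableC; apply: open_measurable_rV; exact: closed_openC.
Qed.

Lemma compact_measurable_rV (U : set pt) : compact U -> measurable U.
Proof.
by move=> cU; apply: closed_measurable_rV; apply: compact_closed => //; exact: norm_hausdorff.
Qed.

Lemma continuous_measurable_rV (f : pt -> R) : continuous f -> measurable_fun setT f.
Proof.
move=> cf; apply: (measurability _ (RGenOpens.measurableE R)) => /= _ [B [a [b ->]] <-].
rewrite setTI; apply: open_measurable_rV; apply: open_comp; last exact: interval_open.
by move=> y _; exact: cf.
Qed.

(** Countably many null sets have a null union. This localizes almost-everywhere statements to boxes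
    whose closure is a compact subset of U, where locally integrable functions are integrable. *)
Lemma ae_ratbox (mu : {measure set pt -> \bar R}) (U : set pt) (P : pt -> Prop) :
  open U ->
  (forall p, cbox (ratbox p).1 (ratbox p).2 `<=` U ->
     \forall x \ae mu, obox (ratbox p).1 (ratbox p).2 x -> P x) ->
  \forall x \ae mu, U x -> P x.
Proof.
move=> oU h.
have : \forall x \ae mu, forall k : nat, forall p, unpickle k = Some p ->
    cbox (ratbox p).1 (ratbox p).2 `<=` U -> obox (ratbox p).1 (ratbox p).2 x -> P x.
  apply/ae_foralln => k; case: (unpickle k) => [p|]; last by apply: aeW => x p.
  case: (pselect (cbox (ratbox p).1 (ratbox p).2 `<=` U)) => [pU|pU].
    by have := h p pU; apply: filterS => x hx _ [<-].
  by apply: aeW => x _ [<-] /pU.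
apply: filterS => x hx Ux; have [p h1 h2] := ratboxP oU Ux.
exact: (hx (pickle p) p (pickleK p)).
Qed.

Lemma cbox_bounded c r : bounded_set (cbox c r).
Proof.
exists (`|c| + `|r|); split; first by rewrite num_real.
move=> M hM y hy /=; apply: le_trans (ltW hM).
rewrite -[y](subrK c); apply: le_trans (ler_normD _ _) _.
rewrite addrC lerD2l [`|y - c|]mx_normrE; apply: bigmax_le => // -[i j] _ /=.
by rewrite (ord1 i) !mxE; apply: (le_trans (hy j)); exact: ler_norm.
Qed.

Lemma cbox_closed c r : closed (cbox c r).
Proof.
rewrite (_ : cbox c r = \bigcap_(i in [set: 'I_n]) ((fun y : pt => `|y ord0 i - c ord0 i|) @^-1` [set x | x <= r])).
  apply: closed_bigI => i _; apply: preimage_closed; last exact: closed_le.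
  move=> y _; apply: (@continuous_comp _ _ _ (fun y : pt => y ord0 i) (fun z => `|z - c ord0 i|)).
    exact: coord_continuous.
  by apply: cvg_norm; apply: cvgB; [exact: cvg_id|exact: cvg_cst].
by rewrite predeqE => y; split=> [h i _ /=|h i]; [exact: h|exact: (h i I)].
Qed.

Lemma cbox_compact c r : compact (cbox c r).
Proof. by apply: bounded_closed_compact; [exact: cbox_bounded|exact: cbox_closed]. Qed.

Lemma bounded_sub_cbox (A : set pt) : bounded_set A -> exists2 r, 0 < r & A `<=` cbox 0 r.
Proof.
move=> [M [_ hM]]; exists (`|M| + 1); first by rewrite ltr_wpDl.
move=> y Ay i; rewrite mxE subr0.
have /hM /(_ y Ay) /= : M < `|M| + 1 by rewrite ltr_pwDr// ler_norm.
apply: le_trans; rewrite [`|y|]mx_normrE.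
by apply: (le_bigmax _ (fun ij => `|y ij.1 ij.2|) (ord0, i)).
Qed.

End boxes.

(** * Invariance of Lebesgue measure under translation and reflection *)

Section affine_invariance.
Variable R : realType.
Local Notation lam1 := (@lebesgue_measure R).

Definition shiftR (v : R) : measurableTypeR R -> measurableTypeR R := fun x => x + v.

Lemma measurable_shiftR v : measurable_fun setT (shiftR v).
Proof. by apply: (@measurable_funD _ (measurableTypeR R) R setT id (cst v)). Qed.

HB.instance Definition _ v := isMeasurableFun.Build _ _ _ _ (shiftR v) (measurable_shiftR v).

Lemma lebesgue_measure_shift v (A : set R) : measurable A ->
  pushforward lam1 (shiftR v) A = lam1 A.
Proof.
move=> mA; apply/esym/lebesgue_measure_unique => //= _ [[a b]] _ <-.
rewrite /pushforward.
rewrite (_ : shiftR v @^-1` _ = `]a - v, b - v]%classic); last first.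
  by rewrite predeqE => x /=; rewrite /shiftR !in_itv/= ltrBlDr lerBrDr.
rewrite !lebesgue_measure_itv/= !lte_fin ltrD2r -!EFinB.
by case: ifPn => // _; congr (_%:E); lra.
Qed.

Lemma ge0_integral_shiftR v (f : R -> \bar R) : measurable_fun setT f ->
  (forall x, (0 <= f x)%E) -> (\int[lam1]_x f (x + v)%R = \int[lam1]_x f x)%E.
Proof.
move=> mf f0; transitivity (\int[pushforward lam1 (shiftR v)]_x f x)%E.
  by rewrite ge0_integral_pushforward//; exact: measurable_shiftR.
by apply: eq_measure_integral => A mA _; exact: lebesgue_measure_shift.
Qed.

Lemma ge0_integral_oppR (f : R -> \bar R) : measurable_fun setT f ->
  (forall x, (0 <= f x)%E) -> (\int[lam1]_x f (- x)%R = \int[lam1]_x f x)%E.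
Proof.
move=> mf f0; transitivity (\int[pushforward lam1 (-%R : _ -> measurableTypeR R)]_x f x)%E.
  by rewrite ge0_integral_pushforward//.
by apply: eq_measure_integral => A mA _; exact: lebesgue_measureN.
Qed.

(** Tonelli for the product measure behind [mcons]: it peels off the first coordinate and drives the
    inductions on the dimension below. *)
Lemma ge0_integral_leb_cons n (f : 'rV[R]_n.+1 -> \bar R) : measurable_fun setT f ->
  (forall x, (0 <= f x)%E) ->
  (\int[leb R n.+1]_x f x = \int[lam1]_a \int[leb R n]_y f (rV_cons (a, y)))%E.
Proof.
move=> mf f0.
transitivity (\int[lam1 \x leb R n]_p f (rV_cons p))%E.
  transitivity (\int[pushforward (lam1 \x leb R n) (@rV_cons R n)]_x f x)%E => //.
  by rewrite ge0_integral_pushforward//; exact: measurable_rV_cons.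
rewrite fubini_tonelli1//.
by apply: measurableT_comp => //; exact: measurable_rV_cons.
Qed.

Lemma measurable_integral_rV_cons n (f : 'rV[R]_n.+1 -> \bar R) : measurable_fun setT f ->
  (forall x, (0 <= f x)%E) ->
  measurable_fun setT (fun a => \int[leb R n]_y f (rV_cons (a, y)))%E.
Proof.
move=> mf f0.
apply: (@measurable_fun_fubini_tonelli_F _ _ _ _ _ (leb R n) (f \o @rV_cons R n)) => //.
  by apply: measurableT_comp => //; exact: measurable_rV_cons.
by move=> x /=.
Qed.

Lemma rV_consD n (a b : R) (x y : 'rV[R]_n) :
  rV_cons (a, x) + rV_cons (b, y) = rV_cons (a + b, x + y).
Proof.
apply/rowP => i; rewrite !mxE.
by case: unliftP => [j|] _ //=; rewrite mxE.
Qed.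

Lemma rV_consN n (a : R) (x : 'rV[R]_n) : - rV_cons (a, x) = rV_cons (- a, - x).
Proof.
apply/rowP => i; rewrite !mxE.
by case: unliftP => [j|] _ //=; rewrite mxE.
Qed.

Lemma measurable_shift_rV n (v : 'rV[R]_n) : measurable_fun setT (fun x : 'rV[R]_n => x + v).
Proof.
apply: measurable_rV => i; under eq_fun do rewrite mxE.
by apply: measurable_funD => //; exact: measurable_coord.
Qed.

Lemma measurable_opp_rV n : measurable_fun setT (fun x : 'rV[R]_n => - x).
Proof.
apply: measurable_rV => i; under eq_fun do rewrite mxE.
by apply: measurableT_comp => //; exact: measurable_coord.
Qed.

Lemma measurable_addf_rV d (T : measurableType d) n (f g : T -> 'rV[R]_n) :
  measurable_fun setT f -> measurable_fun setT g -> measurable_fun setT (fun x => f x + g x).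
Proof.
move=> mf mg; apply: measurable_rV => i; under eq_fun do rewrite mxE.
apply: measurable_funD.
  by apply: (measurableT_comp (measurable_coord i)).
by apply: (measurableT_comp (measurable_coord i)).
Qed.

Lemma measurable_scalef_rV d (T : measurableType d) n (f : T -> R) (g : T -> 'rV[R]_n) :
  measurable_fun setT f -> measurable_fun setT g -> measurable_fun setT (fun x => f x *: g x).
Proof.
move=> mf mg; apply: measurable_rV => i; under eq_fun do rewrite mxE.
apply: measurable_funM => //.
by apply: (measurableT_comp (measurable_coord i)).
Qed.

Lemma ge0_integral_shift n (v : 'rV[R]_n) (f : 'rV[R]_n -> \bar R) : measurable_fun setT f ->
  (forall x, (0 <= f x)%E) -> (\int[leb R n]_x f (x + v)%R = \int[leb R n]_x f x)%E.
Proof.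
elim: n v f => [|n IH] v f mf f0.
  by apply: eq_integral => x _; congr f; apply/rowP => -[].
rewrite ge0_integral_leb_cons//; last first.
  by apply: (measurableT_comp mf); exact: measurable_shift_rV.
rewrite -(rV_unconsK v); case: (rV_uncons v) => b w.
under eq_integral do under eq_integral do rewrite rV_consD.
pose g a := (\int[leb R n]_y f (rV_cons (a, y)))%E.
rewrite (ge0_integral_leb_cons mf f0); transitivity (\int[lam1]_a g (a + b)%R)%E; last first.
  rewrite ge0_integral_shiftR//; first exact: measurable_integral_rV_cons.
  by move=> x; exact: integral_ge0.
apply: eq_integral => a _; apply: (IH w (fun y => f (rV_cons (a + b, y)))) => //.
apply: (measurableT_comp mf); apply: (measurableT_comp (@measurable_rV_cons R n)).
exact: measurable_pair1.
Qed.

Lemma ge0_integral_opp n (f : 'rV[R]_n -> \bar R) : measurable_fun setT f ->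
  (forall x, (0 <= f x)%E) -> (\int[leb R n]_x f (- x)%R = \int[leb R n]_x f x)%E.
Proof.
elim: n f => [|n IH] f mf f0.
  by apply: eq_integral => x _; congr f; apply/rowP => -[].
rewrite ge0_integral_leb_cons//; last first.
  by apply: (measurableT_comp mf); exact: measurable_opp_rV.
under eq_integral do under eq_integral do rewrite rV_consN.
pose g a := (\int[leb R n]_y f (rV_cons (a, y)))%E.
rewrite (ge0_integral_leb_cons mf f0); transitivity (\int[lam1]_a g (- a)%R)%E; last first.
  rewrite ge0_integral_oppR//; first exact: measurable_integral_rV_cons.
  by move=> x; exact: integral_ge0.
apply: eq_integral => a _; apply: (IH (fun y => f (rV_cons (- a, y)))) => //.
apply: (measurableT_comp mf); apply: (measurableT_comp (@measurable_rV_cons R n)).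
exact: measurable_pair1.
Qed.

Lemma integral_indicT d (T : measurableType d) (mu : {measure set T -> \bar R}) (A : set T) :
  measurable A -> (\int[mu]_x (\1_A x)%:E = mu A)%E.
Proof. by move=> mA; rewrite integral_indic// setIT. Qed.

Lemma integral1T d (T : measurableType d) (mu : {measure set T -> \bar R}) :
  (\int[mu]_x 1 = mu setT)%E.
Proof. by rewrite integral_cst// mul1e. Qed.

Lemma leb_shift n (v : 'rV[R]_n) (A : set 'rV[R]_n) : measurable A ->
  leb R n [set x | A (x + v)] = leb R n A.
Proof.
move=> mA; have mAv : measurable [set x | A (x + v)].
  by rewrite -[X in measurable X]setTI; exact: measurable_shift_rV.
have : (\int[leb R n]_x (\1_A (x + v)%R)%:E = \int[leb R n]_x (\1_A x)%:E)%E.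
  apply: (@ge0_integral_shift n v (fun x => (\1_A x)%:E)) => [|x].
    by apply/measurable_EFinP; exact: measurable_indic.
  by rewrite lee_fin.
rewrite (integral_indicT _ mA) => <-; rewrite -(integral_indicT _ mAv).
congr (integral _ _ _); by apply/funext => x; rewrite !indicE; congr ((nat_of_bool _)%:R%:E); apply/idP/idP => /set_mem h; apply/mem_set.
Qed.

Lemma leb0E (A : set 'rV[R]_0) : leb R 0 A = (\1_A 0)%:E.
Proof. by []. Qed.

Lemma leb_cbox n (c : 'rV[R]_n) r : (leb R n (cbox c r) < +oo)%E.
Proof.
elim: n c => [|n IH] c; first by rewrite leb0E ltry.
have -> : leb R n.+1 (cbox c r) =
    (\int[lam1]_a \int[leb R n]_y (\1_(cbox c r) (rV_cons (a, y)))%:E)%E.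
  rewrite -(@ge0_integral_leb_cons n (fun x => (\1_(cbox c r) x)%:E)).
  - by rewrite integral_indic// ?setIT//; exact: cbox_measurable.
  - by apply/measurable_EFinP; exact: measurable_indic (cbox_measurable _ _).
  - by move=> x; rewrite lee_fin.
rewrite -(rV_unconsK c); case: (rV_uncons c) => b w.
have -> : (\int[lam1]_a \int[leb R n]_y (\1_(cbox (rV_cons (b, w)) r) (rV_cons (a, y)))%:E)%E =
    (\int[lam1]_a (leb R n (cbox w r) * (\1_(`[b - r, b + r]%classic) a)%:E))%E.
  apply: eq_integral => a _.
  transitivity (\int[leb R n]_y ((\1_(`[b - r, b + r]%classic) a)%:E * (\1_(cbox w r) y)%:E))%E.
    apply: eq_integral => y _; rewrite -EFinM !indicE -natrM mulnb; congr (_%:R%:E); congr (nat_of_bool _).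
    apply/idP/idP.
      move=> /set_mem h; apply/andP; split; apply/mem_set => /=.
        by have := h ord0; rewrite !mxE unlift_none /= in_itv/= -ler_distl.
      by move=> i; have := h (lift ord0 i); rewrite !mxE liftK.
    move=> /andP[/set_mem h1 /set_mem h2]; apply/mem_set => i; rewrite !mxE.
    case: unliftP => [j|] _ /=; first exact: h2.
    by move: h1; rewrite /= in_itv/= -ler_distl.
  rewrite ge0_integralZl//.
  - by rewrite integral_indicT 1?muleC//; exact: cbox_measurable.
  - by apply/measurable_EFinP; exact: measurable_indic (cbox_measurable _ _).
have mI : measurable (`[b - r, b + r]%classic : set R) by [].
rewrite -(fineK (_ : leb R n (cbox w r) \is a fin_num)); last by rewrite ge0_fin_numE.
rewrite ge0_integralZl//; last first.
- by rewrite lee_fin fine_ge0.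
- by apply/measurable_EFinP; exact: measurable_indic.
set X := (X in (_ * X)%E); have -> : X = lam1 `[b - r, b + r] by exact: integral_indicT.
rewrite lebesgue_measure_itv/=.
by case: ifP => _; rewrite ?mule0 ?ltry// -EFinD -EFinM ltry.
Qed.

Lemma leb_bounded n (A : set 'rV[R]_n) : measurable A -> bounded_set A -> (leb R n A < +oo)%E.
Proof.
move=> mA /bounded_sub_cbox[r r0 Ar]; apply: le_lt_trans (leb_cbox 0 r).
by apply: le_measure => //; rewrite inE//; exact: cbox_measurable.
Qed.

(** If the box were null, so would be its countably many rational translates, which cover the space.
    But the whole space is not null, by induction on the dimension from the Dirac mass in dimension
    0. *)
Lemma leb_obox_gt0 n (c : 'rV[R]_n) r : 0 < r -> (0 < leb R n (obox c r))%E.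
Proof.
move=> r0; rewrite lt0e measure_ge0 andbT; apply/negP => /eqP h0.
have : leb R n setT = 0%E.
  have cov : (setT : set 'rV[R]_n) `<=` \bigcup_q [set x | obox c r (x + map_mx ratr (q : 'rV[rat]_n))].
    move=> x _; have /choice[q hq] : forall i, exists q : rat, `|(x ord0 i + ratr q) - c ord0 i| < r.
      move=> i; have [|q] := @rat_in_itvoo R (c ord0 i - x ord0 i - r) (c ord0 i - x ord0 i + r).
        by rewrite ltrD2l; lra.
      rewrite in_itv/= => /andP[q1 q2]; exists q.
      by rewrite ltr_distl; apply/andP; split; lra.
    by exists (\row_i q i) => //= i; rewrite !mxE.
  have n0 (q : 'rV[rat]_n) : leb R n [set x | obox c r (x + map_mx ratr q)] = 0%E.
    by rewrite leb_shift//; exact: obox_measurable.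
  have mq (q : 'rV[rat]_n) : measurable [set x : 'rV[R]_n | obox c r (x + map_mx ratr q)].
    by rewrite -[X in measurable X]setTI; apply: measurable_shift_rV => //; exact: obox_measurable.
  pose G k := if unpickle k is Some q then [set x : 'rV[R]_n | obox c r (x + map_mx ratr (q : 'rV[rat]_n))] else set0.
  apply/eqP; rewrite -measure_le0.
  apply: le_trans (_ : (leb R n (\bigcup_k G k) <= 0)%E).
    apply: le_measure; rewrite ?inE//.
      by apply: bigcupT_measurable => k; rewrite /G; case: unpickle.
    move=> x /cov[q _ hq]; exists (pickle q) => //.
    by rewrite /G pickleK.
  rewrite measure_le0; apply/eqP/negligibleP.
    by apply: bigcupT_measurable => k; rewrite /G; case: unpickle.
  apply: negligible_bigcup => k; rewrite /G; case: unpickle => [q|]; last exact: negligible_set0.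
  by apply/negligibleP; [exact: mq|exact: n0].
suff : leb R n setT != 0%E by move/[swap] => ->; rewrite eqxx.
elim: (n) => [|m IH]; first by rewrite leb0E indicT /= eqe oner_eq0.
apply/negP => /eqP h.
have : (\int[lam1]_a \int[leb R m]_y (1%E : \bar R) = 0)%E.
  rewrite -(@ge0_integral_leb_cons m (fun _ => 1%E))//.
  exact: etrans (integral1T _) h.
have -> : (\int[lam1]_a \int[leb R m]_y (1%E : \bar R) = leb R m setT * lam1 setT)%E.
  under eq_integral do rewrite integral1T.
  exact: integral_cst.
rewrite (_ : lam1 setT = +oo%E); last by rewrite -set_itvNyy lebesgue_measure_itv.
move=> /eqP; rewrite mule_eq0 (negbTE IH) /= => /eqP //.
Qed.

End affine_invariance.

(** * Bump functions *)

Section smooth1.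
Variable R : realType.
Implicit Types f g : R -> R.

Record smooth1 f : Prop := Smooth1 {
  derivable_smooth1 : forall n (x : R), derivable (derive1n n f) x 1 }.

(** Spares all formulas for n-th derivatives: smoothness follows as soon as the function lies in
    some class stable under differentiation, and each closure property below exhibits such a
    class. *)
Lemma smooth1_coind (C : (R -> R) -> Prop) :
  (forall f, C f -> exists2 g, C g & forall x : R, is_derive x 1 f (g x)) ->
  forall f, C f -> smooth1 f.
Proof.
move=> h f Cf; have hn n : C (derive1n n f).
  elim: n => [//|n IH]; rewrite derive1nS; have [g Cg hg] := h _ IH.
  rewrite (_ : derive1 _ = g)//; apply/funext => x.
  by rewrite derive1E; have [_ <-] := hg x.
by split=> n x; have [g Cg hg] := h _ (hn n); have [] := hg x.
Qed.

Lemma smooth1_derive f : smooth1 f -> smooth1 (derive1 f).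
Proof. by move=> sf; split=> n x; rewrite -derive1Sn; exact: (@derivable_smooth1 _ sf n.+1 x). Qed.

Lemma smooth1_is_derive f (x : R) : smooth1 f -> is_derive x 1 f (derive1 f x).
Proof. by move=> sf; apply: DeriveDef; [exact: (@derivable_smooth1 _ sf 0%N)|rewrite derive1E]. Qed.

Lemma smooth1_continuous f : smooth1 f -> continuous f.
Proof. by move=> sf x; apply/differentiable_continuous/derivable1_diffP/(@derivable_smooth1 _ sf 0%N). Qed.

Lemma smooth1D f g : smooth1 f -> smooth1 g -> smooth1 (fun x => f x + g x).
Proof.
move=> sf sg.
apply: (@smooth1_coind (fun h => exists f g, [/\ smooth1 f, smooth1 g & h = (fun x => f x + g x)])); last by exists f, g.
move=> _ [{sf}f [{sg}g [sf sg ->]]]; exists (fun x => derive1 f x + derive1 g x).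
  by exists (derive1 f), (derive1 g); split => //; exact: smooth1_derive.
by move=> x; apply: is_deriveD; exact: smooth1_is_derive.
Qed.

Lemma smooth1_affine f (c k m : R) : smooth1 f -> smooth1 (fun x => c * f (k * x + m)).
Proof.
move=> sf.
apply: (@smooth1_coind (fun h => exists c f, smooth1 f /\ h = (fun x => c * f (k * x + m)))); last by exists c, f.
move=> _ [{}c [{sf}f [sf ->]]]; exists (fun x => c * k * derive1 f (k * x + m)).
  by exists (c * k), (derive1 f); split => //; exact: smooth1_derive.
move=> x; have h1 : is_derive x 1 (fun x : R => k * x + m) k.
  by apply: is_derive_eq; rewrite addr0 [_ *: _]mulr1.
have h2 := smooth1_is_derive (k * x + m) sf.
have := @is_derive1_comp R f (fun y : R => k * y + m) x _ _ h2 h1 => /(is_deriveZ c)/is_derive_eq; apply.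
by rewrite /GRing.scale /= mulrA mulrAC.
Qed.

(** Products alone are not stable under differentiation, sums of products are. *)
Inductive sum_of_products : (R -> R) -> Prop :=
| sum_of_products1 f g : smooth1 f -> smooth1 g -> sum_of_products (fun x => f x * g x)
| sum_of_productsD a b : sum_of_products a -> sum_of_products b -> sum_of_products (fun x => a x + b x).

Lemma smooth1M f g : smooth1 f -> smooth1 g -> smooth1 (fun x => f x * g x).
Proof.
move=> sf sg; apply: (@smooth1_coind sum_of_products); last exact: sum_of_products1.
move=> h; elim=> [f0 g0 sf0 sg0|a b _ [a' ? ha] _ [b' ? hb]].
  exists (fun x => (f0 x * derive1 g0 x + g0 x * derive1 f0 x)).
    by apply: sum_of_productsD; apply: sum_of_products1 => //; exact: smooth1_derive.
  by move=> x; apply: is_deriveM; exact: smooth1_is_derive.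
exists (fun x => a' x + b' x); first exact: sum_of_productsD.
by move=> x; apply: is_deriveD.
Qed.

Lemma smooth1_cst (c : R) : smooth1 (fun=> c).
Proof.
apply: (@smooth1_coind (fun h => exists c, h = fun=> c)); last by exists c.
by move=> _ [{}c ->]; exists (fun=> 0); [exists 0|move=> x; exact: is_derive_cst].
Qed.

Lemma smooth1_div f g : smooth1 f -> smooth1 g -> (forall x, 0 < g x) ->
  smooth1 (fun x => f x / g x).
Proof.
move=> sf sg g0.
(* All powers of 1/g have to be allowed: each differentiation raises the exponent by one, the
   numerator staying smooth. *)
apply: (@smooth1_coind (fun h => exists n f, smooth1 f /\ h = (fun x => f x * (g x)^-1 ^+ n.+1))); last first.
  by exists 0%N, f; split => //; apply/funext => x; rewrite expr1.
move=> _ [n [{sf}f [sf ->]]].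
exists (fun x => (derive1 f x * g x + (- n.+1%:R * f x) * derive1 g x) * (g x)^-1 ^+ n.+2).
  exists n.+1, (fun x => derive1 f x * g x + (- n.+1%:R * f x) * derive1 g x); split => //.
  apply: smooth1D; apply: smooth1M => //; try exact: smooth1_derive.
  by apply: smooth1M => //; exact: smooth1_cst.
move=> x; have gx : g x != 0 by rewrite gt_eqF.
have hf := smooth1_is_derive x sf; have hg := smooth1_is_derive x sg.
have hi : is_derive x 1 (fun y => (g y)^-1) (- (g x) ^- 2 *: derive1 g x) by exact: is_deriveV.
have hX : is_derive x 1 (fun y : R => (g y)^-1 ^+ n.+1)
    ((n.+1%:R * (g x)^-1 ^+ n) *: (- (g x) ^- 2 *: derive1 g x)).
  rewrite (_ : (fun y : R => _) = (fun y : R => (g y)^-1) ^+ n.+1); first exact: is_deriveX.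
  by apply/funext => y; rewrite exprfctE.
have /is_derive_eq := is_deriveM hf hX; apply.
have -> : g x ^- 2 = (g x)^-1 ^+ 2 by rewrite exprVn.
have e : g x * (g x)^-1 ^+ n.+2 = (g x)^-1 ^+ n.+1 by rewrite exprS mulrA divff// mul1r.
rewrite /GRing.scale /= mulrDl -[X in _ = X + _]mulrA e.
by move: (g x)^-1 n.+1%:R => w N; rewrite !exprS; ring.
Qed.

Lemma is_derive_quadratic0 f (C : R) : (forall x, `|f x| <= C * x ^+ 2) -> is_derive (0 : R) 1 f 0.
Proof.
move=> hf; have C0 : 0 <= C by have := hf 1; rewrite expr1n mulr1; apply: le_trans.
have f0 : f 0 = 0 by apply/eqP; rewrite -normr_eq0 eq_le normr_ge0 andbT; have := hf 0; rewrite expr0n mulr0.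
suff h : h^-1 *: ((f \o shift 0) (h *: 1) - f 0) @[h --> 0^'] --> (0 : R).
  by apply: DeriveDef; [apply/cvg_ex; exists 0|exact/cvg_lim].
have [Ceq0|Cneq0] := eqVneq C 0.
  have -> : f = cst 0.
    apply/funext => y; apply/eqP; rewrite -normr_eq0 eq_le normr_ge0 andbT.
    by have := hf y; rewrite Ceq0 mul0r.
  by rewrite [X in X @ _](_ : _ = cst 0); [exact: cvg_cst|apply/funext => y; rewrite /= subrr scaler0].
apply/cvgr0Pnorm_le => e e0; have eC : 0 < e / C by rewrite divr_gt0// lt_def Cneq0.
near=> h.
rewrite /= f0 subr0 addr0 [h%:A]mulr1 normrZ normfV.
have h0 : h != 0 by near: h; exact: nbhs_dnbhs_neq.
rewrite ler_pdivrMl ?normr_gt0//; apply: (le_trans (hf h)).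
rewrite -real_normK ?num_real// expr2 mulrA [leRHS]mulrC ler_wpM2r//.
rewrite -ler_pdivlMl ?lt_def ?Cneq0// mulrC.
near: h; exact: dnbhs0_le.
Unshelve. all: by end_near. Qed.

(* Derivatives of P(1/x) exp(-1/x) are of the same form, hence the smoothness at 0. *)
Definition flatpoly (P : {poly R}) (x : R) : R :=
  if 0 < x then P.[x^-1] * expR (- x^-1) else 0.

(** With v = 1/x, the monomial v^i is beaten by exp v >= v^(i+2) / (i+2)!, a single term of the
    series. The two extra powers of v become x^2, whence a zero derivative at 0. *)
Lemma flatpoly_bound P : exists C : R, forall x, `|flatpoly P x| <= C * x ^+ 2.
Proof.
exists (\sum_(i < size P) `|P`_i| * (i.+2)`!%:R) => x.
rewrite /flatpoly; case: ifPn => [x0|_]; last first.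
  rewrite normr0 mulr_ge0 ?sqr_ge0//; apply: sumr_ge0 => i _.
  by rewrite mulr_ge0.
rewrite horner_coef mulr_suml mulr_suml; apply: le_trans (ler_norm_sum _ _ _) _.
apply: ler_sum => i _; rewrite !normrM -!mulrA ler_wpM2l//.
have v0 : 0 <= x^-1 by rewrite invr_ge0 ltW.
rewrite ger0_norm ?exprn_ge0// ger0_norm ?expR_ge0// expRN.
rewrite ler_pdivrMr ?expR_gt0//.
have := @expR_ge1Dxn R x^-1 i.+1 v0 => h.
have F0 : (0 : R) < (i.+2)`!%:R by rewrite ltr0n fact_gt0.
have : x^-1 ^+ i.+2 / (i.+2)`!%:R <= expR x^-1 by apply: le_trans h; rewrite lerDr.
rewrite ler_pdivrMr// => h2.
have : x ^+ 2 * x^-1 ^+ i.+2 <= x ^+ 2 * (expR x^-1 * (i.+2)`!%:R).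
  by rewrite ler_wpM2l// exprn_ge0// ltW.
rewrite -{1}(addn2 i) exprD mulrCA -[x ^+ 2 * x^-1 ^+ 2]exprMn divff ?gt_eqF// expr1n mulr1.
by move=> /le_trans; apply; rewrite [expR _ * _]mulrC mulrA [x ^+ 2 * _]mulrC.
Qed.

(** The polynomial X^2 (P - P') is the chain rule in the variable 1/x, whose derivative is -
    (1/x)^2. At 0 the quadratic bound takes over. *)
Lemma flatpoly_is_derive P (x : R) : is_derive x 1 (flatpoly P) (flatpoly ('X^2 * (P - P^`())) x).
Proof.
have [x0|x0|->] := ltgtP x 0.
- rewrite /flatpoly ltNge (ltW x0) /=.
  apply: (@near_eq_is_derive _ _ _ (cst 0)).
    near=> y; rewrite ifF//; apply/negbTE; rewrite -leNgt; apply/ltW.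
    by near: y; exact: lt_nbhsl.
- rewrite /flatpoly x0.
  apply: (@near_eq_is_derive _ _ _ (fun y : R => P.[y^-1] * expR (- y^-1))).
    by near=> y; rewrite ifT//; near: y; exact: lt_nbhsr.
  have xn : x != 0 by rewrite gt_eqF.
  have hv : is_derive x 1 (fun y : R => y^-1) (- x ^- 2 *: (1 : R)) by exact: is_deriveV.
  have hp : is_derive x^-1 1 (fun y => P.[y]) (P^`().[x^-1]) by exact: is_derive_poly.
  have h1 := is_derive1_comp hp hv.
  have h2 := @is_derive1_comp R expR (fun y : R => - y^-1) x _ _ (is_derive_expR (- x^-1)) (is_deriveN hv).
  have /is_derive_eq := is_deriveM h1 h2; apply.
  rewrite /GRing.scale /= !hornerE /=; field.
  by [].
- rewrite {2}/flatpoly ltxx; have [C hC] := flatpoly_bound P.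
  exact: is_derive_quadratic0 hC.
Unshelve. all: by end_near. Qed.

Lemma flatpoly_smooth P : smooth1 (flatpoly P).
Proof.
apply: (@smooth1_coind (fun h => exists P, h = flatpoly P)); last by exists P.
move=> _ [Q ->]; exists (flatpoly ('X^2 * (Q - Q^`()))); first by eexists.
by move=> x; exact: flatpoly_is_derive.
Qed.

(** The usual smooth transition from 0 (for x <= 0) to 1 (for x >= 1). It yields both the cutoffs in
    space, [step_bump], and those in time, [ramp]. *)
Definition smooth_step (x : R) : R := flatpoly 1 x / (flatpoly 1 x + flatpoly 1 (1 - x)).

Lemma flatpoly1_ge0 x : 0 <= flatpoly 1 x.
Proof. by rewrite /flatpoly; case: ifP => // _; rewrite hornerE mul1r expR_ge0. Qed.

Lemma flatpoly1_gt0 x : 0 < x -> 0 < flatpoly 1 x.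
Proof. by rewrite /flatpoly => ->; rewrite hornerE mul1r expR_gt0. Qed.

Lemma flatpoly_le0 P x : x <= 0 -> flatpoly P x = 0.
Proof. by rewrite /flatpoly ltNge => ->. Qed.

Lemma smooth_step_den x : 0 < flatpoly 1 x + flatpoly 1 (1 - x).
Proof.
have [x0|x0] := ltP 0 x; first by rewrite ltr_pwDl ?flatpoly1_gt0 ?flatpoly1_ge0.
by rewrite ltr_wpDl ?flatpoly1_ge0// flatpoly1_gt0//; lra.
Qed.

Lemma smooth_step_smooth : smooth1 smooth_step.
Proof.
apply: smooth1_div; [exact: flatpoly_smooth| |exact: smooth_step_den].
apply: smooth1D; first exact: flatpoly_smooth.
rewrite (_ : (fun _ => _) = (fun x => 1 * flatpoly 1 (-1 * x + 1))).
  by apply: smooth1_affine; exact: flatpoly_smooth.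
by apply/funext => x; rewrite mul1r mulN1r addrC.
Qed.

Lemma smooth_step_le0 x : x <= 0 -> smooth_step x = 0.
Proof. by move=> x0; rewrite /smooth_step flatpoly_le0// mul0r. Qed.

Lemma smooth_step_ge1 x : 1 <= x -> smooth_step x = 1.
Proof.
move=> x1; rewrite /smooth_step [flatpoly 1 (1 - x)]flatpoly_le0 ?subr_le0// addr0 divff//.
by rewrite gt_eqF// flatpoly1_gt0// (lt_le_trans ltr01).
Qed.

Lemma smooth_step_itv x : 0 <= smooth_step x <= 1.
Proof.
have D0 := smooth_step_den x.
rewrite /smooth_step divr_ge0 ?flatpoly1_ge0 ?(ltW D0)//=.
by rewrite ler_pdivrMr ?smooth_step_den// mul1r lerDl flatpoly1_ge0.
Qed.

End smooth1.

(** * Directional derivatives and cutoffs of boxes *)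

Section directional.
Variables (R : realType) (n : nat).
Local Notation pt := 'rV[R]_n.
Local Notation e_ i := (delta_mx ord0 i : pt).

Lemma is_derive_line (f : pt -> R) (x v : pt) (l : R) :
  is_derive (0 : R) 1 (fun t : R => f (t *: v + x)) l <-> is_derive x v f l.
Proof.
have E : (fun h : R => h^-1 *: (((fun t : R => f (t *: v + x)) \o shift 0) (h *: 1) - f (0 *: v + x)))
       = (fun h : R => h^-1 *: ((f \o shift x) (h *: v) - f x)).
  by apply/funext => h /=; rewrite addr0 [h *: 1]mulr1 scale0r add0r.
split=> -[d l'].
- by apply: DeriveDef; move: d l'; rewrite /derivable /derive E.
- by apply: DeriveDef; rewrite /derivable /derive E.
Qed.

Lemma is_derive_along (f : pt -> R) (x v : pt) (s : R) (l : R) :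
  is_derive (s *: v + x) v f l -> is_derive s 1 (fun t : R => f (t *: v + x)) l.
Proof.
move=> /is_derive_line h.
have h1 : is_derive s 1 (fun t : R => t - s) 1.
  by apply: is_derive_eq; rewrite subr0.
have h2 : is_derive (s - s) 1 (fun t : R => f (t *: v + (s *: v + x))) l by rewrite subrr.
have := @is_derive1_comp R _ (fun t : R => t - s) s _ _ h2 h1; rewrite mulr1.
rewrite (_ : _ \o _ = (fun t : R => f (t *: v + x)))//.
by apply/funext => t /=; rewrite addrA -scalerDl subrK.
Qed.

Lemma prodfun_differentiable (I : Type) (s : seq I) (f : I -> pt -> R) x :
  (forall i, differentiable (f i) x) -> differentiable (fun y => \prod_(i <- s) f i y) x.
Proof.
move=> df; elim: s => [|i s IH].
  under eq_fun do rewrite big_nil; exact: differentiable_cst.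
under eq_fun do rewrite big_cons; exact: differentiableM.
Qed.

(** A class of functions stable under partial derivatives and rich enough to contain cutoffs of
    boxes; it reduces smoothness in n variables to [smooth1]. *)
Definition prodfun (f : 'I_n -> R -> R) (x : pt) : R := \prod_i f i (x ord0 i).

Lemma prodfun_diff (f : 'I_n -> R -> R) x : (forall i, smooth1 (f i)) -> differentiable (prodfun f) x.
Proof.
move=> sf; apply: (@prodfun_differentiable _ _ (fun i (y : pt) => f i (y ord0 i))) => i.
apply: (@differentiable_comp _ _ _ _ (fun y : pt => y ord0 i) (f i)).
  exact: differentiable_coord.
by apply/derivable1_diffP; exact: (@derivable_smooth1 _ _ (sf i) 0%N).
Qed.

Lemma prodfun_is_derive (f : 'I_n -> R -> R) x j : (forall i, smooth1 (f i)) ->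
  is_derive x (e_ j) (prodfun f) (prodfun (fun i => if i == j then derive1 (f i) else f i) x).
Proof.
move=> sf; apply/is_derive_line.
pose C := \prod_(i | i != j) f i (x ord0 i).
have E t : prodfun f (t *: e_ j + x) = C * f j (1 * t + x ord0 j).
  rewrite /prodfun (bigD1 j)//= mulrC !mxE !eqxx /= mulr1 mul1r; congr (_ * _).
  apply: eq_bigr => i ij; rewrite !mxE eqxx /= (negbTE ij) mulr0 add0r//.
under eq_fun do rewrite E.
rewrite /prodfun (bigD1 j)//= eqxx mulrC.
rewrite (eq_bigr (fun i => f i (x ord0 i))); last by move=> i /negbTE ->.
rewrite -/C; have h2 : is_derive (1 * 0 + x ord0 j) 1 (f j) (derive1 (f j) (x ord0 j)).
  by rewrite mul1r add0r; exact: smooth1_is_derive.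
have h1 : is_derive (0 : R) 1 (fun t : R => 1 * t + x ord0 j) 1.
  by apply: is_derive_eq; rewrite addr0 [_ *: _]mulr1.
have := @is_derive1_comp R (f j) (fun t : R => 1 * t + x ord0 j) 0 _ _ h2 h1.
by move=> /(is_deriveZ C)/is_derive_eq; apply; rewrite mulr1.
Qed.

Lemma prodfun_partial (f : 'I_n -> R -> R) j : (forall i, smooth1 (f i)) ->
  partial j (prodfun f) = prodfun (fun i => if i == j then derive1 (f i) else f i).
Proof. by move=> sf; apply/funext => x; have [_] := prodfun_is_derive x j sf. Qed.

Lemma iter_partial_prodfun (f : 'I_n -> R -> R) s : (forall i, smooth1 (f i)) ->
  exists2 g, forall i, smooth1 (g i) & iter_partial s (prodfun f) = prodfun g.
Proof.
move=> sf; elim: s => [|j s [g sg E]]; first by exists f.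
rewrite /= E; rewrite prodfun_partial//.
exists (fun i => if i == j then derive1 (g i) else g i) => // i.
by case: ifP => _ //; exact: smooth1_derive.
Qed.

Lemma prodfun_smooth (f : 'I_n -> R -> R) : (forall i, smooth1 (f i)) -> smooth (prodfun f).
Proof.
move=> sf k s; have [g sg ->] := iter_partial_prodfun s sf; split=> [_ x|_ x i].
  by apply: differentiable_continuous; exact: prodfun_diff.
exact: diff_derivable (prodfun_diff _ _).
Qed.

Definition rect (a b : pt) : set pt :=
  [set x | forall i, a ord0 i < x ord0 i < b ord0 i].

Definition crect (a b : pt) : set pt :=
  [set x | forall i, a ord0 i <= x ord0 i <= b ord0 i].

Lemma rect_open a b : open (rect a b).
Proof.
rewrite openE => x rx; rewrite /interior.
have : nbhs x [set y : pt | forall i : 'I_n, a ord0 i < y ord0 i < b ord0 i].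
  apply: (@filter_forall _ _ (fun (i : 'I_n) (y : pt) => is_true (a ord0 i < y ord0 i < b ord0 i)) (nbhs x)) => i.
  have h : open ((fun y : pt => y ord0 i) @^-1` `]a ord0 i, b ord0 i[%classic).
    by apply: open_comp; [move=> y _; exact: coord_continuous|exact: interval_open].
  have := open_nbhs_nbhs (conj h (_ : _ x)); rewrite /= in_itv/= => /(_ (rx i)).
  by apply: filterS => y /=; rewrite in_itv.
by [].
Qed.

Lemma crect_closed a b : closed (crect a b).
Proof.
rewrite (_ : crect a b = \bigcap_(i in [set: 'I_n]) ((fun y : pt => y ord0 i) @^-1` `[a ord0 i, b ord0 i]%classic)).
  apply: closed_bigI => i _; apply: preimage_closed; last exact: interval_closed.
  by move=> y _; exact: coord_continuous.
by rewrite predeqE => y; split=> [h i _ /=|h i]; [rewrite in_itv/=|have := h i I; rewrite /= in_itv/=].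
Qed.

Lemma crect_bounded a b : bounded_set (crect a b).
Proof.
exists (`|a| + `|b|); split; first by rewrite num_real.
move=> M hM y hy /=; apply: le_trans (ltW hM).
rewrite [`|y|]mx_normrE; apply: bigmax_le; first by rewrite addr_ge0.
move=> -[i j] _ /=; rewrite (ord1 i); have /andP[h1 h2] := hy j.
have ha : `|a ord0 j| <= `|a| by rewrite [`|a|]mx_normrE; apply: (le_bigmax _ (fun ij => `|a ij.1 ij.2|) (ord0, j)).
have hb : `|b ord0 j| <= `|b| by rewrite [`|b|]mx_normrE; apply: (le_bigmax _ (fun ij => `|b ij.1 ij.2|) (ord0, j)).
have := ler_norm (b ord0 j); have := ler_norm (- a ord0 j); rewrite normrN => h3 h4.
change (`|y ord0 j| <= `|a| + `|b|); have A0 := normr_ge0 a; have B0 := normr_ge0 b.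
move: ha hb A0 B0; move: `|a| `|b| => A B ha hb A0 B0.
by rewrite ler_norml; apply/andP; split; lra.
Qed.

Lemma crect_compact a b : compact (crect a b).
Proof. by apply: bounded_closed_compact; [exact: crect_bounded|exact: crect_closed]. Qed.

Lemma test_function_crect (Omega : set pt) (f : 'I_n -> R -> R) (a b : pt) :
  crect a b `<=` Omega -> (forall i, smooth1 (f i)) ->
  (forall i y, f i y != 0 -> a ord0 i <= y <= b ord0 i) ->
  test_function Omega (prodfun f).
Proof.
move=> cO sf hf.
have sub : closure [set x | prodfun f x != 0] `<=` crect a b.
  rewrite [X in _ `<=` X](closure_id _).1; last exact: crect_closed.
  apply: closure_subset => x /= fx i; apply: hf.
  by apply: contraNneq fx; rewrite /prodfun (bigD1 i)//= => ->; rewrite mul0r.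
split; [exact: prodfun_smooth| |exact: subset_trans sub cO].
by apply: subclosed_compact sub; [exact: closed_closure|exact: crect_compact].
Qed.

(** Rises from 0 to 1 over [c - r, c - r + r/(k+1)] and falls back over [c + r - r/(k+1), c + r];
    the layers shrink as k grows, so that the limit is the indicator of the open interval. *)
Definition step_bump (k : nat) (c r : R) (x : R) : R :=
  smooth_step (k.+1%:R / r * (x - (c - r))) - smooth_step (k.+1%:R / r * (x - (c + r)) + 1).

Lemma step_bump_smooth k c r : smooth1 (step_bump k c r).
Proof.
rewrite (_ : step_bump k c r = (fun x => 1 * smooth_step (k.+1%:R / r * x + (k.+1%:R / r * (r - c))) +
   (-1) * smooth_step (k.+1%:R / r * x + (1 - k.+1%:R / r * (c + r))))).
  by apply: smooth1D; apply: smooth1_affine; exact: smooth_step_smooth.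
apply/funext => x; rewrite /step_bump mul1r mulN1r; congr (smooth_step _ - smooth_step _); ring.
Qed.

Lemma step_bump_norm k c r x : `|step_bump k c r x| <= 1.
Proof.
rewrite /step_bump; set a := smooth_step _; set b := smooth_step _.
have /andP[a0 a1] : 0 <= a <= 1 := smooth_step_itv _.
have /andP[b0 b1] : 0 <= b <= 1 := smooth_step_itv _.
by rewrite ler_norml; apply/andP; split; lra.
Qed.

Lemma step_bump_out k c r x : 0 < r -> r <= `|x - c| -> step_bump k c r x = 0.
Proof.
move=> r0 xr; have K1 : (1 : R) <= k.+1%:R by rewrite ler1n.
have kr0 : 0 < k.+1%:R / r by rewrite divr_gt0.
move: xr; rewrite ler_normr => /orP[xr|xr]; rewrite /step_bump.
  rewrite !smooth_step_ge1 ?subrr//.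
    by rewrite lerDr mulr_ge0 ?(ltW kr0)//; lra.
  rewrite mulrAC ler_pdivlMr// mul1r; apply: (@le_trans _ _ (k.+1%:R * r)).
    by rewrite ler_peMl// ltW.
  by rewrite ler_wpM2l//; lra.
rewrite !smooth_step_le0 ?subrr//.
  rewrite -lerBrDr sub0r -ler_pdivlMl// invf_div mulrN1 lerNr.
  apply: (@le_trans _ _ r); last lra.
  by rewrite ler_pdivrMr// ler_peMr// ltW.
by rewrite pmulr_rle0//; lra.
Qed.

Lemma step_bump_in k c r x : 0 < r -> `|x - c| <= r - r / k.+1%:R -> step_bump k c r x = 1.
Proof.
move=> r0; have kr0 : 0 < k.+1%:R / r by rewrite divr_gt0.
rewrite ler_norml => /andP[x1 x2]; rewrite /step_bump.
rewrite smooth_step_ge1; last first.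
  by rewrite -ler_pdivrMl// mulr1 invf_div; move: x1; move: (r / _) => z; lra.
rewrite smooth_step_le0 ?subr0//.
by rewrite -lerBrDr sub0r -ler_pdivlMl// invf_div mulrN1; move: x2; move: (r / _) => z; lra.
Qed.

Definition rect_bump_factor k (a b : pt) (i : 'I_n) : R -> R :=
  step_bump k ((a ord0 i + b ord0 i) / 2) ((b ord0 i - a ord0 i) / 2).

Definition rect_bump k (a b : pt) : pt -> R := prodfun (rect_bump_factor k a b).

Lemma rect_bump_factor_smooth k a b i : smooth1 (rect_bump_factor k a b i).
Proof. exact: step_bump_smooth. Qed.

Lemma rect_bump_factor_out k (a b : pt) i y : a ord0 i < b ord0 i ->
  ~~ (a ord0 i < y < b ord0 i) -> rect_bump_factor k a b i y = 0.
Proof.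
move=> ab h; rewrite /rect_bump_factor step_bump_out//; first by lra.
move: h; rewrite negb_and -!leNgt ler_normr => /orP[h|h]; apply/orP; first by right; lra.
by left; lra.
Qed.

Lemma rect_bump_test (Omega : set pt) k (a b : pt) : (forall i, a ord0 i < b ord0 i) ->
  crect a b `<=` Omega -> test_function Omega (rect_bump k a b).
Proof.
move=> ab cO; apply: (test_function_crect cO) => [i|i y]; first exact: rect_bump_factor_smooth.
apply: contraR => h; rewrite rect_bump_factor_out//.
by apply: contra h => /andP[/ltW -> /ltW ->].
Qed.

Lemma rect_bump_norm k a b x : `|rect_bump k a b x| <= 1.
Proof.
rewrite /rect_bump /prodfun normr_prod; apply: prodr_ile1 => i _.
by rewrite normr_ge0 step_bump_norm.
Qed.

Lemma rect_bump_out k (a b x : pt) : (forall i, a ord0 i < b ord0 i) -> ~ rect a b x -> rect_bump k a b x = 0.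
Proof.
move=> ab /existsNP[i /negP h].
by rewrite /rect_bump /prodfun (bigD1 i)//= rect_bump_factor_out// mul0r.
Qed.

(** At each point the sequence is eventually constant: outside the open box it vanishes, and inside
    every factor reaches 1 once the transition layers are thinner than the distance to the faces. *)
Lemma rect_bump_cvg (a b : pt) x : (forall i, a ord0 i < b ord0 i) ->
  (fun k => rect_bump k a b x) @ \oo --> (\1_(rect a b) x : R).
Proof.
move=> ab; rewrite indicE; case: (boolP (x \in _)) => [/set_mem h|/negP h]; last first.
  rewrite [X in X @ _](_ : _ = fun=> 0); first exact: cvg_cst.
  by apply/funext => k; rewrite rect_bump_out// => /mem_set.
have [M hM] : exists M : nat, forall k i, (M <= k)%N -> rect_bump_factor k a b i (x ord0 i) = 1.
  have H i : exists M : nat, forall k, (M <= k)%N -> rect_bump_factor k a b i (x ord0 i) = 1.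
    have := h i; have := ab i; rewrite /rect_bump_factor.
    move: (a ord0 i) (b ord0 i) (x ord0 i) => {a b ab h x} a b x ab hx.
    set r := (b - a) / 2; set c := (a + b) / 2.
    have r0 : 0 < r by rewrite /r; lra.
    have rx : `|x - c| < r.
      by rewrite ltr_norml /r /c; move: hx => /andP[? ?]; apply/andP; split; lra.
    exists (Num.trunc (r / (r - `|x - c|))) => k Mk; apply: step_bump_in => //.
    move: rx Mk; rewrite -subr_gt0; move: `|_ - _| => z rz Mk.
    suff : r / k.+1%:R <= r - z by rewrite lerBrDr addrC -lerBrDr.
    rewrite ler_pdivrMr// mulrC -ler_pdivrMr//.
    by apply: (le_trans (ltW (truncnS_gt _))); rewrite ler_nat.
  have [M hM] := choice H; exists (\max_i M i)%N => k i Mk; apply: hM.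
  by apply: leq_trans Mk; exact: leq_bigmax.
apply: cvg_near_cst; near=> k.
rewrite /rect_bump /prodfun big1// => i _.
by apply: hM; near: k; exact: nbhs_infty_ge.
Unshelve. all: by end_near. Qed.

Lemma rect_bump_continuous k a b : continuous (rect_bump k a b).
Proof.
move=> x; apply: differentiable_continuous; apply: prodfun_diff => i.
exact: rect_bump_factor_smooth.
Qed.

Lemma rectI a b a' b' : rect a b `&` rect a' b' =
  rect (\row_i Num.max (a ord0 i) (a' ord0 i)) (\row_i Num.min (b ord0 i) (b' ord0 i)).
Proof.
rewrite predeqE => x; split=> [[h h'] i|h].
  by rewrite !mxE gt_max lt_min; have /andP[-> ->] := h i; have /andP[-> ->] := h' i.
split=> i; have := h i; rewrite !mxE gt_max lt_min => /andP[/andP[h1 h2] /andP[h3 h4]].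
  by rewrite h1 h3.
by rewrite h2 h4.
Qed.

Lemma rect_sub_crect a b : rect a b `<=` crect a b.
Proof. by move=> x h i; have /andP[h1 h2] := h i; rewrite !ltW. Qed.

Lemma rect_measurable a b : measurable (rect a b).
Proof. by apply: open_measurable_rV; exact: rect_open. Qed.

Lemma obox_rect c r : obox c r = rect (c - const_mx r) (c + const_mx r).
Proof. by rewrite predeqE => x; split=> h i; have := h i; rewrite !mxE ltr_distl. Qed.

Lemma cbox_crect c r : cbox c r = crect (c - const_mx r) (c + const_mx r).
Proof. by rewrite predeqE => x; split=> h i; have := h i; rewrite !mxE ler_distl. Qed.

(** A pi-system generating the sigma-algebra, as the Dynkin argument of [ae_eq0_rects] demands. *)
Definition rects : set (set pt) := [set A | exists a b, A = rect a b].

Lemma rects_open (U : set pt) : open U -> <<s rects >> U.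
Proof.
move=> oU; rewrite (open_ratboxE oU).
have := @countable_bigcupT_measurable _ (g_sigma_algebraType rects) ('rV[rat]_n * nat)%type
  (fun p => if `[< cbox (ratbox R p).1 (ratbox R p).2 `<=` U >]
                 then obox (ratbox R p).1 (ratbox R p).2 else set0).
apply; first exact: countableP.
move=> p; case: ifPn => _; last exact: measurable0.
by apply: sub_sigma_algebra; rewrite obox_rect; do 2 eexists.
Qed.

Lemma measurable_rects : @measurable _ pt = <<s rects >>.
Proof.
apply/seteqP; split; last first.
  apply: smallest_sub; first exact: sigma_algebra_measurable.
  by move=> _ [a [b ->]]; exact: rect_measurable.
apply: smallest_sub; first exact: smallest_sigma_algebra.
move=> A; rewrite -bigcup_seq/= => -[i _ [B mB <-]].
have : measurable_fun setT (fun x : g_sigma_algebraType rects => (x : pt) ord0 i).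
  apply: (measurability _ (RGenOpens.measurableE R)) => /= _ [C [a [b ->]] <-].
  rewrite setTI; apply: rects_open; apply: open_comp; last exact: interval_open.
  by move=> y _; exact: coord_continuous.
by move=> /(_ measurableT _ mB).
Qed.

End directional.

Lemma EFin_Rintegral d (T : measurableType d) (R : realType) (mu : {measure set T -> \bar R})
    (D : set T) (f : T -> R) : measurable D -> mu.-integrable D (EFin \o f) ->
  (\int[mu]_(x in D) (f x)%:E = (\int[mu]_(x in D) f x)%:E)%E.
Proof. by move=> mD fi; rewrite fineK//; exact: integrable_fin_num. Qed.

Lemma itvoo_sub_cc (R : realType) (a b A B : R) : a < b ->
  `]a, b[%classic `<=` `[A, B]%classic -> A <= a /\ b <= B.
Proof.
move=> ab h.
have H y : a < y -> y < b -> A <= y /\ y <= B.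
  by move=> ay yb; have := h y; rewrite /= !in_itv/= ay yb => /(_ isT)/andP.
split; rewrite leNgt; apply/negP => aA.
  by have [Ab|bA] := leP A b; [have [] := H ((a + A) / 2)|have [] := H ((a + b) / 2)]; lra.
by have [Ba|aB] := leP a B; [have [] := H ((b + B) / 2)|have [] := H ((a + b) / 2)]; lra.
Qed.

(** * Weak derivatives *)

Section du_bois_reymond.
Variables (R : realType) (n : nat).
Local Notation pt := 'rV[R]_n.
Local Notation lam := (leb R n).

(** Dominated convergence with majorant |w|: the bumps are bounded by 1 and tend to the indicator of
    the open box. *)
Lemma dbr_rect (w : pt -> R) (a b : pt) : (forall i, a ord0 i < b ord0 i) ->
  lam.-integrable (crect a b) (EFin \o w) ->
  (forall k, \int[lam]_(x in crect a b) (w x * rect_bump k a b x) = 0) ->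
  \int[lam]_(x in rect a b) w x = 0.
Proof.
move=> ab iw h; have mC : measurable (crect a b) by apply: closed_measurable_rV; exact: crect_closed.
have mw : measurable_fun (crect a b) w by apply/measurable_EFinP; exact: measurable_int iw.
have mb k : measurable_fun (crect a b) (rect_bump k a b).
  by apply: measurable_funTS; apply: continuous_measurable_rV; exact: rect_bump_continuous.
have iwb k : lam.-integrable (crect a b) (fun x => (w x * rect_bump k a b x)%:E).
  apply: le_integrable (iw) => //.
    by apply/measurable_EFinP; exact: measurable_funM.
  by move=> x _; rewrite lee_fin normrM ler_piMr// rect_bump_norm.
have E k : (\int[lam]_(x in crect a b) (w x * rect_bump k a b x)%:E = 0)%E.
  by rewrite EFin_Rintegral//; [exact: (congr1 EFin (h k))|exact: iwb].
have : (\int[lam]_(x in crect a b) (w x * rect_bump k a b x)%:E)%E @[k --> \oo] -->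
    (\int[lam]_(x in crect a b) (w x * \1_(rect a b) x)%:E)%E.
  apply: (@dominated_cvg _ _ _ lam _ mC (fun k x => (w x * rect_bump k a b x)%:E) _ (fun x => `|(w x)%:E|%E)).
  - by move=> k; apply/measurable_EFinP; exact: measurable_funM.
  - by move=> x _; apply: cvg_EFin; [exact: nearW|]; apply: cvgMl_tmp; exact: rect_bump_cvg.
  - by [].
  - exact: integrable_abse.
  - by move=> k x _; rewrite abse_EFin lee_fin normrM ler_piMr// rect_bump_norm.
rewrite (funext E) => /cvg_lim H.
have {}H : (\int[lam]_(x in crect a b) (w x * \1_(rect a b) x)%:E = 0)%E.
  by rewrite -H//; apply/cvg_lim => //; exact: cvg_cst.
rewrite /Rintegral (_ : integral _ _ _ = 0)%E// -[RHS]H.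
rewrite {1}(_ : rect a b = crect a b `&` rect a b); last first.
  by rewrite setIC; apply/esym/setIidl; exact: rect_sub_crect.
rewrite integral_mkcondr; apply: eq_integral => x _.
by rewrite patchE indicE; case: ifP => _; rewrite ?mulr1 ?mulr0.
Qed.

Lemma rects0 (a b : pt) i : b ord0 i <= a ord0 i -> rect a b = set0.
Proof.
move=> ba; rewrite predeqE => x; split=> // /(_ i)/andP[h1 h2].
by have := lt_trans h1 h2; rewrite ltNge ba.
Qed.

(** Dynkin's theorem: the sets over which W integrates to zero contain the boxes and are stable
    under countable disjoint unions and, the total integral being zero, under complements. *)
Lemma ae_eq0_rects (W : pt -> R) : lam.-integrable setT (EFin \o W) ->
  \int[lam]_x W x = 0 ->
  (forall a b, \int[lam]_(x in rect a b) W x = 0) -> \forall x \ae lam, W x = 0.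
Proof.
move=> iW W0 hW.
have iWA A : measurable A -> lam.-integrable A (EFin \o W).
  by move=> mA; apply: integrableS iW.
have H : forall A, measurable A -> \int[lam]_(x in A) W x = 0.
  move=> A; rewrite measurable_rects.
  apply: (@dynkin_induction _ pt (@rects R n) (fun A => \int[lam]_(x in A) W x = 0)).
  - exact: measurable_rects.
  - move=> _ _ [a [b ->]] [a' [b' ->]]; rewrite rectI; by do 2 eexists.
  - exact: W0.
  - by move=> _ [a [b ->]]; exact: hW.
  - move=> S mS S0.
    have := @Rintegral_setU _ _ _ lam S (~` S) W mS (measurableC mS).
    rewrite setUv => /(_ iW); rewrite W0 S0 add0r => ->//.
    by apply/disj_setPS => x [].
  - move=> F mF tF F0; rewrite /Rintegral integral_bigcup//.
      by rewrite eseries0// => i _ _; rewrite EFin_Rintegral ?F0//; exact: iWA.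
    by apply: iWA; exact: bigcupT_measurable.
have : ae_eq lam setT (EFin \o W) (cst 0%E).
  apply: integral_ae_eq => // E _ mE; rewrite integral_cst// mul0e.
  by rewrite EFin_Rintegral ?H//; exact: iWA.
by apply: filterS => x /(_ I)[].
Qed.

(** Testing with cutoffs of boxes is enough. After localization to a small box with compact closure
    in O, the restriction of w to that box is integrable on the whole space and [ae_eq0_rects]
    applies to it. *)
Lemma du_bois_reymond (O : set pt) (w : pt -> R) : open O ->
  (forall a b, crect a b `<=` O -> lam.-integrable (crect a b) (EFin \o w)) ->
  (forall k (a b : pt), (forall i, a ord0 i < b ord0 i) -> crect a b `<=` O ->
    \int[lam]_(x in O) (w x * rect_bump k a b x) = 0) ->
  \forall x \ae lam, O x -> w x = 0.
Proof.
move=> oO iw h; apply: ae_ratbox => // p; move: (ratbox _ p).1 (ratbox _ p).2 => c r cO.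
have sub a b : (rect a b `<=` obox c r) -> \int[lam]_(x in rect a b) w x = 0.
  move=> hab; case: (pselect (forall i, a ord0 i < b ord0 i)) => [ab|/existsNP[i /negP]]; last first.
    by rewrite -leNgt => /rects0 ->; rewrite Rintegral_set0.
  have cab : crect a b `<=` O.
    apply: subset_trans cO; rewrite cbox_crect => x hx.
    have h1 i : `]a ord0 i, b ord0 i[%classic `<=` `[(c - const_mx r) ord0 i, (c + const_mx r) ord0 i]%classic.
      move=> y /=; rewrite !in_itv/= => hy.
      (* The point with i-th coordinate y and the other coordinates at the midpoints lies in the
         open box; its membership in the larger box yields the inclusion of the i-th sides. *)
      have := hab (\row_j if j == i then y else (a ord0 j + b ord0 j) / 2).
      move=> /(_ _)/obox_sub_cbox; rewrite cbox_crect => /(_ _ i).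
      rewrite [X in _ <= X <= _]mxE eqxx; apply=> j; rewrite mxE; case: ifPn => [/eqP ->//|_].
      by have := ab j => abj; apply/andP; split; lra.
    move=> i; have [h2 h3] := itvoo_sub_cc (ab i) (h1 i).
    by have /andP[h4 h5] := hx i; rewrite (le_trans h2 h4) (le_trans h5 h3).
  apply: dbr_rect => //; first exact: iw.
  move=> k; have := h k a b ab cab.
  move=> <-; rewrite Rintegral_mkcond [RHS]Rintegral_mkcond; apply: eq_Rintegral => x _.
  rewrite !patchE; case: ifPn => hx.
    by rewrite ifT// inE; apply: cab; exact/set_mem.
  rewrite rect_bump_out ?mulr0 ?if_same// => /rect_sub_crect /mem_set.
  by rewrite (negbTE hx).
have iD : lam.-integrable (obox c r) (EFin \o w).
  apply: (integrableS _ _ (@obox_sub_cbox _ _ c r)) => //.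
  - exact: cbox_measurable.
  - exact: obox_measurable.
  - by rewrite cbox_crect; apply: iw; rewrite -cbox_crect.
have := @ae_eq0_rects (w \_ (obox c r)).
move=> /(_ _ _ _); rewrite -restrict_EFin -integrable_mkcond; last exact: obox_measurable.
move=> /(_ iD); rewrite -Rintegral_mkcond => /(_ _ _).
have E a b : \int[lam]_(x in rect a b) (w \_ (obox c r)) x = 0.
  by rewrite -Rintegral_mkcondr obox_rect rectI; apply: sub; rewrite obox_rect -rectI => x [].
move=> /(_ _ E); rewrite {1}obox_rect => /(_ (sub _ _ _)).
rewrite -obox_rect => /(_ (fun _ => id)).
by apply: filterS => x hx ox; move: hx; rewrite patchE mem_set.
Qed.

End du_bois_reymond.

(** * Differentiation under the integral and integration by parts *)

Section integral_calculus.
Variables (R : realType) (n : nat).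
Local Notation pt := 'rV[R]_n.
Local Notation lam := (leb R n).

Lemma integral_shift (v : pt) (f : pt -> \bar R) : measurable_fun setT f ->
  (\int[lam]_x f (x + v)%R = \int[lam]_x f x)%E.
Proof.
move=> mf; rewrite integralE [RHS]integralE; congr (_ - _)%E.
  transitivity (\int[lam]_x (f^\+)%E (x + v)%R)%E; first by apply: eq_integral => x _; rewrite !funeposE.
  by rewrite ge0_integral_shift//; exact: measurable_funepos.
transitivity (\int[lam]_x (f^\-)%E (x + v)%R)%E; first by apply: eq_integral => x _; rewrite !funenegE.
by rewrite ge0_integral_shift//; exact: measurable_funeneg.
Qed.

Lemma Rintegral_shift (v : pt) (f : pt -> R) : measurable_fun setT f ->
  \int[lam]_x f (x + v) = \int[lam]_x f x.
Proof.
move=> mf; rewrite /Rintegral (@integral_shift v (EFin \o f))//.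
exact/measurable_EFinP.
Qed.

Lemma integrable_shift (v : pt) (f : pt -> R) : lam.-integrable setT (EFin \o f) ->
  lam.-integrable setT (fun x => (f (x + v))%:E).
Proof.
move=> /integrableP[mf foo]; apply/integrableP; split.
  by apply: (measurableT_comp mf); exact: measurable_shift_rV.
rewrite (@ge0_integral_shift R n v (fun x => `|(f x)%:E|%E))//.
exact: measurableT_comp.
Qed.

Lemma Rintegral_supp (D : set pt) (f : pt -> R) : (forall x, ~ D x -> f x = 0) ->
  \int[lam]_(x in D) f x = \int[lam]_x f x.
Proof.
move=> h; rewrite Rintegral_mkcond; apply: eq_Rintegral => x _.
by rewrite patchE; case: ifPn => // /negP nx; rewrite h// => /mem_set.
Qed.

Lemma integrable_supp (D : set pt) (f : pt -> R) : measurable D -> (forall x, ~ D x -> f x = 0) ->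
  lam.-integrable D (EFin \o f) <-> lam.-integrable setT (EFin \o f).
Proof.
move=> mD h; rewrite integrable_mkcond//; suff -> : (EFin \o f) \_ D = EFin \o f by [].
apply/funext => x; rewrite patchE; case: ifPn => // /negP nx /=.
by rewrite h// => /mem_set.
Qed.

Definition bounded_support (f : pt -> R) := exists r, forall x, f x != 0 -> cbox 0 r x.

Lemma continuous_bounded_cbox (f : pt -> R) r : continuous f ->
  exists M, forall x, cbox 0 r x -> `|f x| <= M.
Proof.
move=> cf; have : compact (f @` cbox 0 r).
  by apply: continuous_compact; [exact: continuous_subspaceT|exact: cbox_compact].
move=> /compact_bounded[M [_ hM]]; exists (`|M| + 1) => x hx.
by apply: (hM (`|M| + 1)); [rewrite ltr_pwDr// ler_norm|exists x].
Qed.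

Lemma bounded_support_bounded (f : pt -> R) : continuous f -> bounded_support f ->
  exists M, forall x, `|f x| <= M.
Proof.
move=> cf [r hr]; have [M hM] := continuous_bounded_cbox r cf.
exists (Num.max M 0) => x; rewrite le_max; have [->|/hr /hM ->//] := eqVneq (f x) 0.
by rewrite normr0 lexx orbT.
Qed.

Lemma bounded_support_integrable (f : pt -> R) : continuous f -> bounded_support f ->
  lam.-integrable setT (EFin \o f).
Proof.
move=> cf sf; have [M hM] := bounded_support_bounded cf sf; have [r hr] := sf.
have mC := cbox_measurable (0 : pt) r.
apply/(integrable_supp mC) => [x|].
  by move=> nx; apply/eqP/negP => /negP /hr.
apply: measurable_bounded_integrable => //.
- exact: leb_cbox.
- by apply: measurable_funTS; exact: continuous_measurable_rV.
exists M; split; first exact: num_real.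
by move=> y My x _ /=; apply: le_trans (hM x) (ltW My).
Qed.

(** The derivative falls on eta, with majorant M |f0|, so f0 is only asked to be integrable. This
    serves for a truncated weakly differentiable function as well as for an indicator. *)
Lemma is_derive_translate_integral (f0 eta deta : pt -> R) (v : pt) (M : R) (s : R) :
  lam.-integrable setT (EFin \o f0) ->
  measurable_fun setT eta -> measurable_fun setT deta ->
  (forall x, `|eta x| <= M) -> (forall x, `|deta x| <= M) ->
  (forall x, is_derive x v eta (deta x)) ->
  is_derive s 1 (fun s => \int[lam]_y (f0 y * eta (s *: v + y)))
    (\int[lam]_y (f0 y * deta (s *: v + y))).
Proof.
move=> if0 meta mdeta hM hdM hd.
have mf0 : measurable_fun setT f0 by apply/measurable_EFinP; exact: measurable_int if0.
have msh t : measurable_fun setT (fun y : pt => t *: v + y).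
  by under eq_fun do rewrite addrC; exact: measurable_shift_rV.
have ii (g : pt -> R) : measurable_fun setT g -> (forall x, `|g x| <= M) ->
    forall t, lam.-integrable setT (EFin \o (fun y => f0 y * g (t *: v + y))).
  move=> mg hg t; apply: (@le_integrable _ _ _ lam _ _ _ (fun y => (M * f0 y)%:E)) => //.
  - by apply/measurable_EFinP; apply: measurable_funM => //; exact: measurableT_comp.
  - move=> y _; rewrite lee_fin !normrM mulrC ler_wpM2r//.
    by apply: (le_trans (hg _)); exact: ler_norm.
  - by under eq_fun do rewrite EFinM; exact: integrableZl.
have dd (x : R) (y : pt) : is_derive x 1 (fun t => f0 y * eta (t *: v + y)) (f0 y * deta (x *: v + y)).
  by apply: is_deriveZ; apply: is_derive_along; exact: hd.
have sI : `](s - 1), (s + 1)[%classic s by rewrite /= in_itv/=; apply/andP; split; lra.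
have E (x : R) (y : pt) : partial1of2 (fun t y => f0 y * eta (t *: v + y)) x y = f0 y * deta (x *: v + y).
  by rewrite partial1of2E; have [_ ->] := dd x y.
have G0 (y : pt) : 0 <= `|M * f0 y| by [].
have iG : lam.-integrable setT (EFin \o (fun y => `|M * f0 y|)).
  apply: (integrable_norm (f := fun y => M * f0 y)) => //.
  by rewrite /comp; under eq_fun do rewrite EFinM; exact: integrableZl.
have dGb (x : R) (y : pt) : `](s - 1), (s + 1)[%classic x -> setT y ->
    `|partial1of2 (fun t y => f0 y * eta (t *: v + y)) x y| <= `|M * f0 y|.
  move=> _ _; rewrite E !normrM mulrC ler_wpM2r//.
  by apply: (le_trans (hdM _)); exact: ler_norm.
have der (x : R) (y : pt) : `](s - 1), (s + 1)[%classic x -> setT y ->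
   derivable (fun t : R => f0 y * eta (t *: v + y)) x 1.
  by move=> _ _; have [] := dd x y.
have mT : measurable [set: pt] by [].
have ii' (x : R) : `](s - 1), (s + 1)[%classic x ->
   lam.-integrable setT (EFin \o (fun y => f0 y * eta (x *: v + y))).
  by move=> _; exact: ii.
apply: DeriveDef.
  exact: (derivable_under_integral mT sI ii' der G0 iG dGb).
rewrite -derive1E (differentiation_under_integral mT sI ii' der G0 iG dGb).
by apply: eq_Rintegral => y _; rewrite E.
Qed.

Definition C1dir (v : pt) (f df : pt -> R) :=
  [/\ continuous f, continuous df & forall x, is_derive x v f (df x)].

Lemma C1dirM v f df g dg : C1dir v f df -> C1dir v g dg ->
  C1dir v (fun x => f x * g x) (fun x => f x * dg x + g x * df x).
Proof.
move=> [cf cdf hf] [cg cdg hg]; split.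
- by move=> x; exact: (continuousM (cf x) (cg x)).
- by move=> x; exact: (continuousD (continuousM (cf x) (cdg x)) (continuousM (cg x) (cdf x))).
- by move=> x; apply: is_deriveM.
Qed.

Lemma derive_supp (v : pt) (f df : pt -> R) (D : set pt) : closed D -> (forall x, is_derive x v f (df x)) ->
  (forall x, f x != 0 -> D x) -> forall x, df x != 0 -> D x.
Proof.
move=> cD hd hf x; apply: contraPP => Dx.
have : is_derive x v f 0.
  apply: (@near_eq_is_derive _ _ _ (cst 0)).
  have : nbhs x (~` D) by apply: open_nbhs_nbhs; split => //; exact: closed_openC.
  by apply: filterS => y Dy; apply/esym/eqP; apply/negPn/negP => /hf.
by move=> [_ d0]; have [_] := hd x; rewrite d0 => <-; rewrite eqxx.
Qed.

(** By translation invariance the integral of f(t v + x) does not depend on t, and its derivative at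
    t = 0 is the integral of df. The integrable weight is the indicator of the box K, enlarged by
    |v| so that it is invisible for |t| <= 1. *)
Lemma integral_C1dir (v : pt) (f df : pt -> R) : C1dir v f df -> bounded_support f ->
  \int[lam]_x df x = 0.
Proof.
move=> [cf cdf hd] [r hr].
have sdf : bounded_support df.
  by exists r; apply: derive_supp hd hr; exact: cbox_closed.
have [M1 hM1] := bounded_support_bounded cf (ex_intro _ r hr).
have [M2 hM2] := bounded_support_bounded cdf sdf.
pose M := Num.max M1 M2; pose K := cbox (0 : pt) (r + `|v|).
have mK : measurable K by exact: cbox_measurable.
have iK : lam.-integrable setT (EFin \o (\1_K : pt -> R)).
  rewrite (_ : EFin \o _ = (fun x => (\1_K x)%:E))//; apply/integrableP; split.
    by apply/measurable_EFinP; exact: measurable_indic.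
  under eq_integral do rewrite gee0_abs ?lee_fin//.
  by rewrite integral_indicT//; exact: leb_cbox.
have Kin (t : R) (g : pt -> R) x : `|t| <= 1 -> (forall x, g x != 0 -> cbox 0 r x) -> \1_K x * g (t *: v + x) = g (x + t *: v).
  move=> t1 hg; rewrite addrC; have [->|/hg h] := eqVneq (g (x + t *: v)) 0; first by rewrite mulr0.
  rewrite indicE mem_set ?mul1r// => i; have := h i; rewrite !mxE !subr0 => h1.
  rewrite -[x ord0 i](addrK (t * v ord0 i)); apply: le_trans (ler_normB _ _) _.
  rewrite lerD// normrM; apply: (@le_trans _ _ (1 * `|v ord0 i|)); first by rewrite ler_wpM2r.
  by rewrite mul1r [`|v|]mx_normrE; apply: (le_bigmax _ (fun ij => `|v ij.1 ij.2|) (ord0, i)).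
have := @is_derive_translate_integral (\1_K) f df v M 0 iK (continuous_measurable_rV cf)
  (continuous_measurable_rV cdf).
move=> /(_ _ _ hd)[x|x|_].
- by rewrite le_max hM1.
- by rewrite le_max hM2 orbT.
under eq_Rintegral => y _.
  rewrite (Kin 0 df y) ?normr0//; last by apply: derive_supp hd hr; exact: cbox_closed.
  rewrite scale0r addr0; over.
move=> <-.
suff : is_derive (0 : R) 1 (fun s : R => \int[lam]_y (\1_K y * f (s *: v + y))) 0 by move=> [].
apply: (@near_eq_is_derive _ _ _ (cst (\int[lam]_y f y))).
have n1 : \forall t \near (0 : R), `|t| <= 1.
  by apply/nbhs_ballP; exists 1 => //= y; rewrite /ball /= sub0r normrN => /ltW.
near=> t; have t1 : `|t| <= 1 by near: t.
apply/esym; rewrite -[X in _ = X](Rintegral_shift (t *: v) (continuous_measurable_rV cf)).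
by apply: eq_Rintegral => y _; exact: Kin.
Unshelve. all: by end_near. Qed.

End integral_calculus.

Section real_integrable.
Context d (T : measurableType d) (R : realType) (mu : {measure set T -> \bar R}) (D : set T).
Hypothesis mD : measurable D.
Implicit Types f g : T -> R.

Lemma integrable_addr f g : mu.-integrable D (EFin \o f) -> mu.-integrable D (EFin \o g) ->
  mu.-integrable D (EFin \o (fun x => f x + g x)).
Proof.
move=> fi gi; rewrite (_ : _ \o _ = (fun x => (EFin \o f) x + (EFin \o g) x)%E); first exact: integrableD.
by apply/funext => x /=; rewrite EFinD.
Qed.

Lemma integrable_subr f g : mu.-integrable D (EFin \o f) -> mu.-integrable D (EFin \o g) ->
  mu.-integrable D (EFin \o (fun x => f x - g x)).
Proof.
move=> fi gi; rewrite (_ : _ \o _ = (fun x => (EFin \o f) x - (EFin \o g) x)%E); first exact: integrableB.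
by apply/funext => x /=; rewrite EFinB.
Qed.

Lemma integrable_mulr (c : R) f : mu.-integrable D (EFin \o f) ->
  mu.-integrable D (EFin \o (fun x => c * f x)).
Proof.
move=> fi; rewrite (_ : _ \o _ = (fun x => c%:E * (EFin \o f) x)%E); first exact: integrableZl.
by apply/funext => x /=; rewrite EFinM.
Qed.

End real_integrable.

(** * Calculus of weak derivatives *)

Section weak_derivatives.
Variables (R : realType) (n : nat).
Local Notation pt := 'rV[R]_n.
Local Notation lam := (leb R n).
Local Notation e_ i := (delta_mx ord0 i : pt).
Implicit Types (f g eta : pt -> R) (Omega : set pt).

Lemma smooth_continuous f : smooth f -> continuous f.
Proof. by move=> sf; have [h _] := sf 0%N [::]; exact: h. Qed.

Lemma smooth_partial f i : smooth f -> smooth (partial i f).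
Proof.
move=> sf k s; have E : iter_partial s (partial i f) = iter_partial (rcons s i) f.
  by rewrite /iter_partial foldr_rcons.
rewrite E; have [h1 h2] := sf k.+1 (rcons s i).
split=> hs; first by apply: h1; rewrite size_rcons ltnS.
by apply: h2; rewrite size_rcons ltnS.
Qed.

Lemma smooth_is_derive f i x : smooth f -> is_derive x (e_ i) f (partial i f x).
Proof. by move=> sf; apply: DeriveDef => //; have [_ h] := sf 1%N [::]; exact: h. Qed.

Lemma smooth_C1dir f i : smooth f -> C1dir (e_ i) f (partial i f).
Proof.
move=> sf; split; [exact: smooth_continuous|exact: smooth_continuous (smooth_partial i sf)|].
by move=> x; exact: smooth_is_derive.
Qed.

Lemma test_function_partial Omega f i : test_function Omega f -> test_function Omega (partial i f).
Proof.
move=> [sf cf sO].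
have sub : closure [set x | partial i f x != 0] `<=` closure [set x | f x != 0].
  rewrite [X in _ `<=` X](closure_id _).1; last exact: closed_closure.
  apply: closure_subset => x; apply: (@derive_supp _ _ (e_ i) f) => [|y|y]; first exact: closed_closure.
    exact: smooth_is_derive.
  by move=> fy; exact: subset_closure.
split; [exact: smooth_partial| |exact: subset_trans sub sO].
by apply: subclosed_compact sub => //; exact: closed_closure.
Qed.

Lemma test_function_supp Omega f x : test_function Omega f -> ~ Omega x -> f x = 0.
Proof.
move=> [_ _ sO] nO; apply/eqP/negPn/negP => fx; apply: nO; apply: sO.
exact: subset_closure.
Qed.

Lemma test_function_bounded_support Omega f : test_function Omega f -> bounded_support f.
Proof.
move=> [_ cf _]; have [r _ hr] := bounded_sub_cbox (compact_bounded cf).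
by exists r => x fx; apply: hr; exact: subset_closure.
Qed.

Lemma integral_test_partial f g i : smooth f -> smooth g -> bounded_support f ->
  \int[lam]_x (f x * partial i g x) = - \int[lam]_x (partial i f x * g x).
Proof.
move=> sf sg [r hr].
have bs : bounded_support (fun x => f x * g x).
  by exists r => x; rewrite mulf_eq0 negb_or => /andP[/hr].
have hdr : forall x, partial i f x != 0 -> cbox 0 r x.
  by apply: derive_supp hr; [exact: cbox_closed|move=> x; exact: smooth_is_derive].
have := integral_C1dir (C1dirM (smooth_C1dir i sf) (smooth_C1dir i sg)) bs.
have cM (a b : pt -> R) : continuous a -> continuous b -> continuous (fun x => a x * b x).
  by move=> ca cb x; exact: (continuousM (ca x) (cb x)).
rewrite RintegralD//.
- by move/eqP; rewrite addr_eq0 => /eqP ->; congr (- _); apply: eq_Rintegral => x _; rewrite mulrC.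
- apply: bounded_support_integrable.
    by apply: cM; [exact: smooth_continuous|exact: smooth_continuous (smooth_partial i sg)].
  by exists r => x; rewrite mulf_eq0 negb_or => /andP[/hr].
- apply: bounded_support_integrable.
    by apply: cM; [exact: smooth_continuous|exact: smooth_continuous (smooth_partial i sf)].
  by exists r => x; rewrite mulf_eq0 negb_or => /andP[_ /hdr].
Qed.

Lemma continuous_locally_integrable Omega f : continuous f -> locally_integrable_on Omega f.
Proof.
move=> cf K cK _; have mK := compact_measurable_rV cK.
apply: measurable_bounded_integrable => //.
- by apply: leb_bounded => //; exact: compact_bounded.
- by apply: measurable_funTS; exact: continuous_measurable_rV.
have [r _ hr] := bounded_sub_cbox (compact_bounded cK).
have [M hM] := continuous_bounded_cbox r cf.
exists M; split; first exact: num_real.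
by move=> y My x /hr /hM /= h; apply: le_trans h (ltW My).
Qed.

Lemma smooth_weak_partial Omega f i : smooth f ->
  is_weak_partial Omega i f (partial i f).
Proof.
move=> sf; split.
- by apply: continuous_locally_integrable; exact: smooth_continuous.
- by apply: continuous_locally_integrable; exact: smooth_continuous (smooth_partial i sf).
move=> eta teta; rewrite /ip (@Rintegral_supp _ _ _ (fun x => f x * _)); last first.
  by move=> x nx; rewrite (test_function_supp (test_function_partial i teta))// mulr0.
rewrite (@Rintegral_supp _ _ _ (fun x => partial i f x * _)); last first.
  by move=> x nx; rewrite (test_function_supp teta)// mulr0.
have [seta _ _] := teta.
under eq_Rintegral do rewrite mulrC.
under [in RHS]eq_Rintegral do rewrite mulrC.
by rewrite -(opprK (\int[lam]_x _)) -integral_test_partial// ?opprK//; exact: test_function_bounded_support teta.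
Qed.

Lemma locint_test_integrable Omega g eta : open Omega -> locally_integrable_on Omega g ->
  test_function Omega eta -> lam.-integrable Omega (EFin \o (fun x => g x * eta x)).
Proof.
move=> oO lg [seta ceta sO]; set K := closure _ in ceta sO.
have mK : measurable K := compact_measurable_rV ceta.
have mO := open_measurable_rV oO.
have supp x : ~ K x -> g x * eta x = 0.
  move=> nK; suff -> : eta x = 0 by rewrite mulr0.
  by apply/eqP/negPn/negP => ex; apply: nK; exact: subset_closure.
apply/(integrable_supp mO) => [x nO|]; first by apply: supp => /sO.
apply/(integrable_supp mK) => //.
have [M hM] := bounded_support_bounded (smooth_continuous seta)
  (test_function_bounded_support (And3 seta ceta sO)).
apply: (@le_integrable _ _ _ lam _ _ _ (fun x => (M * g x)%:E)) => //.
- apply/measurable_EFinP; apply: measurable_funM.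
    by apply/measurable_EFinP; exact: measurable_int (lg K ceta sO).
  by apply: measurable_funTS; exact: continuous_measurable_rV (smooth_continuous seta).
- move=> x _; rewrite lee_fin !normrM mulrC ler_wpM2r//.
  by apply: le_trans (hM x) _; exact: ler_norm.
- by under eq_fun do rewrite EFinM; apply: integrableZl => //; exact: lg.
Qed.

Lemma weak_partial_unique Omega i f g g' : open Omega ->
  is_weak_partial Omega i f g -> is_weak_partial Omega i f g' ->
  \forall x \ae lam, Omega x -> g x = g' x.
Proof.
move=> oO [lf lg hg] [_ lg' hg'].
have : \forall x \ae lam, Omega x -> g x - g' x = 0.
  apply: (@du_bois_reymond R n Omega (fun x => g x - g' x)) => //.
    move=> a b cab; have cc : compact (crect a b) by exact: crect_compact.
    by apply: integrable_subr; [exact: compact_measurable_rV|exact: lg|exact: lg'].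
  move=> k a b ab cab; have tb := @rect_bump_test _ _ Omega k a b ab cab.
  under eq_Rintegral do rewrite mulrBl.
  rewrite RintegralB; [|exact: open_measurable_rV|exact: locint_test_integrable|exact: locint_test_integrable].
  by apply/eqP; rewrite subr_eq0 -eqr_opp; apply/eqP; rewrite -[LHS](hg _ tb) -[RHS](hg' _ tb).
by apply: filterS => x h /h /eqP; rewrite subr_eq0 => /eqP.
Qed.

Lemma locally_integrable_lin Omega (c : R) f g : locally_integrable_on Omega f -> locally_integrable_on Omega g ->
  locally_integrable_on Omega (fun x => f x + c * g x).
Proof.
move=> lf lg K cK KO; have mK := compact_measurable_rV cK.
by apply: integrable_addr; [by []|exact: lf|apply: integrable_mulr; [by []|exact: lg]].
Qed.

Lemma weak_partial_lin Omega i (c : R) f f' g g' : open Omega ->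
  is_weak_partial Omega i f f' -> is_weak_partial Omega i g g' ->
  is_weak_partial Omega i (fun x => f x + c * g x) (fun x => f' x + c * g' x).
Proof.
move=> oO [lf lf' hf] [lg lg' hg]; split; try exact: locally_integrable_lin.
move=> eta teta; have dteta := test_function_partial i teta.
have mO := open_measurable_rV oO.
have L (a b z : pt -> R) : locally_integrable_on Omega a -> locally_integrable_on Omega b ->
    test_function Omega z -> ip Omega (fun x => a x + c * b x) z = ip Omega a z + c * ip Omega b z.
  move=> la lb tz; have ia := locint_test_integrable oO la tz; have ib := locint_test_integrable oO lb tz.
  rewrite /ip -RintegralZl// -RintegralD//; first by apply: eq_Rintegral => x _; rewrite mulrDl mulrA.
  exact: integrable_mulr.
by rewrite !L// hf// hg// mulrN opprD.
Qed.

Lemma wpartialP Omega i f g : is_weak_partial Omega i f g -> is_weak_partial Omega i f (wpartial Omega i f).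
Proof. by move=> h; apply: (@xgetPex _ 0 (is_weak_partial Omega i f)); exists g. Qed.

(** The bridge between the representative chosen by [xget] and any weak derivative obtained by
    computation. *)
Lemma wpartial_ae Omega i f g : open Omega -> is_weak_partial Omega i f g ->
  \forall x \ae lam, Omega x -> wpartial Omega i f x = g x.
Proof. by move=> oO h; apply: (weak_partial_unique oO _ h); exact: wpartialP h. Qed.

(** Local integrability yields measurability on compact sets, and countably many boxes with compact
    closure exhaust Omega. *)
Lemma locally_integrable_measurable Omega f : open Omega -> locally_integrable_on Omega f -> measurable_fun Omega f.
Proof.
move=> oO lf; rewrite (open_ratboxE oO).
have [g gK] : exists g : nat -> option ('rV[rat]_n * nat), forall p, exists k, g k = Some p.
  by exists (fun k => unpickle k) => p; exists (pickle p); exact: pickleK.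
pose B p : set pt := if `[< cbox (ratbox R p).1 (ratbox R p).2 `<=` Omega >]
                 then obox (ratbox R p).1 (ratbox R p).2 else set0.
have mB p : measurable (B p) by rewrite /B; case: ifP => _ //; exact: obox_measurable.
have fB p : measurable_fun (B p) f.
  rewrite /B; case: ifPn => [/asboolP h|_]; last exact: measurable_fun_set0.
  apply: (@measurable_funS _ _ _ _ (cbox (ratbox R p).1 (ratbox R p).2)).
  - exact: cbox_measurable.
  - exact: obox_sub_cbox.
  - by apply/measurable_EFinP; apply: measurable_int (lf _ (@cbox_compact _ _ _ _) h).
rewrite (_ : \bigcup_p _ = \bigcup_k (if g k is Some p then B p else set0)); last first.
  rewrite predeqE => x; split=> [[p _ h]|[k _]].
    by have [k kp] := gK p; exists k => //; rewrite kp.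
  by case: (g k) => [p h|//]; exists p.
apply/measurable_fun_bigcup => [k|k]; case: (g k) => [p|] //; exact: measurable_fun_set0.
Qed.

End weak_derivatives.

(** * Real-valued integrals: sums, Fubini, Jensen *)

Section fine_integrals.
Context d (T : measurableType d) (R : realType) (mu : {measure set T -> \bar R}) (D : set T).
Hypothesis mD : measurable D.

Lemma integrable_fine (g : T -> \bar R) : mu.-integrable D g ->
  mu.-integrable D (fun x => (fine (g x))%:E).
Proof.
move=> ig; apply: le_integrable (ig) => //.
  by apply/measurable_EFinP; apply: measurableT_comp => //; exact: measurable_int ig.
by move=> x _; case: (g x) => [r| |] //=; rewrite ?normr0 ?leey.
Qed.

Lemma integral_fine (g : T -> \bar R) : mu.-integrable D g ->
  (\int[mu]_(x in D) (fine (g x))%:E = \int[mu]_(x in D) g x)%E.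
Proof.
move=> ig; apply: ae_eq_integral => //.
- exact: measurable_int (integrable_fine ig).
- exact: measurable_int ig.
- by apply: filterS (integrable_ae mD ig) => x h /h ?; rewrite fineK.
Qed.

Lemma ae_eq_Rintegral (f g : T -> R) : measurable_fun D f -> measurable_fun D g ->
  (\forall x \ae mu, D x -> f x = g x) -> \int[mu]_(x in D) f x = \int[mu]_(x in D) g x.
Proof.
move=> mf mg h; rewrite /Rintegral; congr fine; apply: ae_eq_integral => //; try exact/measurable_EFinP.
by apply: filterS h => x h /h ->.
Qed.

Lemma ge0_le_integral_gen (f g : T -> \bar R) : (forall x, D x -> (0 <= f x)%E) ->
  (forall x, D x -> (f x <= g x)%E) -> (\int[mu]_(x in D) f x <= \int[mu]_(x in D) g x)%E.
Proof.
move=> f0 fg; have g0 x : D x -> (0 <= g x)%E by move=> Dx; exact: le_trans (f0 _ Dx) (fg _ Dx).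
rewrite (ge0_integralE _ f0) (ge0_integralE _ g0).
apply: le_ereal_sup => _ [h hf <-]; exists h => // x; apply: le_trans (hf x) _.
by rewrite !patchE; case: ifP => // /set_mem; exact: fg.
Qed.

Lemma integrable_cst_fin (c : R) : (mu D < +oo)%E -> mu.-integrable D (EFin \o (fun=> c)).
Proof.
move=> Doo; apply: measurable_bounded_integrable => //.
by exists `|c|; split; [exact: num_real|move=> y cy x _ /=; exact: ltW].
Qed.

Lemma integrable_Rsum (I : finType) (F : I -> T -> R) :
  (forall i, mu.-integrable D (EFin \o F i)) ->
  mu.-integrable D (EFin \o (fun x => \sum_i F i x)).
Proof.
move=> hF; rewrite (_ : _ \o _ = (fun x => \sum_(i <- index_enum I) (EFin \o F i) x)%E).
  exact: integrable_sum.
by apply/funext => x /=; rewrite sumEFin.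
Qed.

Lemma Rintegral_sum (I : finType) (F : I -> T -> R) :
  (forall i, mu.-integrable D (EFin \o F i)) ->
  \int[mu]_(x in D) (\sum_i F i x) = \sum_i \int[mu]_(x in D) F i x.
Proof.
move=> hF; apply: EFin_inj; rewrite -EFin_Rintegral//; last exact: integrable_Rsum.
under eq_integral do rewrite -sumEFin.
rewrite integral_sum// -sumEFin; apply: eq_bigr => i _; exact: EFin_Rintegral.
Qed.

End fine_integrals.

Section real_fubini.
Context d1 d2 (T1 : measurableType d1) (T2 : measurableType d2) (R : realType).
Variables (m1 : {sigma_finite_measure set T1 -> \bar R}) (m2 : {sigma_finite_measure set T2 -> \bar R}).
Variable f : T1 * T2 -> R.
Hypothesis fi : (m1 \x m2)%E.-integrable setT (EFin \o f).

Lemma integrable_Rfubini : m1.-integrable setT (EFin \o (fun x => \int[m2]_y f (x, y))).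
Proof. exact: (integrable_fine measurableT (integrable_fubini_F fi)). Qed.

Lemma ae_integrable_section : \forall x \ae m1, m2.-integrable setT (fun y => (f (x, y))%:E).
Proof. exact: (ae_integrable1 fi). Qed.

Lemma EFin_Rfubini : ((\int[m1]_x \int[m2]_y f (x, y))%:E = \int[m1]_x \int[m2]_y (f (x, y))%:E)%E.
Proof.
rewrite -(EFin_Rintegral measurableT integrable_Rfubini).
exact: (integral_fine measurableT (integrable_fubini_F fi)).
Qed.

End real_fubini.

Section jensen.
Variable R : realType.
Local Notation lam1 := (@lebesgue_measure R).

(** Integrate (f - c)^2 >= 0 with c the mean of f over an interval of length 1. The case of an
    infinite right-hand side is set apart, which leaves f square integrable. *)
Lemma sqr_Rintegral01_le (f : R -> R) : measurable_fun (`[0, 1]%classic : set R) f ->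
  (((\int[lam1]_(s in `[0%R, 1%R]) f s) ^+ 2)%:E <= \int[lam1]_(s in `[0%R, 1%R]) ((f s) ^+ 2)%:E)%E.
Proof.
move=> mf; set I01 : set R := `[0, 1]%classic.
have mI : measurable I01 by exact: measurable_itv.
have l1 : lam1 I01 = 1%E by rewrite /I01 lebesgue_measure_itv/= lte_fin ltr01 -EFinB subr0.
have l1oo : (lam1 I01 < +oo)%E by rewrite l1 ltry.
have mf2 : measurable_fun I01 (fun s => f s ^+ 2) by exact: measurable_funX.
have [foo|] := ltP (\int[lam1]_(s in I01) ((f s) ^+ 2)%:E)%E +oo%E; last first.
  by rewrite leye_eq => /eqP ->; rewrite leey.
have i2 : lam1.-integrable I01 (EFin \o (fun s => f s ^+ 2)).
  apply/integrableP; split; first exact/measurable_EFinP.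
  by under eq_integral do rewrite gee0_abs ?lee_fin ?sqr_ge0//.
have ic (c : R) : lam1.-integrable I01 (EFin \o (fun=> c)).
  by apply: integrable_cst_fin => //; exact: l1oo.
have i1 : lam1.-integrable I01 (EFin \o f).
  apply: (@le_integrable _ _ _ lam1 _ _ _ (EFin \o (fun s => 1 + f s ^+ 2))) => //.
  - exact/measurable_EFinP.
  - move=> s _; rewrite lee_fin [leRHS]ger0_norm; last by rewrite addr_ge0// sqr_ge0.
    by rewrite -real_normK ?num_real//; have := sqr_ge0 (`|f s| - 1); rewrite sqrrB; have := sqr_ge0 `|f s|; lra.
  - exact: integrable_addr.
set c := \int[lam1]_(s in I01) f s.
rewrite (EFin_Rintegral _ i2)// lee_fin.
have : \int[lam1]_(s in I01) (2 * c * f s - c ^+ 2) <= \int[lam1]_(s in I01) (f s ^+ 2).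
  apply: le_Rintegral => //.
    by apply: integrable_subr => //; exact: integrable_mulr.
  by move=> s _; have := sqr_ge0 (f s - c); rewrite sqrrB -mulr_natl; lra.
rewrite RintegralB//; last exact: integrable_mulr.
rewrite RintegralZl// -/c Rintegral_cst// (_ : fine _ = 1); last exact: (congr1 fine l1).
by nra.
Qed.

End jensen.

(** * Difference quotients *)

Section segments.
Variables (R : realType) (n : nat).
Local Notation pt := 'rV[R]_n.
Local Notation lam := (leb R n).
Local Notation lam1 := (@lebesgue_measure R).
Implicit Types (Omega : set pt) (v x y : pt).

(** Points x from which the whole segment to x + v stays in Omega: there the increment of a function
    along v can be written as an integral of its gradient. *)
Definition segset Omega v : set pt := [set x | forall s : R, 0 <= s <= 1 -> Omega (x + s *: v)].

Lemma segset_open Omega v : open Omega -> open (segset Omega v).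
Proof.
move=> oO; rewrite openE => x sx; rewrite /interior.
have /compact_near_coveringP := @segment_compact R 0 1.
move=> /(_ pt (nbhs x) (fun y s => Omega (y + s *: v)) _) H.
have : \forall y \near x, `[0, 1]%classic `<=` (fun s : R => Omega (y + s *: v)).
  apply: H => s; rewrite /= in_itv/= => s01.
  have c : (fun p : R * pt => p.2 + p.1 *: v) @ (s, x) --> x + s *: v.
    by apply: cvgD; [exact: cvg_snd|apply: cvgZr_tmp; exact: cvg_fst].
  have := c Omega; apply; exact: (open_nbhs_nbhs (conj oO (sx s s01))).
by apply: filterS => y hy s s01; apply: hy; rewrite /= in_itv.
Qed.

Lemma measurable_shiftl_rV (w : pt) : measurable_fun setT (fun y : pt => w + y).
Proof.
rewrite (_ : (fun _ => _) = (fun y => y + w)); first exact: measurable_shift_rV.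
by apply/funext => y; rewrite addrC.
Qed.

Lemma is_derive_shift (f : pt -> R) (w e x : pt) l :
  is_derive (w + x) e f l -> is_derive x e (fun y => f (w + y)) l.
Proof.
move=> /is_derive_line h; apply/is_derive_line.
by rewrite (_ : (fun _ => _) = (fun t : R => f (t *: e + (w + x))))//; apply/funext => t; rewrite addrCA.
Qed.

Lemma differentiable_derive_sum (f : pt -> R) x v : differentiable f x ->
  is_derive x v f (\sum_i v ord0 i * partial i f x).
Proof.
move=> df; apply: DeriveDef; first exact: diff_derivable.
rewrite deriveE// {1}(row_sum_delta v) linear_sum; apply: eq_bigr => i _.
by rewrite linearZ /partial deriveE.
Qed.

End segments.

Section difference_quotient.
Variables (R : realType) (n : nat).
Local Notation pt := 'rV[R]_n.
Local Notation lam := (leb R n).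
Local Notation lam1 := (@lebesgue_measure R).
Variables (Omega : set pt) (f : pt -> R) (g : 'I_n -> pt -> R) (v a b : pt).
Hypothesis oO : open Omega.
Hypothesis hfg : forall i, is_weak_partial Omega i f (g i).
Hypothesis habv : crect a b `<=` segset Omega v.

(** The compact set swept by the segments issued from the closed box. Truncated to K, the function f
    and its derivative along v become integrable on the whole space, where translations and Fubini
    are available. *)
Let K : set pt := (fun p : pt * R => p.1 + p.2 *: v) @` (crect a b `*` `[0, 1]%classic).

Let K_compact : compact K.
Proof.
apply: continuous_compact; last by apply: compact_setX; [exact: crect_compact|exact: segment_compact].
apply: continuous_subspaceT => p; apply: cvgD; first exact: cvg_fst.
by apply: cvgZr_tmp; exact: cvg_snd.
Qed.

Let mK : measurable K. Proof. exact: compact_measurable_rV. Qed.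

Let K_Omega : K `<=` Omega.
Proof. by move=> _ [[x s] [/= hx hs] <-]; apply: habv => //; move: hs; rewrite in_itv. Qed.

Let KP x s : crect a b x -> 0 <= s <= 1 -> K (x + s *: v).
Proof. by move=> hx hs; exists (x, s) => //; split => //=; rewrite in_itv. Qed.

Let G x := \sum_i v ord0 i * g i x.
Let f0 := f \_ K.
Let G0 := G \_ K.

Let if0 : lam.-integrable setT (EFin \o f0).
Proof.
rewrite /f0 -restrict_EFin -integrable_mkcond//.
(* The local integrability of f is read off from any one of its weak derivatives; in dimension 0
   there is none, and f is a constant. *)
case: (pickP 'I_n) => [i _|h]; first by have [lf _ _] := hfg i; exact: lf.
apply: measurable_bounded_integrable => //.
- by apply: leb_bounded => //; exact: compact_bounded.
- have c : f = cst (f 0).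
    by apply/funext => x; congr f; apply/rowP => j; have := h j.
  by rewrite c; exact: measurable_cst.
- exists `|f 0|; split; first exact: num_real.
  move=> y My x _ /=; rewrite (_ : x = 0) ?ltW//.
  by apply/rowP => j; have := h j.
Qed.

Let iG0 : lam.-integrable setT (EFin \o G0).
Proof.
rewrite /G0 -restrict_EFin -integrable_mkcond//; apply: integrable_Rsum => // i.
by apply: integrable_mulr => //; have [_ lg _] := hfg i; exact: lg.
Qed.

Let mI01 : measurable (`[0, 1]%classic : set R). Proof. exact: measurable_itv. Qed.

Let Phi (p : pt * R) := G0 (p.1 + p.2 *: v) * \1_(`[0, 1]%classic : set R) p.2.

Let mG0 : measurable_fun setT G0.
Proof. by apply/measurable_EFinP; exact: measurable_int iG0. Qed.

Let mPhi : measurable_fun setT Phi.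
Proof.
apply: measurable_funM.
  apply: (measurableT_comp mG0); apply: measurable_addf_rV => //.
  by apply: measurable_scalef_rV.
by apply: (measurableT_comp _ measurable_snd); exact: measurable_indic.
Qed.

Let iPhi : (lam \x lam1)%E.-integrable setT (EFin \o Phi).
Proof.
have mE : measurable_fun setT (EFin \o Phi) by exact/measurable_EFinP.
apply: (proj2 (integrable21ltyP lam lam1 _)); [exact: mE|].
have N : (\int[lam]_x `|(G0 x)%:E| < +oo)%E by have /integrableP[] := iG0.
have E (s : R) : (\int[lam]_x `|(Phi (x, s))%:E| = (\int[lam]_x `|(G0 x)%:E|) * (\1_(`[0, 1]%classic : set R) s)%:E)%E.
  rewrite -(@ge0_integral_shift _ _ (s *: v) (fun x => `|(G0 x)%:E|%E))//; last first.
    by apply: measurableT_comp => //; exact/measurable_EFinP.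
  rewrite -ge0_integralZr//.
    by apply: eq_integral => x _; rewrite /Phi /= -EFinM normrM; congr (_ * _)%:E; rewrite ger0_norm.
  apply: measurableT_comp => //; apply/measurable_EFinP.
  by apply: (measurableT_comp mG0); exact: measurable_shift_rV.
under eq_integral do rewrite E.
set X := (\int[lam]_x `|(G0 x)%:E|)%E in N *; have X0 : (0 <= X)%E by exact: integral_ge0.
have -> : X = (fine X)%:E by rewrite fineK// ge0_fin_numE.
rewrite ge0_integralZl//; last 2 first.
- by apply/measurable_EFinP; exact: measurable_indic.
- by rewrite lee_fin fine_ge0.
set Y := (Y in (_ * Y)%E); have -> : Y = lam1 `[0%R, 1%R] by exact: integral_indicT.
by rewrite lebesgue_measure_itv/= lte_fin ltr01 -EFinB -EFinM ltry.
Qed.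

Let avg x := \int[lam1]_(s in `[0%R, 1%R]) G0 (x + s *: v).

Let avgE x : avg x = \int[lam1]_s Phi (x, s).
Proof.
rewrite /avg Rintegral_mkcond; apply: eq_Rintegral => s _.
by rewrite patchE /Phi indicE; case: ifP => _; rewrite ?mulr1 ?mulr0.
Qed.

Let iavg : lam.-integrable setT (EFin \o avg).
Proof. by rewrite (funext avgE); exact: (integrable_Rfubini iPhi). Qed.

Let mavg : measurable_fun setT avg.
Proof. by apply/measurable_EFinP; exact: measurable_int iavg. Qed.

Section bump.
Variables (k : nat) (a' b' : pt).
Hypothesis ab' : forall i, a' ord0 i < b' ord0 i.
Hypothesis sab : crect a' b' `<=` rect a b.
Let eta := rect_bump k a' b'.

Let deta x := \sum_i (- v) ord0 i * partial i eta x.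

Let seta : smooth eta.
Proof. by apply: prodfun_smooth => i; exact: rect_bump_factor_smooth. Qed.

Let eta_supp x : eta x != 0 -> crect a' b' x.
Proof.
move=> h; apply: rect_sub_crect; apply: contrapT => nx; move: h.
by rewrite /eta rect_bump_out// eqxx.
Qed.

Let shifted_test s : 0 <= s <= 1 -> test_function Omega (fun y => eta (s *: (- v) + y)).
Proof.
move=> s01; pose ff i y := 1 * rect_bump_factor k a' b' i (1 * y + s * (- v ord0 i)).
have -> : (fun y => eta (s *: - v + y)) = prodfun ff.
  apply/funext => y; rewrite /eta /rect_bump /prodfun; apply: eq_bigr => i _.
  by rewrite /ff !mxE !mul1r addrC.
apply: (@test_function_crect _ _ _ _ (a' + s *: v) (b' + s *: v)).
- move=> x hx; rewrite -[x](subrK (s *: v)); apply: habv => //; apply/rect_sub_crect/sab => i.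
  by have := hx i; rewrite !mxE lerBrDr lerBlDr.
- by move=> i; apply: smooth1_affine; exact: rect_bump_factor_smooth.
move=> i y; rewrite /ff !mul1r !mxE => h; have : a' ord0 i < y + s * - v ord0 i < b' ord0 i.
  by apply: contraNT h => h; rewrite rect_bump_factor_out.
by move=> /andP[h1 h2]; apply/andP; split; lra.
Qed.

Let shifted_supp s y : 0 <= s <= 1 -> eta (s *: (- v) + y) != 0 -> K y.
Proof.
move=> s01 /eta_supp/sab/rect_sub_crect h.
by rewrite (_ : y = (s *: - v + y) + s *: v); [exact: KP|rewrite scalerN addrAC addNr add0r].
Qed.

Let deta_is_derive x : is_derive x (- v) eta (deta x).
Proof.
apply: differentiable_derive_sum; apply: prodfun_diff => i; exact: rect_bump_factor_smooth.
Qed.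

Let eta1 x : `|eta x| <= 1. Proof. exact: rect_bump_norm. Qed.

Let meta : measurable_fun setT eta.
Proof. exact: continuous_measurable_rV (smooth_continuous seta). Qed.

Let eta_bs : bounded_support eta.
Proof.
have [r _ hr] := bounded_sub_cbox (@crect_bounded _ _ a' b').
by exists r => x /eta_supp /hr.
Qed.

Let mdeta : measurable_fun setT deta.
Proof.
apply: measurable_sum => i; apply: measurable_funM => //.
exact: continuous_measurable_rV (smooth_continuous (smooth_partial i seta)).
Qed.

Let deta_bounded : exists2 M, 1 <= M & forall x, `|deta x| <= M.
Proof.
have /choice[M hM] : forall i, exists M, forall x, `|partial i eta x| <= M.
  move=> i; apply: bounded_support_bounded; first exact: smooth_continuous (smooth_partial i seta).
  have [r hr] := eta_bs; exists r; apply: derive_supp hr; first exact: cbox_closed.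
  by move=> x; exact: smooth_is_derive.
exists (1 + \sum_i `|(- v) ord0 i| * M i).
  rewrite lerDl; apply: sumr_ge0 => i _; rewrite mulr_ge0//; exact: le_trans (hM i 0).
move=> x; apply: (@le_trans _ _ (\sum_i `|(- v) ord0 i| * M i)); last by rewrite lerDr.
apply: le_trans (ler_norm_sum _ _ _) _; apply: ler_sum => i _.
by rewrite normrM ler_wpM2l.
Qed.

(** [H s] pairs f with the bump translated by s v. Its derivative falls on the bump, and the
    definition of the weak derivative transfers it to f, which gives [h s]. The fundamental theorem
    of calculus on [0, 1] and Fubini then give the difference quotient formula, tested against the
    bump. *)
Let H s := \int[lam]_y (f0 y * eta (s *: (- v) + y)).
Let h s := \int[lam]_y (G0 y * eta (s *: (- v) + y)).

Let H_derive (s : R) : is_derive s 1 H (\int[lam]_y (f0 y * deta (s *: (- v) + y))).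
Proof.
have [M M1 hM] := deta_bounded.
by apply: (@is_derive_translate_integral _ _ f0 eta deta _ M) => // x; exact: le_trans (eta1 x) M1.
Qed.

Let h_continuous : continuous h.
Proof.
have [M M1 hM] := deta_bounded => s.
have [d _] : is_derive s 1 h (\int[lam]_y (G0 y * deta (s *: (- v) + y))).
  by apply: (@is_derive_translate_integral _ _ G0 eta deta _ M) => // x; exact: le_trans (eta1 x) M1.
by apply/differentiable_continuous/derivable1_diffP.
Qed.

Let H_continuous : continuous H.
Proof. by move=> s; have [d _] := H_derive s; apply/differentiable_continuous/derivable1_diffP. Qed.

Let H_h (s : R) : 0 <= s <= 1 -> \int[lam]_y (f0 y * deta (s *: (- v) + y)) = h s.
Proof.
move=> s01; have ts := shifted_test s01; set c := fun y => _ in ts.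
have pc i y : partial i c y = partial i eta (s *: (- v) + y).
  have [_ <-] := @is_derive_shift _ _ eta (s *: - v) (delta_mx ord0 i) y _ (smooth_is_derive i (s *: - v + y) seta).
  by [].
have cK y : c y != 0 -> K y by exact: shifted_supp.
have pcK i y : partial i c y != 0 -> K y.
  apply: derive_supp cK y; first by apply: compact_closed => //; exact: norm_hausdorff.
  by move=> x; apply: smooth_is_derive; have [] := ts.
have fK (F C : pt -> R) : (forall y, C y != 0 -> K y) -> forall y, (F \_ K) y * C y = F y * C y.
  move=> hC y; rewrite patchE; case: ifPn => // /negP ny.
  have [->|/hC Ky] := eqVneq (C y) 0; first by rewrite !mulr0.
  by exfalso; apply: ny; exact/mem_set.
have ipE (F C : pt -> R) : (forall y, C y != 0 -> K y) -> \int[lam]_y (F y * C y) = ip Omega F C.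
  move=> hC; rewrite /ip [RHS](@Rintegral_supp _ _ Omega)// => x nO.
  have [->|/hC/K_Omega //] := eqVneq (C x) 0; by rewrite mulr0.
have iK (F C : pt -> R) : test_function Omega C -> locally_integrable_on Omega F -> (forall y, C y != 0 -> K y) ->
   lam.-integrable setT (EFin \o (fun y => F y * C y)).
  move=> tC lF hC; apply/(@integrable_supp _ _ Omega).
  - exact: open_measurable_rV.
  - move=> x nO; have [->|/hC/K_Omega //] := eqVneq (C x) 0; by rewrite mulr0.
  - exact: locint_test_integrable.
transitivity (\int[lam]_y \sum_i ((- v) ord0 i * (f y * partial i c y))).
  apply: eq_Rintegral => y _; rewrite /deta mulr_sumr; apply: eq_bigr => i _.
  by rewrite -pc mulrCA /f0 fK//; exact: pcK.
rewrite Rintegral_sum//; last first.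
  move=> i; apply: integrable_mulr => //; apply: iK => //; last exact: pcK.
    exact: test_function_partial.
  by have [] := hfg i.
transitivity (\int[lam]_y \sum_i (v ord0 i * (g i y * c y))); last first.
  rewrite /h; apply: eq_Rintegral => y _; rewrite (_ : eta (s *: - v + y) = c y)//.
  rewrite /G0 fK// /G mulr_suml; apply: eq_bigr => i _.
  by rewrite mulrA.
rewrite Rintegral_sum//; last first.
  move=> i; apply: integrable_mulr => //; apply: iK => //.
  by have [] := hfg i.
apply: eq_bigr => i _; have [lf lg hw] := hfg i.
rewrite RintegralZl//; last by apply: iK => //; [exact: test_function_partial|exact: pcK].
rewrite RintegralZl//; last exact: iK.
rewrite ipE; last exact: pcK.
by rewrite hw// ipE// mxE mulrNN.
Qed.

Let FTC : (\int[lam1]_(s in `[0%R, 1%R]) (h s)%:E = (H 1 - H 0)%:E)%E.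
Proof.
rewrite EFinB; apply: continuous_FTC2 => //.
- exact: continuous_subspaceT.
- split=> [s _| |]; first by have [] := H_derive s.
  + by apply: cvg_at_right_filter; exact: H_continuous.
  + by apply: cvg_at_left_filter; exact: H_continuous.
move=> s; rewrite in_itv/= => /andP[s0 s1]; rewrite derive1E.
by have [_ ->] := H_derive s; rewrite H_h// !ltW.
Qed.

Let imul (F : pt -> R) : lam.-integrable setT (EFin \o F) ->
  lam.-integrable setT (EFin \o (fun x => F x * eta x)).
Proof.
move=> iF; apply: le_integrable (iF) => //.
  apply/measurable_EFinP; apply: measurable_funM => //.
  by apply/measurable_EFinP; exact: measurable_int iF.
by move=> x _; rewrite lee_fin normrM ler_piMr.
Qed.

Let Phi_eta (p : pt * R) := Phi p * eta p.1.

Let iPhi_eta : (lam \x lam1)%E.-integrable setT (EFin \o Phi_eta).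
Proof.
apply: le_integrable (iPhi) => //.
  apply/measurable_EFinP; apply: measurable_funM => //.
  exact: (measurableT_comp meta measurable_fst).
by move=> x _; rewrite lee_fin normrM ler_piMr.
Qed.

Let h_shift (s : R) : h s = \int[lam]_x (G0 (x + s *: v) * eta x).
Proof.
rewrite /h -[LHS](Rintegral_shift (s *: v)).
  by apply: eq_Rintegral => x _; rewrite [x + _]addrC scalerN addKr.
apply: measurable_funM => //; apply: (measurableT_comp meta).
exact: measurable_shiftl_rV.
Qed.

Let int_avg_eta : \int[lam]_x (avg x * eta x) = H 1 - H 0.
Proof.
apply: EFin_inj; rewrite -FTC.
transitivity ((\int[lam]_x \int[lam1]_s Phi_eta (x, s))%:E).
  congr EFin; apply: ae_eq_Rintegral => //.
  - by apply: measurable_funM.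
  - by apply/measurable_EFinP; exact: measurable_int (integrable_Rfubini iPhi_eta).
  apply: filterS (ae_integrable_section iPhi) => x ix _.
  by rewrite avgE -RintegralZr.
rewrite (EFin_Rfubini iPhi_eta); apply: (etrans (Fubini iPhi_eta)).
rewrite [RHS]integral_mkcond; apply: eq_integral => s _.
transitivity (\int[lam]_x ((\1_(`[0, 1]%classic : set R) s * (G0 (x + s *: v) * eta x))%:E))%E.
  by apply: eq_integral => x _; rewrite /Phi_eta /Phi /= mulrAC mulrC mulrA.
have is' : lam.-integrable setT (EFin \o (fun x => G0 (x + s *: v) * eta x)).
  by apply: (imul (F := fun x => G0 (x + s *: v))); exact: (integrable_shift _ iG0).
rewrite EFin_Rintegral//; last exact: integrable_mulr.
rewrite RintegralZl// -h_shift patchE indicE.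
by case: ifP => _; rewrite ?mul1r ?mul0r.
Qed.

Lemma int_diff_eta : \int[lam]_x ((f0 (x + v) - f0 x - avg x) * eta x) = 0.
Proof.
have i1 := integrable_shift v if0.
have E : (fun x => (f0 (x + v) - f0 x - avg x) * eta x) =
   (fun x => f0 (x + v) * eta x - f0 x * eta x - avg x * eta x).
  by apply/funext => x; rewrite !mulrBl.
have iA : lam.-integrable setT (EFin \o (fun x => f0 (x + v) * eta x)) by exact: (imul (F := fun x => f0 (x + v))).
have iB := imul if0; have iC := imul iavg.
rewrite E (RintegralB measurableT (integrable_subr measurableT iA iB) iC) (RintegralB measurableT iA iB).
rewrite int_avg_eta /H.
have -> : \int[lam]_x (f0 (x + v) * eta x) = \int[lam]_y (f0 y * eta (1 *: - v + y)).
  rewrite -[RHS](Rintegral_shift v).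
    by apply: eq_Rintegral => x _; rewrite scale1r [x + v]addrC addKr.
  apply: measurable_funM; first by apply/measurable_EFinP; exact: measurable_int if0.
  apply: (measurableT_comp meta); exact: measurable_shiftl_rV.
have -> : \int[lam]_y (f0 y * eta (0 *: - v + y)) = \int[lam]_x (f0 x * eta x).
  by apply: eq_Rintegral => y _; rewrite scale0r add0r.
exact: subrr.
Qed.

End bump.

Lemma difference_quotient_rect : \forall x \ae lam, rect a b x ->
  f (x + v) - f x = \int[lam1]_(s in `[0%R, 1%R]) (\sum_i v ord0 i * g i (x + s *: v)).
Proof.
have : \forall x \ae lam, rect a b x -> f0 (x + v) - f0 x - avg x = 0.
  apply: (@du_bois_reymond R n (rect a b) (fun x => f0 (x + v) - f0 x - avg x)).
  - exact: rect_open.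
  - move=> a' b' _; apply: (integrableS measurableT) => //.
      by apply: closed_measurable_rV; exact: crect_closed.
    apply: integrable_subr => //; apply: integrable_subr => //.
    exact: (integrable_shift v if0).
  move=> k a' b' ab' sab; rewrite Rintegral_supp; first exact: int_diff_eta.
  move=> x nx; rewrite rect_bump_out// ?mulr0// => /rect_sub_crect /sab //.
apply: filterS => x hx rx; move: (hx rx) => /eqP; rewrite subr_eq0 => /eqP.
have cx := rect_sub_crect rx.
rewrite /f0 !patchE !mem_set; last 2 first.
- by have := @KP x 0 cx; rewrite scale0r addr0; apply; rewrite ler01 lexx.
- by have := @KP x 1 cx; rewrite scale1r; apply; rewrite ler01 lexx.
move=> ->; apply: eq_Rintegral => s /set_mem; rewrite /= in_itv/= => s01.
by rewrite /G0 patchE mem_set//; exact: KP.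
Qed.

End difference_quotient.

Lemma sqr_sum_le (R : realType) (n : nat) (u : 'I_n -> R) :
  (\sum_i u i) ^+ 2 <= n%:R * \sum_i u i ^+ 2.
Proof.
have key : \sum_(i < n) \sum_(j < n) (u i ^+ 2 + u j ^+ 2) = 2 * (n%:R * \sum_i u i ^+ 2).
  under eq_bigr do rewrite big_split/= sumr_const card_ord.
  rewrite big_split/= sumr_const card_ord sumrMnl mulr_natl.
  by rewrite mulr_natl mulr2n.
rewrite -(ler_pM2l (ltr0Sn _ 1)) -key expr2 mulr_suml mulr_sumr; apply: ler_sum => i _.
rewrite !mulr_sumr; apply: ler_sum => j _.
by have := sqr_ge0 (u i - u j); rewrite sqrrB -mulr_natl; lra.
Qed.

Section dirichlet.
Variables (R : realType) (n : nat).
Local Notation pt := 'rV[R]_n.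
Local Notation lam := (leb R n).
Local Notation lam1 := (@lebesgue_measure R).
Variable Omega : set pt.
Hypothesis oO : open Omega.
Let mO : measurable Omega := open_measurable_rV oO.

Lemma restrict_measurable (D : set pt) (f : pt -> R) : measurable D -> measurable_fun D f ->
  measurable_fun setT (f \_ D).
Proof. by move=> mD mf; apply/(measurable_restrictT f mD). Qed.

Section energy_form.
Variables (f : pt -> R) (g : 'I_n -> pt -> R).
Hypothesis mf : measurable_fun Omega f.
Hypothesis hfg : forall i, is_weak_partial Omega i f (g i).

Let mg i : measurable_fun Omega (g i).
Proof. by apply: locally_integrable_measurable => //; have [] := hfg i. Qed.

Definition dirichlet : \bar R := (\int[lam]_(x in Omega) (\sum_i g i x ^+ 2)%:E)%E.

Let fO := f \_ Omega.
Let mfO : measurable_fun setT fO. Proof. exact: restrict_measurable. Qed.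

Lemma difference_quotient_ae (v : pt) : \forall x \ae lam, segset Omega v x ->
  f (x + v) - f x = \int[lam1]_(s in `[0%R, 1%R]) (\sum_i v ord0 i * g i (x + s *: v)).
Proof.
apply: ae_ratbox; first exact: segset_open.
move=> p; rewrite cbox_crect obox_rect => h.
exact: (difference_quotient_rect oO hfg h).
Qed.

(** Jensen along the segment, then Tonelli: by translation invariance each s contributes at most the
    integral over Omega of the squared derivative along v, whatever A is. Cauchy-Schwarz over the n
    coordinates gives the factor n rho^2. *)
Lemma difference_quotient_le (v : pt) (rho : R) (A : set pt) : (forall i, `|v ord0 i| <= rho) ->
  measurable A -> A `<=` segset Omega v ->
  (\int[lam]_(x in A) ((fO (x + v) - fO x) ^+ 2)%:E <= (n%:R * rho ^+ 2)%:E * dirichlet)%E.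
Proof.
move=> hv mA As.
pose G x := \sum_i v ord0 i * g i x; pose GO := G \_ Omega.
have mGO : measurable_fun setT GO.
  apply: restrict_measurable => //; apply: measurable_sum => i; exact: measurable_funM.
have mGs : measurable_fun setT (fun p : pt * R => GO (p.1 + p.2 *: v)).
  by apply: (measurableT_comp mGO); apply: measurable_addf_rV => //; exact: measurable_scalef_rV.
pose Psi (p : pt * R) := (GO (p.1 + p.2 *: v) ^+ 2 * \1_(`[0, 1]%classic : set R) p.2)%:E.
have mPsi : measurable_fun setT Psi.
  apply/measurable_EFinP; apply: measurable_funM; first exact: measurable_funX.
  by apply: (measurableT_comp _ measurable_snd); exact: measurable_indic.
have Psi0 p : (0 <= Psi p)%E by rewrite lee_fin mulr_ge0// sqr_ge0.
pose J x := (\int[lam1]_s Psi (x, s))%E.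
have mJ : measurable_fun setT J.
  exact: (@measurable_fun_fubini_tonelli_F _ _ _ _ _ lam1 Psi mPsi Psi0).
have mshift : measurable_fun setT (fun x : pt => fO (x + v) - fO x).
  apply: measurable_funB => //; apply: (measurableT_comp mfO); exact: measurable_shift_rV.
apply: (@le_trans _ _ (\int[lam]_(x in A) J x)%E).
  apply: ae_ge0_le_integral => //.
  - by move=> x _; rewrite lee_fin sqr_ge0.
  - by apply/measurable_EFinP; apply: measurable_funX; exact: measurable_funTS.
  - by move=> x _; apply: integral_ge0.
  - exact: measurable_funTS.
  apply: filterS (difference_quotient_ae v) => x hx Ax.
  have sx := As _ Ax.
  have x1 : Omega (x + v) by have := sx 1; rewrite scale1r; apply; rewrite ler01 lexx.
  have x0 : Omega x by have := sx 0; rewrite scale0r addr0; apply; rewrite ler01 lexx.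
  rewrite /fO !patchE !mem_set// hx//.
  have -> : \int[lam1]_(s in `[0%R, 1%R]) (\sum_i v ord0 i * g i (x + s *: v)) =
      \int[lam1]_(s in `[0%R, 1%R]) GO (x + s *: v).
    apply: eq_Rintegral => s /set_mem; rewrite /= in_itv/= => s01.
    by rewrite /GO patchE mem_set//; exact: sx.
  apply: le_trans (sqr_Rintegral01_le _) _.
    apply: measurable_funTS; apply: (measurableT_comp mGO).
    rewrite (_ : (fun s : R => _) = (fun s : R => s *: v + x)); last by apply/funext => s; rewrite addrC.
    apply: (measurableT_comp (measurable_shift_rV x)); exact: measurable_scalef_rV.
  rewrite integral_mkcond le_eqVlt; apply/orP; left; apply/eqP; apply: eq_integral => s _.
  by rewrite patchE /Psi indicE /=; case: ifP => _; rewrite ?mulr1 ?mulr0.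
apply: (@le_trans _ _ (\int[lam]_x J x)%E).
  by apply: ge0_subset_integral => // x _; exact: integral_ge0.
have -> : (\int[lam]_x J x = \int[lam1]_s \int[lam]_x Psi (x, s))%E.
  exact: (@fubini_tonelli _ _ _ _ _ lam lam1 Psi mPsi Psi0).
have sh (s : R) : (\int[lam]_x Psi (x, s) = (\int[lam]_x (GO x ^+ 2)%:E) * (\1_(`[0, 1]%classic : set R) s)%:E)%E.
  rewrite -(@ge0_integral_shift _ _ (s *: v) (fun x => (GO x ^+ 2)%:E))//; last 2 first.
  - by apply/measurable_EFinP; exact: measurable_funX.
  - by move=> x; rewrite lee_fin sqr_ge0.
  rewrite -ge0_integralZr//.
  - apply/measurable_EFinP; apply: measurable_funX; apply: (measurableT_comp mGO).
    exact: measurable_shift_rV.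
  - by move=> x _; rewrite lee_fin sqr_ge0.
apply: (@le_trans _ _ (\int[lam]_x (GO x ^+ 2)%:E)%E).
  have [Xoo|] := ltP (\int[lam]_x (GO x ^+ 2)%:E)%E +oo%E; last by rewrite leye_eq => /eqP ->; rewrite leey.
  under eq_integral do rewrite sh.
  move: Xoo; set X := (\int[lam]_x (GO x ^+ 2)%:E)%E => Xoo.
  have X0 : (0 <= X)%E by apply: integral_ge0 => x _; rewrite lee_fin sqr_ge0.
  have -> : X = (fine X)%:E by rewrite fineK// ge0_fin_numE.
  rewrite ge0_integralZl//; last 2 first.
  - by apply/measurable_EFinP; exact: measurable_indic.
  - by rewrite lee_fin fine_ge0.
  set Y := (Y in (_ * Y)%E); have -> : Y = lam1 `[0%R, 1%R] by exact: integral_indicT.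
  by rewrite lebesgue_measure_itv/= lte_fin ltr01 -EFinB subr0 mule1.
rewrite /dirichlet -ge0_integralZl//; last 3 first.
- by apply/measurable_EFinP; apply: measurable_sum => i; exact: measurable_funX.
- by move=> x _; rewrite lee_fin; apply: sumr_ge0 => i _; exact: sqr_ge0.
- by rewrite lee_fin mulr_ge0// sqr_ge0.
rewrite [leRHS]integral_mkcond; apply: ge0_le_integral_gen => x _.
  by rewrite lee_fin sqr_ge0.
rewrite /GO !patchE; case: ifP => _; last by rewrite expr0n.
rewrite -EFinM lee_fin; apply: le_trans (sqr_sum_le _) _.
rewrite -mulrA ler_wpM2l// mulr_sumr; apply: ler_sum => i _.
by rewrite exprMn ler_wpM2r ?sqr_ge0// -real_normK ?num_real// lerXn2r// nnegrE (le_trans _ (hv i)).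
Qed.

End energy_form.
End dirichlet.

(** * Poincare-Wirtinger inequality on a C^1 domain *)

Section double_integral.
Variables (R : realType) (n : nat).
Local Notation pt := 'rV[R]_n.
Local Notation lam := (leb R n).
Variable f : pt -> R.
Hypothesis mf : measurable_fun setT f.

Definition kappa (B : set pt) (x : pt) : \bar R :=
  (\int[lam]_(y in B) ((f x - f y) ^+ 2)%:E)%E.

(* By (f x - f z)^2 <= 2 (f x - f y)^2 + 2 (f y - f z)^2, averaged over y in B,
   smallness of osc2 is transitive through a set B of positive measure. *)
Definition osc2 (A B : set pt) : \bar R := (\int[lam]_(x in A) kappa B x)%E.

Let K (A B : set pt) (p : pt * pt) : \bar R :=
  (\1_A p.1 * \1_B p.2 * (f p.1 - f p.2) ^+ 2)%:E.

Let K_ge0 A B p : (0 <= K A B p)%E.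
Proof. by rewrite lee_fin mulr_ge0 ?sqr_ge0// mulr_ge0. Qed.

Let mK A B : measurable A -> measurable B -> measurable_fun setT (K A B).
Proof.
move=> mA mB; apply/measurable_EFinP; apply: measurable_funM; first apply: measurable_funM.
- by apply: (measurableT_comp _ measurable_fst); exact: measurable_indic.
- by apply: (measurableT_comp _ measurable_snd); exact: measurable_indic.
- apply: measurable_funX; apply: measurable_funB.
  + exact: (measurableT_comp mf measurable_fst).
  + exact: (measurableT_comp mf measurable_snd).
Qed.

Let kappaE A B x : (\int[lam]_y K A B (x, y) = (\1_A x)%:E * kappa B x)%E.
Proof.
rewrite /kappa /K/= [in RHS]integral_mkcond indicE; case: (x \in A) => /=; last first.
  by rewrite mul0e; apply: integral0_eq => y _; rewrite !mul0r.
rewrite mul1e; apply: eq_integral => y _; rewrite patchE indicE mul1r.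
by case: (y \in B); rewrite ?mul1r ?mul0r.
Qed.

Lemma kappa_ge0 B x : (0 <= kappa B x)%E.
Proof. by apply: integral_ge0 => y _; rewrite lee_fin sqr_ge0. Qed.

Lemma osc2_ge0 A B : (0 <= osc2 A B)%E.
Proof. by apply: integral_ge0 => y _; exact: kappa_ge0. Qed.

Lemma measurable_kappa B : measurable B -> measurable_fun setT (kappa B).
Proof.
move=> mB; have := measurable_fun_fubini_tonelli_F (m2 := lam) (K setT B) (mK measurableT mB) (K_ge0 setT B).
rewrite /fubini_F (_ : (fun x : pt => _) = kappa B)//; apply/funext => x.
by rewrite kappaE indicT mul1e.
Qed.

Lemma osc2_iter A B : (osc2 A B = \int[lam]_x \int[lam]_y K A B (x, y))%E.
Proof.
rewrite /osc2 integral_mkcond; apply: eq_integral => x _.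
by rewrite kappaE patchE indicE; case: (x \in A); rewrite ?mul1e ?mul0e.
Qed.

Lemma osc2C A B : measurable A -> measurable B -> osc2 A B = osc2 B A.
Proof.
move=> mA mB; rewrite !osc2_iter.
have -> : (\int[lam]_x \int[lam]_y K A B (x, y) = \int[lam]_y \int[lam]_x K A B (x, y))%E.
  exact: (@fubini_tonelli _ _ _ _ _ lam lam (K A B) (mK mA mB) (K_ge0 A B)).
apply: eq_integral => y _; apply: eq_integral => x _; rewrite /K/=; congr EFin.
by rewrite (mulrC (\1_A x)) -sqrrN opprB.
Qed.

Lemma osc2S A A' B B' : measurable A -> measurable A' -> measurable B' ->
  A `<=` A' -> B `<=` B' -> measurable B -> (osc2 A B <= osc2 A' B')%E.
Proof.
move=> mA mA' mB' AA BB mB; apply: (@le_trans _ _ (osc2 A B')).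
  apply: ge0_le_integral_gen => x _; first exact: kappa_ge0.
  apply: ge0_subset_integral => //.
  - apply/measurable_EFinP; apply: measurable_funTS; apply: measurable_funX.
    by apply: measurable_funB => //; exact: measurable_cst.
  - by move=> y _; rewrite lee_fin sqr_ge0.
apply: ge0_subset_integral => //; last by move=> *; exact: kappa_ge0.
by apply: measurable_funTS; exact: measurable_kappa.
Qed.

Lemma osc2U A A' B : measurable A -> measurable A' -> measurable B ->
  (osc2 (A `|` A') B <= osc2 A B + osc2 A' B)%E.
Proof.
move=> mA mA' mB; rewrite /osc2 -(setDUK (@subsetUl _ A A')).
rewrite ge0_integral_setU//.
- rewrite leeD2l//; apply: ge0_subset_integral => //.
  + by apply: measurableD => //; exact: measurableU.
  + by apply: measurable_funTS; exact: measurable_kappa.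
  + by move=> *; exact: kappa_ge0.
  + by rewrite setDUl setDv set0U; exact: subDsetl.
- by apply: measurableD => //; exact: measurableU.
- by apply: measurable_funTS; exact: measurable_kappa.
- by move=> *; exact: kappa_ge0.
- by apply/disj_setPS => x [Ax [_]].
Qed.

Lemma osc2_trans A B E : measurable A -> measurable B -> measurable E ->
  (lam B < +oo)%E ->
  (lam B * osc2 A E <= 2%:E * (lam E * osc2 A B + lam A * osc2 E B))%E.
Proof.
move=> mA mB mE Bf.
have k2 (x y : pt) : (lam B * ((f x - f y) ^+ 2)%:E <= 2%:E * kappa B x + 2%:E * kappa B y)%E.
  have mq (z : pt) : measurable_fun B (fun b : pt => ((f z - f b) ^+ 2)%:E).
    apply/measurable_EFinP; apply: measurable_funTS; apply: measurable_funX.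
    by apply: measurable_funB => //; exact: measurable_cst.
  have k2 z : (2%:E * kappa B z = \int[lam]_(b in B) (2%:E * ((f z - f b) ^+ 2)%:E))%E.
    by rewrite ge0_integralZl// => b _; rewrite lee_fin sqr_ge0.
  rewrite muleC -integral_cst// !k2.
  rewrite -ge0_integralD//; last 4 first.
  - by move=> z _; rewrite mule_ge0// lee_fin sqr_ge0.
  - by apply: measurable_funeM; exact: mq.
  - by move=> z _; rewrite mule_ge0// lee_fin sqr_ge0.
  - by apply: measurable_funeM; exact: mq.
  apply: ge0_le_integral_gen => b _; first by rewrite lee_fin sqr_ge0.
  rewrite -!EFinM -EFinD lee_fin.
  by have := sqr_ge0 (f x - f b - (f b - f y)); rewrite !expr2; lra.
have mkA := measurable_kappa mB.
rewrite /osc2 -ge0_integralZl//; last 2 first.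
- by apply: measurable_funTS; exact: measurable_kappa.
- by move=> *; exact: kappa_ge0.
apply: (@le_trans _ _ (\int[lam]_(x in A) (2%:E * kappa B x * lam E + 2%:E * osc2 E B))%E).
  apply: ge0_le_integral_gen => x _; first by rewrite mule_ge0// kappa_ge0.
  rewrite {1}/kappa -ge0_integralZl//; last 2 first.
  - apply/measurable_EFinP; apply: measurable_funTS; apply: measurable_funX.
    by apply: measurable_funB => //; exact: measurable_cst.
  - by move=> y _; rewrite lee_fin sqr_ge0.
  apply: (@le_trans _ _ (\int[lam]_(y in E) (2%:E * kappa B x + 2%:E * kappa B y))%E).
    by apply: ge0_le_integral_gen => y _ //; rewrite mule_ge0// lee_fin sqr_ge0.
  rewrite ge0_integralD//; last 3 first.
  - by move=> y _; rewrite mule_ge0// kappa_ge0.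
  - by move=> y _; rewrite mule_ge0// kappa_ge0.
  - by apply: measurable_funeM; exact: measurable_funTS.
  rewrite (integral_cst lam mE) ge0_integralZl//; first by exact: measurable_funTS.
  by move=> *; exact: kappa_ge0.
have m2k : measurable_fun A (fun x : pt => 2%:E * kappa B x)%E.
  by apply: measurable_funeM; exact: measurable_funTS.
rewrite ge0_integralD//; last 3 first.
- by move=> x _; rewrite mule_ge0// mule_ge0// kappa_ge0.
- by apply: emeasurable_funM.
- by move=> x _; rewrite mule_ge0// osc2_ge0.
rewrite (integral_cst lam mA).
rewrite ge0_integralZr//; last by move=> x _; rewrite mule_ge0// kappa_ge0.
rewrite ge0_integralZl//; last 2 first.
- exact: measurable_funTS.
- by move=> x _; exact: kappa_ge0.
have iA := integral_ge0 lam (fun x (_ : A x) => kappa_ge0 B x).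
have iE := integral_ge0 lam (fun x (_ : E x) => kappa_ge0 B x).
rewrite [leRHS]ge0_muleDr ?mule_ge0//.
by rewrite /osc2 (muleC (lam E)) (muleC (lam A)) !muleA.
Qed.

End double_integral.

(** * Linked sets *)

Section linked.
Variables (R : realType) (n : nat).
Local Notation pt := 'rV[R]_n.
Local Notation lam := (leb R n).
Variable Omega : set pt.
Hypothesis oO : open Omega.

(** The constant is chosen before f. Extending f by 0 makes it measurable on the whole space, as the
    lemmas on [osc2] require. *)
Definition linked (A B : set pt) : Prop :=
  exists2 C : R, 0 <= C & forall (f : pt -> R) (g : 'I_n -> pt -> R),
    measurable_fun Omega f -> (forall i, is_weak_partial Omega i f (g i)) ->
    (osc2 (f \_ Omega) A B <= C%:E * dirichlet Omega g)%E.

Let mO : measurable Omega := open_measurable_rV oO.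

Lemma dirichlet_ge0 g : (0 <= dirichlet Omega g)%E.
Proof. by apply: integral_ge0 => x _; rewrite lee_fin sumr_ge0// => i _; exact: sqr_ge0. Qed.

Lemma linkedC A B : measurable A -> measurable B -> linked A B -> linked B A.
Proof.
move=> mA mB [C C0 h]; exists C; first exact: C0.
move=> f g mf hfg; rewrite osc2C//; [exact: h|exact: restrict_measurable].
Qed.

Lemma linkedS A A' B B' : measurable A -> measurable A' -> measurable B -> measurable B' ->
  A `<=` A' -> B `<=` B' -> linked A' B' -> linked A B.
Proof.
move=> mA mA' mB mB' AA BB [C C0 h]; exists C; first exact: C0.
move=> f g mf hfg; apply: le_trans (h f g mf hfg); apply: osc2S => //; exact: restrict_measurable.
Qed.

Lemma linkedU A A' B : measurable A -> measurable A' -> measurable B ->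
  linked A B -> linked A' B -> linked (A `|` A') B.
Proof.
move=> mA mA' mB [C C0 h] [C' C0' h']; exists (C + C'); first exact: addr_ge0.
move=> f g mf hfg; rewrite EFinD ge0_muleDl ?lee_fin//.
apply: (@le_trans _ _ (osc2 (f \_ Omega) A B + osc2 (f \_ Omega) A' B)%E).
  by apply: osc2U => //; exact: restrict_measurable.
by apply: leeD; [exact: h|exact: h'].
Qed.

Lemma linked_trans A B E : measurable A -> measurable B -> measurable E ->
  (lam A < +oo)%E -> (0 < lam B < +oo)%E -> (lam E < +oo)%E ->
  linked A B -> linked B E -> linked A E.
Proof.
move=> mA mB mE fA /andP[B0 fB] fE [C C0 h] /(linkedC mB mE)[C' C0' h'].
have fin (X : set pt) : (lam X < +oo)%E -> exists2 r : R, 0 <= r & lam X = r%:E.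
  by move=> fX; exists (fine (lam X)); rewrite ?fine_ge0// fineK// ge0_fin_numE.
have [a a0 aE] := fin _ fA; have [e e0 eE] := fin _ fE; have [b b0 bE] := fin _ fB.
have b_gt0 : 0 < b by rewrite -lte_fin -bE.
exists (b^-1 * (2 * (e * C + a * C'))).
  by rewrite mulr_ge0 ?invr_ge0// mulr_ge0// addr_ge0// mulr_ge0.
move=> f g mf hfg; have D0 := dirichlet_ge0 g.
have := osc2_trans (restrict_measurable mO mf) mA mB mE fB.
rewrite aE bE eE => tr.
have {}tr : (b%:E * osc2 (f \_ Omega) A E <= (2 * (e * C + a * C'))%:E * dirichlet Omega g)%E.
  apply: le_trans tr _; rewrite EFinM -muleA; apply: lee_wpmul2l => //.
  rewrite EFinD ge0_muleDl ?lee_fin ?mulr_ge0// !EFinM -!muleA.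
  by apply: leeD; apply: lee_wpmul2l; rewrite ?lee_fin//; [exact: h|exact: h'].
rewrite EFinM -muleA -(@lee_pmul2l _ b%:E) ?fin_numE//.
by rewrite [leRHS]muleA -EFinM divff ?gt_eqF// mul1e.
Qed.

(** Substituting y = x + v and exchanging the integrals leaves, for each v, an integral of
    difference quotients over the x in A with x + v in B, to which [difference_quotient_le] applies.
    Only v in the box of radius 2 rho count, and that box has finite measure. *)
Lemma linked_visible A B (rho : R) : measurable A -> measurable B ->
  A `<=` cbox 0 rho -> B `<=` cbox 0 rho ->
  (forall x y, A x -> B y -> segset Omega (y - x) x) -> linked A B.
Proof.
move=> mA mB Ar Br vis.
pose rr := rho *+ 2; pose V : set pt := cbox 0 rr.
have mV : measurable V by apply: closed_measurable_rV; exact: cbox_closed.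
have fV : lam V \is a fin_num by rewrite ge0_fin_numE//; exact: leb_cbox.
exists (n%:R * rr ^+ 2 * fine (lam V)).
  by rewrite mulr_ge0 ?fine_ge0// mulr_ge0// sqr_ge0.
move=> f g mf hfg; set fO := f \_ Omega.
have mfO : measurable_fun setT fO by exact: restrict_measurable.
rewrite osc2_iter.
pose L (p : pt * pt) : \bar R :=
  (\1_A p.1 * \1_B (p.2 + p.1) * (fO p.1 - fO (p.2 + p.1)) ^+ 2)%:E.
have madd : measurable_fun setT (fun p : pt * pt => p.2 + p.1).
  by apply: measurable_addf_rV; [exact: measurable_snd|exact: measurable_fst].
have mL : measurable_fun setT L.
  apply/measurable_EFinP; apply: measurable_funM; first apply: measurable_funM.
  - by apply: (measurableT_comp _ measurable_fst); exact: measurable_indic.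
  - by apply: (measurableT_comp _ madd); exact: measurable_indic.
  - apply: measurable_funX; apply: measurable_funB.
    + exact: (measurableT_comp mfO measurable_fst).
    + exact: (measurableT_comp mfO madd).
have L0 p : (0 <= L p)%E by rewrite lee_fin mulr_ge0 ?sqr_ge0// mulr_ge0.
have -> : (\int[lam]_x \int[lam]_y (\1_A (x, y).1 * \1_B (x, y).2 *
    (fO (x, y).1 - fO (x, y).2) ^+ 2)%:E = \int[lam]_x \int[lam]_y L (x, y))%E.
  apply: eq_integral => x _ /=.
  rewrite -(ge0_integral_shift x (f := fun y => (\1_A x * \1_B y * (fO x - fO y) ^+ 2)%:E))//.
  - apply/measurable_EFinP; apply: measurable_funM; first apply: measurable_funM.
    + exact: measurable_cst.
    + exact: measurable_indic.
    by apply: measurable_funX; apply: measurable_funB.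
  - by move=> y; rewrite lee_fin mulr_ge0 ?sqr_ge0// mulr_ge0.
have -> : (\int[lam]_x \int[lam]_y L (x, y) = \int[lam]_y \int[lam]_x L (x, y))%E.
  exact: (@fubini_tonelli _ _ _ _ _ lam lam L mL L0).
apply: (@le_trans _ _ (\int[lam]_(v in V) ((n%:R * rr ^+ 2)%:E * dirichlet Omega g))%E); last first.
  by rewrite (integral_cst lam mV) (EFinM _ (fine _)) fineK// -!muleA (muleC (dirichlet _ _)).
rewrite [leRHS]integral_mkcond; apply: ge0_le_integral_gen => v _; first by apply: integral_ge0.
rewrite patchE; case: ifPn => [vV|/negP vV].
  have mAv : measurable (A `&` (fun x : pt => x + v) @^-1` B).
    apply: measurableI => //; rewrite -[X in measurable X]setTI.
    exact: (measurable_shift_rV v).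
  apply: le_trans (difference_quotient_le (v := v) (rho := rr) (A := A `&` (fun x : pt => x + v) @^-1` B) oO mf hfg _ mAv _).
  - rewrite [leRHS]integral_mkcond; apply: ge0_le_integral_gen => x _; first exact: L0.
    rewrite patchE /L/= !indicE (addrC v).
    case: ifPn => [/set_mem[Ax Bx]|/negP nm].
      by rewrite !mem_set// !mul1r -sqrrN opprB.
    rewrite lee_fin; have [Ax|_] := boolP (x \in A); last by rewrite !mul0r.
    have [Bx|_] := boolP (x + v \in B); last by rewrite mulr0 mul0r.
    by exfalso; apply: nm; apply/mem_set; split; exact/set_mem.
  - by move=> i; have := set_mem vV; rewrite /V /cbox/= => /(_ i); rewrite mxE subr0.
  - move=> x [Ax Bx]; have := vis _ _ Ax Bx.
    by rewrite addrC addKr.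
rewrite le_eqVlt; apply/orP; left; apply/eqP; apply: integral0_eq => x _; rewrite /L/= !indicE.
have [/set_mem Ax|_] := boolP (x \in A); last by rewrite !mul0r.
have [/set_mem Bx|_] := boolP (v + x \in B); last by rewrite mulr0 mul0r.
exfalso; apply: vV; apply/mem_set; rewrite /V /cbox/= => i.
have := Ar _ Ax i; have := Br _ Bx i; rewrite !mxE !subr0 => h1 h2.
have -> : v ord0 i = v ord0 i + x ord0 i - x ord0 i by rewrite addrK.
by apply: le_trans (ler_normB _ _) _; rewrite /rr mulr2n lerD.
Qed.

End linked.

(** * Linking near a boundary point *)

Section boundary.
Variables (R : realType) (n : nat).
Local Notation pt := 'rV[R]_n.
Local Notation lam := (leb R n).
Local Notation e_ j := (delta_mx ord0 j : pt).

Lemma mvt_coord (f : pt -> R) (j : 'I_n) (x : pt) (t : R) :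
  (forall y, derivable f y (e_ j)) ->
  exists2 c, (0 <= c <= t) || (t <= c <= 0) &
    f (t *: e_ j + x) - f x = partial j f (c *: e_ j + x) * t.
Proof.
move=> df; pose g (u : R) := f (u *: e_ j + x).
have dg (u : R) : is_derive u 1 g (partial j f (u *: e_ j + x)).
  by apply: is_derive_along; apply: DeriveDef.
have cg : continuous g.
  move=> u; apply/differentiable_continuous/derivable1_diffP; by case: (dg u).
have f0 : f x = g 0 by rewrite /g scale0r add0r.
rewrite f0 -/(g t); have [t0|/ltW t0] := leP 0 t.
  have [|c c0t E] := MVT_segment t0 (fun u _ => dg u); first exact: continuous_subspaceT.
  by exists c; [move: c0t; rewrite in_itv/= => ->|rewrite E subr0].
have [|c c0t E] := MVT_segment t0 (fun u _ => dg u); first exact: continuous_subspaceT.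
exists c; first by move: c0t; rewrite in_itv/= => ->; rewrite orbT.
by rewrite -(opprB (g 0)) E sub0r mulrN opprK.
Qed.

(** The path from y to z changes one coordinate at a time, so each step is a one-variable mean value
    theorem and only partial derivatives enter; the intermediate points remain in the box. *)
Lemma box_increment (f : pt -> R) (o : pt) (r : R) (y z : pt) (c : 'I_n -> R) :
  (forall x j, derivable f x (e_ j)) -> obox o r y -> obox o r z ->
  (forall j x, obox o r x -> partial j f x * (z ord0 j - y ord0 j) <= c j) ->
  f z - f y <= \sum_j c j.
Proof.
move=> df oy oz hc.
pose Y (k : nat) : pt := \row_j (if (j < k)%N then z ord0 j else y ord0 j).
have Yo k : obox o r (Y k) by move=> j; rewrite mxE; case: ifP => _.
have -> : f z = f (Y n) by congr f; apply/rowP => j; rewrite mxE ltn_ord.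
have -> : f y = f (Y 0%N) by congr f; apply/rowP => j; rewrite mxE ltn0.
rewrite -(telescope_sumr (fun k => f (Y k)) (leq0n n)) big_mkord.
apply: ler_sum => k _; set t := z ord0 k - y ord0 k.
have YS : Y k.+1 = t *: e_ k + Y k.
  apply/rowP => j; rewrite !mxE eqxx/= eq_sym ltnS leq_eqVlt.
  have [->|kj] := eqVneq j k; first by rewrite eqxx/= ltnn mulr1 /t subrK.
  by rewrite (inj_eq val_inj) (negbTE kj)/= mulr0 add0r.
have [u ut] := mvt_coord (Y k) t (fun x => df x k).
rewrite -YS => ->; apply: hc => j; have := Yo k j; have := Yo k.+1 j; rewrite YS !mxE eqxx/=.
have [_|_] := eqVneq j k; last by rewrite !mulr0 !add0r.
rewrite !mulr1 !ltr_norml => /andP[a1 a2] /andP[b1 b2]; apply/andP.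
by case/orP: ut => /andP[u0 u1]; split; lra.
Qed.

Variable Omega : set pt.
Hypothesis oO : open Omega.

Lemma obox_segment (o : pt) r x y (s : R) : obox o r x -> obox o r y -> 0 <= s <= 1 ->
  obox o r (x + s *: (y - x)).
Proof.
move=> ox oy /andP[s0 s1] i; have := ox i; have := oy i; rewrite !mxE !ltr_norml.
move=> /andP[a1 a2] /andP[b1 b2].
have [->|sn0] := eqVneq s 0; first by rewrite mul0r addr0 b1.
have {}s0 : 0 < s by rewrite lt_neqAle eq_sym sn0.
move: a1 a2 b1 b2 s1; rewrite -subr_gt0 -[_ < r]subr_gt0 -[_ < _ - o ord0 i]subr_gt0.
rewrite -[x ord0 i - _ < r]subr_gt0 -[s <= 1]subr_ge0 => a1 a2 b1 b2 s1.
have := mulr_gt0 s0 a1; have := mulr_gt0 s0 a2.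
have := mulr_ge0 s1 (ltW b1); have := mulr_ge0 s1 (ltW b2).
by rewrite -[_ < r]subr_gt0 -[- r < _]subr_gt0 !mulrBl !mulrBr !mul1r => *; apply/andP; split; lra.
Qed.

Lemma obox_sub_cbox0 (o : pt) r : exists rho, obox o r `<=` cbox 0 rho.
Proof.
have [rho _ h] := bounded_sub_cbox (cbox_bounded o r).
by exists rho => x /obox_sub_cbox/h.
Qed.

Lemma linked_convex (o : pt) r A B : measurable A -> measurable B -> obox o r `<=` Omega ->
  A `<=` obox o r -> B `<=` obox o r -> linked Omega A B.
Proof.
move=> mA mB oOm Ao Bo; have [rho h] := obox_sub_cbox0 o r.
apply: (linked_visible oO (rho := rho)) => //.
- by move=> x /Ao/h.
- by move=> x /Bo/h.
- by move=> x y /Ao ox /Bo oy s s01; apply: oOm; exact: obox_segment.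
Qed.

(* From a small box around a boundary point, every point of Omega sees, along
   segments inside Omega, a box translated in the direction - sg p e_i, where
   p = d_i rho x0 <> 0: rho decreases along such segments. *)
Lemma boundary_linked (x0 : pt) : closure Omega x0 ->
  (~ Omega x0 -> exists2 r : R, 0 < r & exists rho : pt -> R,
        [/\ Ck 1 rho, exists i, partial i rho x0 != 0 &
          forall x, ball x0 r x -> (Omega x <-> rho x < 0)]) ->
  exists e c, [/\ 0 < e, obox c e `<=` Omega & linked Omega (obox x0 e `&` Omega) (obox c e)].
Proof.
move=> cx hb; have mO := open_measurable_rV oO.
have [Ox|/hb{hb}[r0 r00 [rho [Crho [i pi0] hrho]]]] := pselect (Omega x0).
  have /nbhs_ballP[e /= e0 he] : nbhs x0 Omega by exact: open_nbhs_nbhs.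
  rewrite ball_rV// in he; exists e, x0; split=> //.
  apply: (linked_convex _ _ he) => //; [|exact: obox_measurable].
  by apply: measurableI => //; exact: obox_measurable.
have df x j : derivable rho x (e_ j) by have [_] := Crho [::]; apply.
have cf : continuous rho by have [+ _] := Crho [::]; apply.
have cp j : continuous (partial j rho) by have [+ _] := Crho [:: j]; apply.
(* Half of |p|: by continuity, the i-th derivative of rho, multiplied by the sign of p, stays above
   m near x0. *)
pose p := partial i rho x0; pose m := `|p| / 2.
have m0 : 0 < m by rewrite divr_gt0// normr_gt0.
have near_box (P : pt -> Prop) : (\forall x \near x0, P x) -> exists2 r, 0 < r & forall x, obox x0 r x -> P x.
  by move=> /nbhs_ballP[e /= e0 he]; exists e => // x; rewrite -ball_rV//; exact: he.
have [r1 r10 hr1] : exists2 r1, 0 < r1 & forall x, obox x0 r1 x -> forall j, `|partial j rho x0 - partial j rho x| < m.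
  apply: (near_box (fun x => forall j, is_true (`|partial j rho x0 - partial j rho x| < m))).
  apply: (@filter_forall _ _ (fun (j : 'I_n) (x : pt) => is_true (`|partial j rho x0 - partial j rho x| < m)) (nbhs x0)) => j.
  exact: (cvgr_dist_lt (partial j rho) _ (cp j x0)).
pose r := Num.min r0 r1; have r_gt0 : 0 < r by rewrite lt_min r00.
have rr0 x : obox x0 r x -> ball x0 r0 x.
  by rewrite ball_rV// => h j; apply: lt_le_trans (h j) _; rewrite ge_min lexx.
have rr1 x : obox x0 r x -> obox x0 r1 x.
  by move=> h j; apply: lt_le_trans (h j) _; rewrite ge_min lexx orbT.
pose K := \sum_j `|partial j rho x0| + m.
have K0 : 0 < K by rewrite ltr_wpDl// sumr_ge0.
have hK x j : obox x0 r x -> `|partial j rho x| <= K.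
  move=> /rr1/hr1/(_ j) h; rewrite -(subrK (partial j rho x0) (partial j rho x)) addrC.
  apply: le_trans (ler_normD _ _) _; apply: lerD; last by rewrite distrC ltW.
  by rewrite (bigD1 j)//= lerDl sumr_ge0.
pose s := Num.sg p.
have sp : s * p = `|p| by rewrite /s -normrEsg.
have hi x : obox x0 r x -> m <= s * partial i rho x.
  move=> /rr1/hr1/(_ i); rewrite -/p => h.
  have : `|s * (p - partial i rho x)| < m.
    by rewrite normrM normr_sg pi0 mul1r.
  rewrite mulrBr sp ltr_norml => /andP[_].
  by rewrite /m; lra.
have ss : s * s = 1 by rewrite -expr2 sqr_sg pi0.
have s1 : `|s| = 1 by rewrite normr_sg pi0.
pose N : R := n%:R.
have N0 : 0 <= N by rewrite ler0n.
pose h := r / 2.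
(* Along a segment from the box around x0 to the one around c, the i-th coordinate lowers rho by at
   least m (h - 2 e), and each other one raises it by at most 2 e K. This e makes m h = 4 e (N K +
   m), so the decrease wins; it also gives 4 e <= h, which keeps both boxes inside the box of radius
   r. *)
pose e := h * m / (4 * (N * K + m)).
have NK0 : 0 < 4 * (N * K + m) by rewrite mulr_gt0// ltr_wpDl// mulr_ge0// ltW.
have h0 : 0 < h by rewrite divr_gt0.
have e0 : 0 < e by rewrite /e divr_gt0// mulr_gt0.
have eE : e * (4 * (N * K + m)) = h * m by rewrite /e mulfVK// gt_eqF.
have NK : 0 <= N * K by rewrite mulr_ge0// ltW.
have eh : 4 * e <= h.
  rewrite -(ler_pM2r m0) -eE.
  by rewrite (mulrC 4) -mulrA ler_pM2l// ler_pM2l// lerDr.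
pose c : pt := x0 - (h * s) *: e_ i.
have cE j : c ord0 j = x0 ord0 j - (if j == i then h * s else 0).
  by rewrite !mxE eqxx/=; case: eqP; rewrite ?mulr1 ?mulr0.
have Wr : obox x0 e `<=` obox x0 r.
  move=> x hx j; apply: lt_trans (hx j) _; move: eh; rewrite /h; lra.
have Vr : obox c e `<=` obox x0 r.
  move=> x hx j; have := hx j; rewrite cE; case: eqP => _; last first.
    by rewrite subr0 => /lt_trans; apply; move: eh; rewrite /h; lra.
  have : `|h * s| <= h by rewrite normrM s1 mulr1 gtr0_norm.
  rewrite ler_norml !ltr_norml => /andP[u1 u2] /andP[w1 w2].
  by apply/andP; split; move: eh u1 u2 w1 w2 e0; rewrite /h; set w := _ * s; lra.
have key y z : (obox x0 e `&` Omega) y -> obox c e z -> segset Omega (z - y) y.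
  move=> [yW yO] zV t t01.
  have yr := Wr _ yW; have zr := Vr _ zV.
  have sr := obox_segment yr zr t01.
  apply/(hrho _ (rr0 _ sr)).
  have rho_y : rho y < 0 by apply/hrho => //; exact: rr0.
  suff : rho (y + t *: (z - y)) - rho y <= 0 by lra.
  have /andP[t0 t1] := t01.
  pose C j := if j == i then - t * (m * (h - 2 * e)) else t * (2 * e * K).
  apply: (@le_trans _ _ (\sum_j C j)).
    apply: (box_increment df yr sr) => j x xr; rewrite !mxE addrAC subrr add0r mulrCA.
    have := yW j; have := zV j; rewrite cE /C; have [->|ji] := eqVneq j i.
      move=> zi yi; rewrite mulNr -mulrN; apply: ler_wpM2l => //.
      have q := hi _ xr; set Q := s * _ in q.
      have sz : s * (z ord0 i - y ord0 i) <= - (h - 2 * e).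
        have E : s * (z ord0 i - y ord0 i) = s * ((z ord0 i - (x0 ord0 i - h * s)) - (y ord0 i - x0 ord0 i)) - h.
          rewrite (_ : _ - (y ord0 i - x0 ord0 i) = z ord0 i - y ord0 i + h * s); last by ring.
          by rewrite (mulrDr s (_ - _) (h * s)) (mulrCA s h s) ss mulr1 addrK.
        rewrite E; have : `|s * (z ord0 i - (x0 ord0 i - h * s) - (y ord0 i - x0 ord0 i))| <= 2 * e.
          rewrite normrM s1 mul1r; apply: le_trans (ler_normB _ _) _.
          by rewrite mulr_natl mulr2n lerD// ltW.
        by rewrite ler_norml => /andP[_]; set X := s * _; lra.
      have he2 : 0 <= h - 2 * e by lra.
      rewrite (_ : partial i rho x * _ = Q * (s * (z ord0 i - y ord0 i))); last first.
        by rewrite /Q mulrACA ss mul1r.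
      have m0' : 0 <= Q by apply: le_trans q; exact: ltW.
      apply: le_trans (ler_wpM2l m0' sz) _.
      by rewrite !mulrN lerN2 ler_wpM2r.
    rewrite subr0 => z1 y1; apply: ler_wpM2l => //.
    apply: le_trans (ler_norm _) _; rewrite normrM mulrC; apply: ler_pM => //; last exact: hK.
    rewrite (_ : z ord0 j - y ord0 j = (z ord0 j - x0 ord0 j) - (y ord0 j - x0 ord0 j)); last by ring.
    apply: le_trans (ler_normB _ _) _.
    by rewrite mulr_natl mulr2n lerD// ltW.
  rewrite (bigD1 i)//= /C eqxx.
  have : \sum_(j | j != i) (if j == i then - t * (m * (h - 2 * e)) else t * (2 * e * K)) <= N * (t * (2 * e * K)).
    apply: (@le_trans _ _ (\sum_(j < n) (t * (2 * e * K)))).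
      have T0 : 0 <= t * (2 * e * K).
        by apply: mulr_ge0 => //; apply: mulr_ge0; [apply: mulr_ge0 => //|]; apply: ltW.
      rewrite [leRHS](bigD1 i)//=; apply: ler_wpDl => //.
      by apply: ler_sum => j /negbTE ->.
    by rewrite sumr_const card_ord /N [leRHS]mulr_natl; apply: lexx.
  set X := \sum_(_ | _) _ => hX.
  have : 0 <= t * (m * h - 2 * (m * e) - 2 * (e * (N * K))).
    apply: mulr_ge0 => //; rewrite (mulrC m h) -eE.
    have : 0 <= e * (N * K) by rewrite mulr_ge0// ltW.
    have : 0 <= e * m by rewrite mulr_ge0// ltW.
    rewrite (mulrC m e); lra.
  move: hX; rewrite (_ : N * (t * (2 * e * K)) = t * (2 * (e * (N * K)))); last by ring.
  rewrite (_ : - t * (m * (h - 2 * e)) = - (t * (m * h - 2 * (m * e)))); last by ring.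
  by rewrite !mulrBr; lra.
(* As x0 is in the closure, some y of Omega lies in its box, and each z in the box around c ends a
   segment from y inside Omega. *)
have Vo : obox c e `<=` Omega.
  have [y [yO yW]] : (Omega `&` obox x0 e) !=set0.
    by apply: cx; rewrite -ball_rV//; exact: nbhsx_ballx.
  move=> z zV; have := key y z (conj yW yO) zV 1; rewrite scale1r subrKC; apply.
  by rewrite ler01 lexx.
exists e, c; split=> //.
have [rho1 h1] := obox_sub_cbox0 x0 r.
apply: (linked_visible oO (rho := rho1)) => //.
- by apply: measurableI => //; exact: obox_measurable.
- exact: obox_measurable.
- by move=> y [/Wr/h1].
- by move=> z /Vr/h1.
Qed.

End boundary.

(** * Linking the whole domain to itself *)

Section domain.
Variables (R : realType) (n : nat).
Local Notation pt := 'rV[R]_n.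
Local Notation lam := (leb R n).
Variable Omega : set pt.
Hypothesis hOmega : C1_bounded_domain Omega.

Lemma domain_open : open Omega. Proof. by case: hOmega. Qed.
Local Notation oO := domain_open.
Lemma domain_measurable : measurable Omega. Proof. exact: open_measurable_rV domain_open. Qed.
Lemma domain_finite : (lam Omega < +oo)%E.
Proof. by apply: leb_bounded; [exact: domain_measurable|case: hOmega]. Qed.

Lemma leb_obox (c : pt) r : (lam (obox c r) < +oo)%E.
Proof.
apply: le_lt_trans (leb_cbox c r); apply: le_measure; rewrite ?inE.
- exact: obox_measurable.
- exact: cbox_measurable.
- exact: obox_sub_cbox.
Qed.

Lemma leb_open_gt0 (U : set pt) : open U -> U !=set0 -> (0 < lam U)%E.
Proof.
move=> oU [x Ux]; have /nbhs_ballP[e /= e0 he] : nbhs x U by exact: open_nbhs_nbhs.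
rewrite ball_rV// in he; apply: lt_le_trans (leb_obox_gt0 x e0) _.
by apply: le_measure; rewrite ?inE//; [exact: obox_measurable|exact: open_measurable_rV].
Qed.

Lemma domain_gt0 : (0 < lam Omega)%E.
Proof. by apply: leb_open_gt0; case: hOmega. Qed.

(** The overlap of V and V' is open and nonempty, hence of positive measure, and can serve as the
    intermediate set of [linked_trans]. *)
Lemma linked_overlap (A V V' E : set pt) : measurable A -> open V -> open V' -> measurable E ->
  (lam A < +oo)%E -> (lam V < +oo)%E -> (lam E < +oo)%E -> V `&` V' !=set0 ->
  linked Omega A V -> linked Omega V' E -> linked Omega A E.
Proof.
move=> mA oV oV' mE fA fV fE VV AV VE.
have mV := open_measurable_rV oV; have mV' := open_measurable_rV oV'.
have mVV : measurable (V `&` V') by exact: measurableI.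
have fVV : (lam (V `&` V') < +oo)%E.
  by apply: le_lt_trans fV; apply: le_measure; rewrite ?inE//; exact: subIsetl.
have VV0 : (0 < lam (V `&` V'))%E by apply: leb_open_gt0 => //; exact: openI.
have l1 := linkedS oO mA mA mVV mV (@subset_refl _ A) (@subIsetl _ V V') AV.
have l2 := linkedS oO mVV mV' mE mE (@subIsetr _ V V') (@subset_refl _ E) VE.
by apply: (linked_trans oO mA mVV mE fA _ fE l1 l2); rewrite VV0 fVV.
Qed.

(** Connectedness: the points that own a box linked to the one around a form a nonempty open set S,
    and so do the points of Omega outside S when there are any, because a box inside Omega that
    meets S is linked to each box it overlaps. *)
Lemma domain_chain (a : pt) (ra : R) : 0 < ra -> obox a ra `<=` Omega ->
  forall x, Omega x -> exists r, [/\ 0 < r, obox x r `<=` Omega & linked Omega (obox x r) (obox a ra)].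
Proof.
move=> ra0 aO.
pose S := [set x | exists r, [/\ 0 < r, obox x r `<=` Omega & linked Omega (obox x r) (obox a ra)]].
have self (x : pt) r : 0 < r -> obox x r x by move=> r0 i; rewrite subrr normr0.
have SO : S `<=` Omega by move=> x [r [r0 h _]]; apply: h; exact: self.
have inner (x y : pt) r : obox x r y -> exists2 e, 0 < e & obox y e `<=` obox x r.
  move=> xy; have /nbhs_ballP[e /= e0 he] : nbhs y (obox x r).
    by apply: open_nbhs_nbhs; split => //; exact: obox_open.
  by exists e => //; rewrite -ball_rV.
have oS : open S.
  rewrite openE => x [r [r0 h1 h2]]; rewrite /interior.
  apply/nbhs_ballP; exists r => //= y; rewrite ball_rV// => xy.
  have [e e0 he] := inner _ _ _ xy; exists e; split=> //.
    exact: subset_trans h1.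
  have mo := @obox_measurable R n.
  exact: (linkedS oO (mo _ _) (mo _ _) (mo _ _) (mo _ _) he (@subset_refl _ _) h2).
have step (x y : pt) r : 0 < r -> obox x r `<=` Omega -> obox x r y -> S y -> S x.
  move=> r0 xO xy [s [s0 h1 h2]]; exists r; split=> //.
  apply: (linked_overlap _ _ _ _ _ _ _ _ _ h2 (V := obox x r)).
  - exact: obox_measurable.
  - exact: obox_open.
  - exact: obox_open.
  - exact: obox_measurable.
  - exact: leb_obox.
  - exact: leb_obox.
  - exact: leb_obox.
  - by exists y; split => //; exact: self.
  - by apply: linked_convex xO _ _ => //; [exact: oO|exact: obox_measurable|exact: obox_measurable].
have oC : open (Omega `\` S).
  rewrite openE => x [Ox nSx]; rewrite /interior.
  have /nbhs_ballP[r /= r0 hr] : nbhs x Omega by apply: open_nbhs_nbhs; split => //; exact: oO.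
  apply/nbhs_ballP; exists r => //= y xy; split; first exact: hr.
  rewrite ball_rV// in hr xy; move=> Sy; apply: nSx; exact: (step x y r).
suff OS : S = Omega by move=> x; rewrite -[X in X x]OS.
 have [_ cO _ _ _] := hOmega; apply: cO.
- exists a; exists ra; split => //.
  by apply: linked_convex aO _ _ => //; [exact: oO|exact: obox_measurable|exact: obox_measurable].
- by exists S => //; rewrite setIidr.
- exists (~` (Omega `\` S)); first exact: open_closedC.
  rewrite predeqE => x; split=> [Sx|[Ox nx]]; first by split; [exact: SO|case].
  by apply: contrapT => nSx; apply: nx.
Qed.

Lemma bounded_set_closure (A : set pt) : bounded_set A -> bounded_set (closure A).
Proof.
move=> /bounded_sub_cbox[r _ h]; have : closure A `<=` cbox 0 r.
  by rewrite ((closure_id (cbox 0 r)).1 (@cbox_closed _ _ _ _)); exact: closure_subset.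
by move=> hs; have [M [Mr hM]] := @cbox_bounded R n 0 r; exists M; split => // N MN x /hs; exact: hM.
Qed.

(** Finitely many of the boxes given by [boundary_linked] cover the compact closure. The part of
    Omega in each of them is linked to the box around c, hence to V0 by [domain_chain]; then Omega
    is linked to itself through V0. *)
Lemma domain_linked : linked Omega Omega Omega.
Proof.
have [oOm cO [a Oa] bO hb] := hOmega; have mO := domain_measurable; have fO := domain_finite.
have /nbhs_ballP[ra /= ra0 aO] : nbhs a Omega by exact: open_nbhs_nbhs.
rewrite ball_rV// in aO; set V0 := obox a ra in aO.
have mV0 : measurable V0 := obox_measurable a ra.
have V0gt0 : (0 < lam V0)%E := leb_obox_gt0 a ra0.
have fV0 : (lam V0 < +oo)%E := leb_obox a ra.
have chain := domain_chain ra0 aO.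
have self (x : pt) r : 0 < r -> obox x r x by move=> r0 i; rewrite subrr normr0.
(* The hypothesis on x sits under the existential so that [choice] yields one radius function on all
   points; outside the closure the value is arbitrary. *)
have loc x : exists e : R, closure Omega x -> 0 < e /\ linked Omega (obox x e `&` Omega) V0.
  have [cx|ncx] := pselect (closure Omega x); last by exists 0.
  have [|e [c [e0 h1 h2]]] := boundary_linked oOm cx; first exact: hb.
  exists e => _; split; first exact: e0.
  have [r [r0 h3 h4]] := chain _ (h1 _ (self c e e0)).
  apply: (linked_overlap _ _ _ _ _ _ _ _ h2 h4).
  - by apply: measurableI => //; exact: obox_measurable.
  - exact: obox_open.
  - exact: obox_open.
  - by [].
  - apply: le_lt_trans (leb_obox x e); apply: le_measure; rewrite ?inE; last exact: subIsetl.
      by apply: measurableI => //; exact: obox_measurable.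
    exact: obox_measurable.
  - exact: leb_obox.
  - by [].
  - by exists c; split; exact: self.
have [e he] := choice loc.
have : compact (closure Omega).
  by apply: bounded_closed_compact; [exact: bounded_set_closure|exact: closed_closure].
rewrite compact_cover => /(_ pt (closure Omega) (fun x => obox x (e x))) [|x cx|D DO hD].
- by move=> x _; exact: obox_open.
- by exists x => //; apply: self; have [] := he _ cx.
suff OV0 : linked Omega Omega V0.
  apply: (linked_trans oOm mO mV0 mO fO _ fO OV0 (linkedC oOm mO mV0 OV0)).
  by rewrite V0gt0 fV0.
pose W (s : seq pt) : set pt := [set y | exists2 x, x \in s & (obox x (e x) `&` Omega) y].
have hW (s : seq pt) : {in s, forall x, closure Omega x} -> measurable (W s) /\ linked Omega (W s) V0.
  elim: s => [|x s IH] hs.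
    have -> : W [::] = set0 by rewrite predeqE => y; split => // -[].
    split; first exact: measurable0.
    apply: (linkedS oOm measurable0 mV0 mV0 mV0 (@sub0set _ _) (@subset_refl _ _)).
    exact: (linked_convex oOm mV0 mV0 aO).
  have -> : W (x :: s) = (obox x (e x) `&` Omega) `|` W s.
    rewrite predeqE => y; split=> [[z]|[xy|[z zs zy]]].
    - by rewrite inE => /orP[/eqP ->|zs zy]; [left|right; exists z].
    - by exists x; rewrite ?inE ?eqxx.
    - by exists z; rewrite ?inE ?zs ?orbT.
  have [|mW lW] := IH; first by move=> y ys; apply: hs; rewrite inE ys orbT.
  have mx : measurable (obox x (e x) `&` Omega) by apply: measurableI => //; exact: obox_measurable.
  split; first exact: measurableU.
  apply: linkedU => //; have [] := he x => //.
  by apply: hs; rewrite inE eqxx.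
have [|mW lW] := hW (finmap.enum_fset D).
  by move=> x /DO; rewrite inE.
apply: (linkedS oOm mO mW mV0 mV0 _ (@subset_refl _ _) lW) => x Ox.
have [y yD xy] := hD _ (subset_closure Ox).
by exists y => //; split.
Qed.

End domain.

Lemma le_integral_ge0 d (T : measurableType d) (R : realType) (mu : measure T R)
    (D : set T) (f g : T -> \bar R) :
  (forall x, D x -> (0 <= g x)%E) -> (forall x, D x -> (f x <= g x)%E) ->
  (\int[mu]_(x in D) f x <= \int[mu]_(x in D) g x)%E.
Proof.
move=> g0 fg; rewrite integralE; apply: (@le_trans _ _ (\int[mu]_(x in D) f^\+ x)%E).
  rewrite -[leRHS]adde0 leeD2l// oppe_le0; apply: integral_ge0 => x _; exact: funeneg_ge0.
apply: ge0_le_integral_gen => x Dx; first exact: funepos_ge0.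
by rewrite funeposE ge_max fg// g0.
Qed.

Lemma sqre_half (R : realType) (x : \bar R) : (0 <= x)%E -> ((x `^ 2^-1) ^+ 2 = x)%E.
Proof.
case: x => [r||]//; rewrite ?lee_fin => r0.
  by rewrite poweR_EFin -EFin_expe powR12_sqrt// sqr_sqrtr.
by rewrite poweRyr ?invr_eq0 ?pnatr_eq0// expe2.
Qed.

(** * The spaces L^2 and H^1 *)

Section L2_space.
Variables (R : realType) (n : nat) (Omega : set 'rV[R]_n).
Local Notation pt := 'rV[R]_n.
Local Notation lam := (leb R n).
Hypothesis mO : measurable Omega.

Definition sqnorm (f : pt -> R) : \bar R := (\int[lam]_(x in Omega) (f x ^+ 2)%:E)%E.

Lemma sqnorm_ge0 f : (0 <= sqnorm f)%E.
Proof. by apply: integral_ge0 => x _; rewrite lee_fin sqr_ge0. Qed.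

Lemma Lp_norm2E f : Lp_norm Omega 2%:E f = (sqnorm f `^ 2^-1)%E.
Proof.
rewrite /Lp_norm unlock; congr (_ `^ _)%E.
rewrite /sqnorm [RHS]integral_mkcond; apply: eq_integral => x _; rewrite /= !patchE.
case: ifP => _ /=; last by rewrite normr0 powR0 ?pnatr_eq0.
by rewrite powR_mulrn// real_normK ?num_real.
Qed.

Lemma Lp_norm2_sqr f : (Lp_norm Omega 2%:E f ^+ 2)%E = sqnorm f.
Proof. by rewrite Lp_norm2E sqre_half// sqnorm_ge0. Qed.

Lemma L2P f : L2 Omega f <-> measurable_fun Omega f /\ (sqnorm f < +oo)%E.
Proof.
rewrite /L2 /Lp /= Lp_norm2E; split=> -[mf h]; split=> //.
  by apply: lty_poweRy h; rewrite invr_eq0 pnatr_eq0.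
exact: poweR_lty.
Qed.

Lemma L2_measurable f : L2 Omega f -> measurable_fun Omega f.
Proof. by case/L2P. Qed.

Lemma L2_sqr_integrable f : L2 Omega f -> lam.-integrable Omega (EFin \o (fun x => f x ^+ 2)).
Proof.
case/L2P => mf h; apply/integrableP; split.
  by apply/measurable_EFinP; exact: measurable_funX.
rewrite (_ : \int[_]_(x in _) _ = sqnorm f)%E//; apply: eq_integral => x _ /=.
by rewrite ger0_norm// sqr_ge0.
Qed.

Lemma L2_fin f : L2 Omega f -> sqnorm f = (\int[lam]_(x in Omega) (f x ^+ 2))%:E.
Proof. by move=> h; rewrite /sqnorm EFin_Rintegral//; exact: L2_sqr_integrable. Qed.

Lemma L2_mul f g : L2 Omega f -> L2 Omega g -> lam.-integrable Omega (EFin \o (fun x => f x * g x)).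
Proof.
move=> hf hg.
apply: (@le_integrable _ _ _ _ _ mO _ (EFin \o (fun x => f x ^+ 2 + g x ^+ 2))).
- by apply/measurable_EFinP; apply: measurable_funM; exact: L2_measurable.
- move=> x _ /=; rewrite lee_fin normrM [leRHS]ger0_norm ?addr_ge0 ?sqr_ge0//.
  rewrite -(real_normK (num_real (f x))) -(real_normK (num_real (g x))).
  by move: (normr_ge0 (f x)) (normr_ge0 (g x)); set a := `|_|; set b := `|_|; nra.
- by apply: integrable_addr => //; exact: L2_sqr_integrable.
Qed.

Lemma L2_le (f g : pt -> R) : measurable_fun Omega f -> lam.-integrable Omega (EFin \o g) ->
  (forall x, Omega x -> f x ^+ 2 <= g x) -> L2 Omega f.
Proof.
move=> mf ig h; apply/L2P; split=> //.
apply: (@le_lt_trans _ _ (\int[lam]_(x in Omega) (g x)%:E)%E).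
  by apply: ge0_le_integral_gen => x Ox; rewrite lee_fin ?sqr_ge0// h.
by rewrite EFin_Rintegral// ltry.
Qed.

Lemma L2D f g : L2 Omega f -> L2 Omega g -> L2 Omega (fun x => f x + g x).
Proof.
move=> hf hg; apply: (L2_le (g := fun x => 2 * (f x ^+ 2 + g x ^+ 2))).
- by apply: measurable_funD; exact: L2_measurable.
- by apply: integrable_mulr => //; apply: integrable_addr => //; exact: L2_sqr_integrable.
- by move=> x _; have := sqr_ge0 (f x - g x); rewrite !expr2; lra.
Qed.

Lemma L2Z c f : L2 Omega f -> L2 Omega (fun x => c * f x).
Proof.
move=> hf; apply: (L2_le (g := fun x => c ^+ 2 * f x ^+ 2)).
- by apply: measurable_funM => //; exact: L2_measurable.
- by apply: integrable_mulr => //; exact: L2_sqr_integrable.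
- by move=> x _; rewrite exprMn.
Qed.

Lemma L2B f g : L2 Omega f -> L2 Omega g -> L2 Omega (fun x => f x - g x).
Proof.
move=> hf hg; rewrite (_ : (fun _ => _) = (fun x => f x + (-1) * g x)).
  by apply: L2D => //; exact: L2Z.
by apply/funext => x; rewrite mulN1r.
Qed.

Hypothesis fO : (lam Omega < +oo)%E.

Lemma L2_cst c : L2 Omega (fun=> c).
Proof.
by apply: (L2_le (g := fun=> c ^+ 2)) => //; exact: integrable_cst_fin.
Qed.

Lemma L2_integrable f : L2 Omega f -> lam.-integrable Omega (EFin \o f).
Proof.
move=> hf; have := L2_mul (L2_cst 1) hf.
by rewrite (_ : (fun _ => _) = f)//; apply/funext => x; rewrite mul1r.
Qed.

End L2_space.

Section H1_space.
Variables (R : realType) (n : nat) (Omega : set 'rV[R]_n).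
Local Notation pt := 'rV[R]_n.
Local Notation lam := (leb R n).
Hypothesis oO : open Omega.
Let mO : measurable Omega := open_measurable_rV oO.

Lemma L2_ae f g : f = g %[ae lam in Omega] -> measurable_fun Omega g -> L2 Omega f -> L2 Omega g.
Proof.
move=> fg mg /L2P[mf hf]; apply/L2P; split=> //.
rewrite (_ : sqnorm Omega g = sqnorm Omega f)//; apply: ae_eq_integral => //.
- by apply/measurable_EFinP; exact: measurable_funX.
- by apply/measurable_EFinP; exact: measurable_funX.
- by apply: filterS fg => x h Ox; rewrite h.
Qed.

Lemma H1_L2 f : H1 Omega f -> L2 Omega f. Proof. by case. Qed.

Lemma H1_weak_partial f i : H1 Omega f -> is_weak_partial Omega i f (wpartial Omega i f).
Proof. by case=> _ /(_ i)[g hg _]; exact: wpartialP hg. Qed.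

Lemma H1_wpartial_L2 f i : H1 Omega f -> L2 Omega (wpartial Omega i f).
Proof.
move=> hf; have [_ lw _] := H1_weak_partial i hf; have [_ /(_ i)[g hg Lg]] := hf.
apply: L2_ae Lg; last exact: locally_integrable_measurable.
by apply: filterS (wpartial_ae oO hg) => x h Ox; rewrite h.
Qed.

End H1_space.

Section poincare_wirtinger.
Variables (R : realType) (n : nat) (Omega : set 'rV[R]_n).
Local Notation pt := 'rV[R]_n.
Local Notation lam := (leb R n).
Hypothesis hOmega : C1_bounded_domain Omega.
Let oO := domain_open hOmega.
Let mO := domain_measurable hOmega.
Let fO := domain_finite hOmega.
Let vol := fine (lam Omega).

Lemma vol_gt0 : 0 < vol.
Proof. by rewrite fine_gt0// fO domain_gt0. Qed.

Lemma volE : lam Omega = vol%:E.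
Proof. by rewrite fineK// ge0_fin_numE. Qed.

Lemma Rintegral_cstO (c : R) : \int[lam]_(x in Omega) c = c * vol.
Proof.
apply: EFin_inj; rewrite -EFin_Rintegral//; last exact: integrable_cst_fin.
by rewrite EFinM -volE -(integral_cst lam mO).
Qed.

Lemma dirichletE f : H1 Omega f -> dirichlet Omega (fun i => wpartial Omega i f) =
  (\sum_i \int[lam]_(x in Omega) (wpartial Omega i f x ^+ 2))%:E.
Proof.
move=> hf; have ig i := L2_sqr_integrable (H1_wpartial_L2 oO i hf).
rewrite /dirichlet EFin_Rintegral//; first by rewrite Rintegral_sum.
exact: integrable_Rsum.
Qed.

(** As w has mean zero, |Omega| times the integral of f w is the double integral of w x (f x - f y).
    Young's inequality with weight al splits it into al / 2 times (f x - f y)^2, bounded by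
    [domain_linked], and a multiple of (w x)^2; hence the constant C / (2 |Omega|). *)
Lemma poincare_wirtinger : exists2 C : R, 0 <= C & forall (f w : pt -> R) (al : R),
  0 < al -> H1 Omega f -> L2 Omega w -> \int[lam]_(x in Omega) w x = 0 ->
  \int[lam]_(x in Omega) (f x * w x) <=
    al * C * \sum_i \int[lam]_(x in Omega) (wpartial Omega i f x ^+ 2) +
    (2 * al)^-1 * \int[lam]_(x in Omega) (w x ^+ 2).
Proof.
have [C C0 hC] := domain_linked hOmega; have V0 := vol_gt0.
exists (C / (2 * vol)); first by rewrite divr_ge0// mulr_ge0// ltW.
move=> f w al al0 hf hw w0.
have Lf := H1_L2 hf; have mf := L2_measurable Lf.
have := hC f (fun i => wpartial Omega i f) mf (fun i => H1_weak_partial i hf).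
rewrite (dirichletE hf); set D := \sum_i _ => oscD.
have intf := L2_integrable mO fO Lf.
have intw := L2_integrable mO fO hw.
have ifw := L2_mul mO Lf hw.
set m := \int[lam]_(x in Omega) f x.
have E1 : vol * \int[lam]_(x in Omega) (f x * w x) =
    \int[lam]_(x in Omega) (w x * (vol * f x - m)).
  rewrite -[LHS]subr0 -[X in _ - X](mulr0 m) -w0 -!RintegralZl//.
  rewrite -RintegralB//; last 2 first.
  - exact: integrable_mulr.
  - exact: integrable_mulr.
  by apply: eq_Rintegral => x _; ring.
have iE1 : lam.-integrable Omega (EFin \o (fun x => w x * (vol * f x - m))).
  by apply: L2_mul => //; apply: L2B => //; [exact: L2Z|exact: L2_cst].
rewrite -(ler_pM2l V0) E1 -lee_fin -EFin_Rintegral//.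
apply: (@le_trans _ _ (\int[lam]_(x in Omega) ((al / 2)%:E * kappa (f \_ Omega) Omega x +
   ((2 * al)^-1 * vol * w x ^+ 2)%:E))%E).
  apply: le_integral_ge0 => x Ox.
    rewrite adde_ge0 ?mule_ge0 ?kappa_ge0 ?lee_fin ?divr_ge0 ?(ltW al0)//.
    by rewrite mulr_ge0 ?sqr_ge0// mulr_ge0 ?(ltW V0)// invr_ge0 mulr_ge0 ?(ltW al0).
  have -> : w x * (vol * f x - m) = \int[lam]_(y in Omega) (w x * (f x - f y)).
    rewrite RintegralZl//; last first.
      apply: (L2_integrable mO fO); apply: L2B => //; exact: L2_cst.
    rewrite RintegralB//; last exact: integrable_cst_fin.
    by rewrite Rintegral_cstO (mulrC vol).
  rewrite -EFin_Rintegral//; last first.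
    apply: integrable_mulr => //; apply: (L2_integrable mO fO); apply: L2B => //; exact: L2_cst.
  have mk : measurable_fun Omega (fun y => (((f \_ Omega) x - (f \_ Omega) y) ^+ 2)%:E).
    apply/measurable_EFinP; apply: measurable_funX; apply: measurable_funB => //.
    by apply: measurable_funTS; exact: restrict_measurable.
  apply: (@le_trans _ _ (\int[lam]_(y in Omega) ((al / 2)%:E * (((f \_ Omega) x - (f \_ Omega) y) ^+ 2)%:E +
      ((2 * al)^-1 * w x ^+ 2)%:E))%E).
    apply: le_integral_ge0 => y Oy; rewrite -?EFinM -?EFinD lee_fin.
      by rewrite addr_ge0// mulr_ge0 ?sqr_ge0// ?divr_ge0 ?(ltW al0)// invr_ge0 mulr_ge0 ?(ltW al0).
    rewrite !patchE !mem_set//.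
    have := sqr_ge0 (al * (f x - f y) - w x).
    rewrite -(pmulr_rge0 _ (_ : 0 < (2 * al)^-1)) ?invr_gt0 ?mulr_gt0//.
    rewrite -subr_ge0 => h; apply: le_trans h _; rewrite le_eqVlt; apply/orP; left; apply/eqP.
    by field; rewrite gt_eqF.
  rewrite ge0_integralD//; last 3 first.
  - by move=> y _; rewrite -EFinM lee_fin mulr_ge0 ?sqr_ge0// divr_ge0 ?(ltW al0).
  - exact: measurable_funeM.
  - by move=> y _; rewrite lee_fin mulr_ge0 ?sqr_ge0// invr_ge0 mulr_ge0 ?(ltW al0).
  rewrite ge0_integralZl//; last 2 first.
  - by move=> y _; rewrite lee_fin sqr_ge0.
  - by rewrite lee_fin divr_ge0 ?(ltW al0).
  rewrite (EFin_Rintegral mO (f := fun=> (2 * al)^-1 * w x ^+ 2)); last exact: integrable_cst_fin.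
  by rewrite Rintegral_cstO mulrAC.
have mk : measurable_fun Omega (kappa (f \_ Omega) Omega).
  by apply: measurable_funTS; apply: measurable_kappa => //; exact: restrict_measurable.
rewrite ge0_integralD//; last 4 first.
- by move=> x _; rewrite mule_ge0 ?kappa_ge0// lee_fin divr_ge0 ?(ltW al0).
- exact: measurable_funeM.
- move=> x _; rewrite lee_fin mulr_ge0 ?sqr_ge0// mulr_ge0 ?(ltW V0)//.
  by rewrite invr_ge0 mulr_ge0 ?(ltW al0).
- apply/measurable_EFinP; apply: measurable_funM => //; apply: measurable_funX.
  exact: L2_measurable hw.
rewrite ge0_integralZl//; last 2 first.
- by move=> y _; exact: kappa_ge0.
- by rewrite lee_fin divr_ge0 ?(ltW al0).
have iw2 := L2_sqr_integrable hw.
rewrite EFin_Rintegral//; last exact: integrable_mulr.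
rewrite RintegralZl//.
apply: (@le_trans _ _ ((al / 2)%:E * (C%:E * D%:E) + ((2 * al)^-1 * vol * \int[lam]_(x in Omega) (w x ^+ 2))%:E)%E).
  by rewrite leeD2r// lee_wpmul2l// lee_fin divr_ge0 ?(ltW al0).
rewrite -!EFinM -EFinD lee_fin le_eqVlt; apply/orP; left; apply/eqP.
by field; rewrite !gt_eqF.
Qed.

End poincare_wirtinger.

Lemma mxdotE (R : realType) (m n : nat) (A B : 'M[R]_(m, n)) :
  mxdot A B = \sum_i \sum_j A i j * B i j.
Proof.
rewrite /mxdot /mxtrace; apply: eq_bigr => i _; rewrite mxE; apply: eq_bigr => j _.
by rewrite mxE.
Qed.

Lemma enorm_sqr (R : realType) (m n : nat) (A : 'M[R]_(m, n)) :
  enorm A ^+ 2 = \sum_i \sum_j A i j ^+ 2.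
Proof.
have E : mxdot A A = \sum_i \sum_j A i j ^+ 2.
  by rewrite mxdotE; apply: eq_bigr => i _; apply: eq_bigr => j _; rewrite expr2.
rewrite /enorm sqr_sqrtr E//; apply: sumr_ge0 => i _; apply: sumr_ge0 => j _; exact: sqr_ge0.
Qed.

(** * Poincare and Korn inequalities on H^1_0 *)

Section smooth_identities.
Variables (R : realType) (n : nat).
Local Notation pt := 'rV[R]_n.
Local Notation lam := (leb R n).

Lemma rect_bump_partialC k (a b : pt) i j :
  partial i (partial j (rect_bump k a b)) = partial j (partial i (rect_bump k a b)).
Proof.
have s1 l : smooth1 (rect_bump_factor k a b l) := rect_bump_factor_smooth k a b l.
have s2 m l : smooth1 (if l == m then derive1 (rect_bump_factor k a b l) else rect_bump_factor k a b l).
  by case: ifP => _ //; exact: smooth1_derive.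
rewrite /rect_bump !(prodfun_partial _ s1) (prodfun_partial i (s2 j)) (prodfun_partial j (s2 i)).
congr prodfun; apply/funext => l; by case: eqP => [->|//]; case: eqP => [->|//].
Qed.

Let RintegralBl (A B th : pt -> R) : lam.-integrable setT (EFin \o (fun x => A x * th x)) ->
  lam.-integrable setT (EFin \o (fun x => B x * th x)) ->
  \int[lam]_x (A x * th x) = \int[lam]_x (B x * th x) -> \int[lam]_x ((A x - B x) * th x) = 0.
Proof.
move=> iA iB e; under eq_Rintegral do rewrite mulrBl.
by rewrite RintegralB// e subrr.
Qed.

(** The mixed derivatives are compared weakly: both are moved onto a cutoff of a box, where they
    commute by the product form, and the du Bois-Reymond lemma concludes. *)
Lemma smooth_partialC_ae (f : pt -> R) i j : smooth f ->
  \forall x \ae lam, partial i (partial j f) x = partial j (partial i f) x.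
Proof.
move=> sf; have c2 k l : continuous (partial k (partial l f)).
  by apply: smooth_continuous; do 2 apply: smooth_partial.
pose w x := partial i (partial j f) x - partial j (partial i f) x.
suff : \forall x \ae lam, setT x -> w x = 0.
  by apply: filterS => x /(_ I) /subr0_eq.
have li (g : pt -> R) a b : continuous g -> lam.-integrable (crect a b) (EFin \o g).
  by move=> cg; apply: (continuous_locally_integrable cg (Omega := setT)) => //; exact: crect_compact.
have cw : continuous w by move=> x; exact: (cvgB (c2 i j x) (c2 j i x)).
apply: du_bois_reymond; first exact: openT.
  by move=> a b _; exact: li.
move=> k a b ab _; pose th := rect_bump k a b.
have tth : test_function setT th by exact: rect_bump_test.
have sth : smooth th by case: tth.
have bth := test_function_bounded_support tth.
have iI (g h : pt -> R) : continuous g -> test_function setT h ->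
    lam.-integrable setT (EFin \o (fun x => g x * h x)).
  move=> cg th'; apply: (locint_test_integrable (Omega := setT)) => //; first exact: openT.
  exact: continuous_locally_integrable.
have key p q : \int[lam]_x (partial p (partial q f) x * th x) = \int[lam]_x (partial q (partial p th) x * f x).
  have e0 : \int[lam]_x (partial p (partial q f) x * th x) = \int[lam]_x (th x * partial p (partial q f) x).
    by apply: eq_Rintegral => x _; rewrite mulrC.
  have e1 := integral_test_partial p sth (smooth_partial q sf) bth.
  have e2 := integral_test_partial q (smooth_partial p sth) sf (test_function_bounded_support (test_function_partial p tth)).
  exact: (etrans e0 (etrans e1 (etrans (congr1 -%R e2) (opprK _)))).
have kC : partial j (partial i th) = partial i (partial j th) by exact: rect_bump_partialC.
have e : \int[lam]_x (partial i (partial j f) x * th x) = \int[lam]_x (partial j (partial i f) x * th x).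
  exact: (etrans (key i j) (etrans (congr1 (fun z : pt -> R => \int[lam]_x (z x * f x)) kC) (esym (key j i)))).
exact: (RintegralBl (iI _ _ (c2 i j) tth) (iI _ _ (c2 j i) tth) e).
Qed.

Lemma test_mixed Omega (f g : pt -> R) i j : test_function Omega f -> test_function Omega g ->
  \int[lam]_(x in Omega) (partial i f x * partial j g x) =
  \int[lam]_(x in Omega) (partial j f x * partial i g x).
Proof.
move=> tf tg; have [sf _ _] := tf; have [sg _ _] := tg.
have bf := test_function_bounded_support tf.
have supp k (h : pt -> R) x : ~ Omega x -> partial k f x * h x = 0.
  by move=> nO; rewrite (test_function_supp (test_function_partial k tf) nO) mul0r.
rewrite (Rintegral_supp (supp i (partial j g))) (Rintegral_supp (supp j (partial i g))).
have e1 := integral_test_partial i sf (smooth_partial j sg) bf.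
have e2 := integral_test_partial j sf (smooth_partial i sg) bf.
have mm k l : measurable_fun setT (fun x => f x * partial k (partial l g) x).
  apply: measurable_funM; apply: continuous_measurable_rV; apply: smooth_continuous; first exact: sf.
  exact: (smooth_partial k (smooth_partial l sg)).
have e3 : \int[lam]_x (f x * partial i (partial j g) x) = \int[lam]_x (f x * partial j (partial i g) x).
  apply: (ae_eq_Rintegral measurableT (mm i j) (mm j i)).
  by apply: filterS (smooth_partialC_ae i j sg) => x -> _.
by apply: oppr_inj; exact: (etrans (esym e1) (etrans e3 e2)).
Qed.

Lemma is_derive_coord (x : pt) i : is_derive x (delta_mx ord0 i : pt) (fun y : pt => y ord0 i) (1 : R).
Proof.
apply/is_derive_line; rewrite (_ : (fun _ => _) = (fun t : R => t + x ord0 i)).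
  by apply: is_derive_eq; rewrite addr0.
by apply/funext => t; rewrite !mxE !eqxx mulr1.
Qed.

(** The derivative of x_i f^2 has zero integral, so that of f^2 equals that of - 2 x_i f d_i f. With
    |x_i| <= r, this is at most half of the integral of f^2 plus 2 r^2 times that of (d_i f)^2. *)
Lemma test_poincare Omega (f : pt -> R) i r : open Omega -> Omega `<=` cbox 0 r -> test_function Omega f ->
  \int[lam]_(x in Omega) (f x ^+ 2) <= 4 * r ^+ 2 * \int[lam]_(x in Omega) (partial i f x ^+ 2).
Proof.
move=> oO Or tf; have mO := open_measurable_rV oO; have [sf _ _] := tf.
have tpf := test_function_partial i tf; have [spf _ _] := tpf.
have bf := test_function_bounded_support tf.
have cf := smooth_continuous sf; have cpf := smooth_continuous spf.
have C1 : C1dir (delta_mx ord0 i : pt) (fun x : pt => x ord0 i) (fun=> 1).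
  split; [exact: coord_continuous|exact: cst_continuous|].
  by move=> x; exact: is_derive_coord.
have Cf := smooth_C1dir i sf.
have I0 : \int[lam]_(x in Omega) (x ord0 i * (f x * partial i f x + f x * partial i f x) + f x * f x * 1) = 0.
  rewrite Rintegral_supp; last first.
    by move=> x nO; rewrite (test_function_supp tf nO) !mul0r !addr0 mulr0.
  apply: (integral_C1dir (C1dirM C1 (C1dirM Cf Cf))).
  have [s hs] := bf; exists s => x; have [->|/hs//] := eqVneq (f x) 0.
  by rewrite mul0r mulr0 eqxx.
have ic (g h : pt -> R) : continuous g -> test_function Omega h ->
    lam.-integrable Omega (EFin \o (fun x => g x * h x)).
  by move=> cg th; apply: locint_test_integrable => //; exact: continuous_locally_integrable.
have iff : lam.-integrable Omega (EFin \o (fun x => f x ^+ 2)).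
  by apply: ic.
have ipp : lam.-integrable Omega (EFin \o (fun x => partial i f x ^+ 2)).
  by apply: ic.
have ixf : lam.-integrable Omega (EFin \o (fun x : pt => 2 * (x ord0 i * f x) * partial i f x)).
  apply: (ic (fun x : pt => 2 * (x ord0 i * f x))) => // x.
  exact: (cvgM (cvg_cst (2 : R)) (cvgM (@coord_continuous R 1 n ord0 i x) (cf x))).
have E : \int[lam]_(x in Omega) (f x ^+ 2) = - \int[lam]_(x in Omega) (2 * (x ord0 i * f x) * partial i f x).
  apply/eqP; rewrite -subr_eq0 opprK -RintegralD//; apply/eqP; rewrite -[RHS]I0.
  by apply: eq_Rintegral => x _; rewrite expr2; ring.
have : (- \int[lam]_(x in Omega) (2 * (x ord0 i * f x) * partial i f x)) <=
    \int[lam]_(x in Omega) (2^-1 * f x ^+ 2 + 2 * r ^+ 2 * partial i f x ^+ 2).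
  rewrite -[leLHS]mulN1r -RintegralZl//; apply: le_Rintegral => //.
  - exact: integrable_mulr.
  - by apply: integrable_addr => //; exact: integrable_mulr.
  - move=> x Ox; have := Or _ Ox i; rewrite mxE subr0 => hx.
    have h1 : (x ord0 i * partial i f x) ^+ 2 <= r ^+ 2 * partial i f x ^+ 2.
      by rewrite exprMn ler_wpM2r ?sqr_ge0// -(real_normK (num_real (x ord0 i))) lerXn2r// nnegrE (le_trans _ hx).
    have := sqr_ge0 (f x + 2 * (x ord0 i * partial i f x)); move: h1.
    by set p := partial i f x; set y := x ord0 i; rewrite !expr2; lra.
rewrite -E RintegralD//; last 2 first.
- exact: integrable_mulr.
- exact: integrable_mulr.
by rewrite !RintegralZl//; lra.
Qed.

End smooth_identities.

(** Controls a product under perturbation: p and r stand for weak derivatives, s and t for those of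
    approximating test functions. The weight de on p and r can be made small, the large weight
    falling on the errors p - s and r - t. *)
Lemma mixed_term_le (R : realFieldType) (de p r s t : R) : 0 < de ->
  2 * (s * t) <= 2 * (p * r) + (de * p ^+ 2 + (de^-1 + 1) * (p - s) ^+ 2 +
    (de * r ^+ 2 + (de^-1 + 1) * (r - t) ^+ 2)).
Proof.
move=> de0.
have tw (a y : R) : - (2 * a * y) <= de * a ^+ 2 + de^-1 * y ^+ 2.
  have : 0 <= de^-1 * (de * a + y) ^+ 2 by rewrite mulr_ge0 ?sqr_ge0// invr_ge0 ltW.
  rewrite (_ : de^-1 * (de * a + y) ^+ 2 = de * a ^+ 2 + de^-1 * y ^+ 2 + 2 * a * y).
    by lra.
  by field; rewrite gt_eqF.
have := tw r (p - s); have := tw p (r - t); have := sqr_ge0 (p - s - (r - t)).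
rewrite !(mulrDl de^-1 1) !mul1r.
move: (de * p ^+ 2) (de * r ^+ 2) (de^-1 * (p - s) ^+ 2) (de^-1 * (r - t) ^+ 2) => P2 R2 X2 Y2.
rewrite !expr2; lra.
Qed.

(** * Density of test functions in H^1_0 *)

Section H10_space.
Variables (R : realType) (n : nat) (Omega : set 'rV[R]_n).
Local Notation pt := 'rV[R]_n.
Local Notation lam := (leb R n).
Hypothesis oO : open Omega.
Hypothesis bO : bounded_set Omega.
Let mO : measurable Omega := open_measurable_rV oO.
Let fO : (lam Omega < +oo)%E := leb_bounded mO bO.

Lemma Lp_norm2_enorm m k (W : pt -> 'M[R]_(m, k)) :
  (L2v_norm Omega W ^+ 2 = \int[lam]_(x in Omega) (\sum_i \sum_j W x i j ^+ 2)%:E)%E.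
Proof.
by rewrite /L2v_norm Lp_norm2_sqr; apply: eq_integral => x _; rewrite /= enorm_sqr.
Qed.

Lemma Lp_norm_ge0 p (f : pt -> R) : (0 <= Lp_norm Omega p f)%E.
Proof. exact: Lnorm_ge0. Qed.

Lemma H1_norm_sqr f : (H1_norm Omega f ^+ 2 =
  sqnorm Omega f + dirichlet Omega (fun i => wpartial Omega i f))%E.
Proof.
rewrite /H1_norm sqre_half; last by rewrite adde_ge0// expe2 mule_ge0// Lp_norm_ge0.
rewrite Lp_norm2_sqr Lp_norm2_enorm; congr (_ + _)%E; apply: eq_integral => x _.
by rewrite big_ord1; congr EFin; apply: eq_bigr => i _; rewrite mxE.
Qed.

Lemma test_L2 f : test_function Omega f -> L2 Omega f.
Proof.
move=> tf; have [sf _ _] := tf.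
have mf : measurable_fun Omega f.
  by apply: measurable_funTS; apply: continuous_measurable_rV; exact: smooth_continuous.
apply: (@L2_le _ _ _ mO _ (fun x => f x * f x)) => //.
by apply: locint_test_integrable => //; apply: continuous_locally_integrable; exact: smooth_continuous.
Qed.

Lemma H10_approx f e : H10 Omega f -> 0 < e -> exists eta, [/\ test_function Omega eta,
  \int[lam]_(x in Omega) ((f x - eta x) ^+ 2) <= e &
  forall i, \int[lam]_(x in Omega) ((wpartial Omega i f x - partial i eta x) ^+ 2) <= e].
Proof.
(* Both bounds on e1 are used: they give e1^2 <= e for the squared norm. *)
move=> [hf happ] e0; pose e1 := Num.min 1 e.
have e10 : 0 < e1 by rewrite lt_min ltr01.
have e1e : e1 ^+ 2 <= e.
  rewrite expr2; apply: (@le_trans _ _ (1 * e1)); last by rewrite mul1r ge_min lexx orbT.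
  by apply: ler_wpM2r; rewrite ?(ltW e10)// ge_min lexx.
have [eta teta hn] := happ e1 e10; exists eta; have [seta _ _] := teta.
have Lf := H1_L2 hf; have Leta := test_L2 teta.
have E : (sqnorm Omega (f - eta)%R + dirichlet Omega (fun i => wpartial Omega i (f - eta)%R) <= e%:E)%E.
  rewrite -H1_norm_sqr; apply: (@le_trans _ _ (e1 ^+ 2)%:E); last by rewrite lee_fin.
  rewrite expr2 EFinM expe2.
  have h0 : (0 <= H1_norm Omega (f - eta)%R)%E by exact: poweR_ge0.
  by apply: lee_pmul => //; exact: ltW.
have wE i : wpartial Omega i (f - eta)%R = (fun x => wpartial Omega i f x + (-1) * partial i eta x) %[ae lam in Omega].
  rewrite (_ : f - eta = (fun x => f x + (-1) * eta x)); last first.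
    by apply/funext => x; rewrite mulN1r.
  apply: wpartial_ae => //; apply: weak_partial_lin => //.
  - exact: H1_weak_partial.
  - exact: smooth_weak_partial.
have sqE : sqnorm Omega (f - eta)%R = (\int[lam]_(x in Omega) ((f x - eta x) ^+ 2))%:E.
  by apply: L2_fin => //; exact: L2B.
have s0 := sqnorm_ge0 Omega (f - eta); have d0 := dirichlet_ge0 Omega (fun i => wpartial Omega i (f - eta)%R).
split=> // [|i].
  by rewrite -lee_fin -sqE; apply: le_trans E; rewrite leeDl.
have Lw : L2 Omega (fun x => wpartial Omega i f x - partial i eta x).
  by apply: L2B => //; [exact: H1_wpartial_L2|exact/test_L2/test_function_partial].
rewrite -lee_fin -(L2_fin mO Lw); apply: le_trans E.
apply: (@le_trans _ _ (dirichlet Omega (fun i => wpartial Omega i (f - eta)%R))); last by rewrite leeDr.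
have lw j : locally_integrable_on Omega (wpartial Omega j (f - eta)).
  have : is_weak_partial Omega j (f - eta) (wpartial Omega j (f - eta)).
    rewrite (_ : f - eta = (fun x => f x + (-1) * eta x)); last first.
      by apply/funext => x; rewrite mulN1r.
    apply: wpartialP; apply: weak_partial_lin => //.
    - exact: H1_weak_partial.
    - exact: smooth_weak_partial.
  by case.
have mw j : measurable_fun Omega (wpartial Omega j (f - eta)) by exact: locally_integrable_measurable.
rewrite (_ : sqnorm _ _ = sqnorm Omega (wpartial Omega i (f - eta)%R)).
  by apply: ge0_le_integral_gen => x _; rewrite lee_fin ?sqr_ge0// (bigD1 i)//= lerDl sumr_ge0// => j _; exact: sqr_ge0.
apply: ae_eq_integral => //.
- by apply/measurable_EFinP; apply: measurable_funX; exact: L2_measurable Lw.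
- by apply/measurable_EFinP; exact: measurable_funX.
- by apply: filterS (wE i) => x h Ox; rewrite h// mulN1r.
Qed.

(** By density from [test_poincare] in a single direction. Replacing f by a test function, and then
    the derivative of that function by the one of f, costs a factor 2 each time. *)
Lemma H10_poincare : (0 < n)%N -> exists2 C : R, 0 <= C & forall f, H10 Omega f ->
  \int[lam]_(x in Omega) (f x ^+ 2) <= C * \sum_i \int[lam]_(x in Omega) (wpartial Omega i f x ^+ 2).
Proof.
move=> n0; have [r r0 hr] := bounded_sub_cbox bO; pose i0 := Ordinal n0.
pose A := 4 * r ^+ 2; have A0 : 0 <= A by rewrite mulr_ge0// sqr_ge0.
exists (4 * A); first by rewrite mulr_ge0.
move=> f hf; have [h1 _] := hf.
set S := \sum_i _.
have split2 (a b : pt -> R) : L2 Omega a -> L2 Omega b ->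
    \int[lam]_(x in Omega) (a x ^+ 2) <= 2 * \int[lam]_(x in Omega) (b x ^+ 2) +
      2 * \int[lam]_(x in Omega) ((a x - b x) ^+ 2).
  move=> La Lb; have Lab := L2B mO La Lb.
  have ia := L2_sqr_integrable La; have ib := L2_sqr_integrable Lb; have iab := L2_sqr_integrable Lab.
  rewrite -!RintegralZl// -RintegralD//; last 2 first.
  - exact: integrable_mulr.
  - exact: integrable_mulr.
  apply: le_Rintegral => //.
    by apply: integrable_addr => //; exact: integrable_mulr.
  by move=> x _; have := sqr_ge0 (b x - (a x - b x)); rewrite !expr2; lra.
have key e : 0 < e -> \int[lam]_(x in Omega) (f x ^+ 2) <= 4 * A * S + (4 * A + 2) * e.
  move=> e0; have [eta [teta h2 h3]] := H10_approx hf e0.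
  have Lw := H1_wpartial_L2 oO i0 h1.
  have Lp := test_L2 (test_function_partial i0 teta).
  have q1 := split2 _ _ (H1_L2 h1) (test_L2 teta).
  have q2 := test_poincare i0 oO hr teta.
  have q3 := split2 _ _ Lp Lw.
  have q4 : \int[lam]_(x in Omega) ((partial i0 eta x - wpartial Omega i0 f x) ^+ 2) <= e.
    by apply: le_trans (h3 i0); under eq_Rintegral do rewrite -sqrrN opprB.
  have q5 : \int[lam]_(x in Omega) (wpartial Omega i0 f x ^+ 2) <= S.
    rewrite /S (bigD1 i0)//= lerDl sumr_ge0// => j _.
    by apply: Rintegral_ge0 => x _; exact: sqr_ge0.
  have q6 : \int[lam]_(x in Omega) (partial i0 eta x ^+ 2) <= 2 * S + 2 * e by lra.
  have q7 : A * \int[lam]_(x in Omega) (partial i0 eta x ^+ 2) <= A * (2 * S + 2 * e) by exact: ler_wpM2l.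
  move: q1 q2 q7 h2; rewrite -/A.
  rewrite (_ : A * (2 * S + 2 * e) = 2 * (A * S) + 2 * (A * e)); last by ring.
  rewrite (_ : 4 * A * S + (4 * A + 2) * e = 4 * (A * S) + 4 * (A * e) + 2 * e); last by ring.
  lra.
apply/ler_addgt0Pr => e e0; have B0 : 0 < 4 * A + 2 by rewrite ltr_wpDl// mulr_ge0.
have := key (e / (4 * A + 2)) (divr_gt0 e0 B0).
by rewrite (mulrC (4 * A + 2)) divfK// gt_eqF.
Qed.

(** Exchanging the two derivatives in each term turns the sum into the square of the divergence. *)
Lemma test_mixed_ge0 (eta : 'I_n -> pt -> R) : (forall i, test_function Omega (eta i)) ->
  0 <= \int[lam]_(x in Omega) (\sum_i \sum_j partial i (eta j) x * partial j (eta i) x).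
Proof.
move=> te; have L i j : L2 Omega (partial i (eta j)) by exact/test_L2/test_function_partial.
have I2 i j k l : lam.-integrable Omega (EFin \o (fun x => partial i (eta j) x * partial k (eta l) x)).
  exact: L2_mul.
rewrite Rintegral_sum//; last by move=> i; exact: integrable_Rsum.
under eq_bigr do rewrite Rintegral_sum//.
under eq_bigr => i _ do under eq_bigr => j _ do rewrite (test_mixed i j (te j) (te i)).
under eq_bigr do rewrite -Rintegral_sum//.
rewrite -Rintegral_sum//; last by move=> i; exact: integrable_Rsum.
apply: Rintegral_ge0 => x _.
rewrite (_ : \sum_i \sum_j _ = (\sum_i partial i (eta i) x) ^+ 2) ?sqr_ge0//.
rewrite expr2 mulr_suml; apply: eq_bigr => i _; rewrite mulr_sumr; apply: eq_bigr => j _.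
by rewrite mulrC.
Qed.

(** The core of Korn's inequality, by density from [test_mixed_ge0]. The approximation error is at
    most de S + (1/de + 1) n^2 e, so de is fixed before e. *)
Lemma H10_mixed_ge0 (u : pt -> pt) : (forall i, H10 Omega (component u i)) ->
  0 <= \int[lam]_(x in Omega) (\sum_i \sum_j vgrad Omega u x i j * vgrad Omega u x j i).
Proof.
move=> hu; pose a i j := wpartial Omega i (component u j).
have La i j : L2 Omega (a i j) by apply: H1_wpartial_L2 => //; case: (hu j).
have iaa i j k l : lam.-integrable Omega (EFin \o (fun x => a i j x * a k l x)) by exact: L2_mul.
have ia2 i j := L2_sqr_integrable (La i j).
have -> : \int[lam]_(x in Omega) (\sum_i \sum_j vgrad Omega u x i j * vgrad Omega u x j i) =
    \int[lam]_(x in Omega) (\sum_i \sum_j a i j x * a j i x).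
  by apply: eq_Rintegral => x _; apply: eq_bigr => i _; apply: eq_bigr => j _; rewrite !mxE.
set X := \int[lam]_(x in Omega) _.
pose S := \sum_i \sum_j \int[lam]_(x in Omega) (a i j x ^+ 2).
have S0 : 0 <= S.
  by apply: sumr_ge0 => i _; apply: sumr_ge0 => j _; apply: Rintegral_ge0 => x _; exact: sqr_ge0.
have key de e : 0 < de -> 0 < e -> - X <= de * S + (de^-1 + 1) * (n%:R * (n%:R * e)).
  move=> de0 e0.
  have /choice[eta heta] : forall j, exists eta, [/\ test_function Omega eta,
    \int[lam]_(x in Omega) ((component u j x - eta x) ^+ 2) <= e &
    forall i, \int[lam]_(x in Omega) ((a i j x - partial i eta x) ^+ 2) <= e].
    by move=> j; exact: H10_approx.
  have te j : test_function Omega (eta j) by case: (heta j).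
  pose x_ i j x := a i j x - partial i (eta j) x.
  have Lp i j : L2 Omega (partial i (eta j)) by exact/test_L2/test_function_partial.
  have Lx i j : L2 Omega (x_ i j) by exact: L2B.
  have ix2 i j := L2_sqr_integrable (Lx i j).
  have ipp i j k l : lam.-integrable Omega (EFin \o (fun x => partial i (eta j) x * partial k (eta l) x)) by exact: L2_mul.
  have pos := test_mixed_ge0 te.
  pose Y := \int[lam]_(x in Omega) (\sum_i \sum_j (de * a i j x ^+ 2 + (de^-1 + 1) * x_ i j x ^+ 2)).
  have iY : lam.-integrable Omega (EFin \o (fun x => \sum_i \sum_j (de * a i j x ^+ 2 + (de^-1 + 1) * x_ i j x ^+ 2))).
    apply: integrable_Rsum => // i; apply: integrable_Rsum => // j.
    by apply: integrable_addr => //; exact: integrable_mulr.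
  have YE : Y <= de * S + (de^-1 + 1) * (n%:R * (n%:R * e)).
    rewrite /Y Rintegral_sum//; last first.
      move=> i; apply: integrable_Rsum => // j.
      by apply: integrable_addr => //; exact: integrable_mulr.
    have -> : de * S + (de^-1 + 1) * (n%:R * (n%:R * e)) =
      \sum_(i < n) \sum_(j < n) (de * \int[lam]_(x in Omega) (a i j x ^+ 2) + (de^-1 + 1) * e).
      under eq_bigr do rewrite big_split/= sumr_const card_ord -mulr_sumr.
      by rewrite big_split/= sumr_const card_ord -mulr_sumr -[X in _ = _ + X *+ n]mulr_natl -[X in _ = _ + X]mulr_natl !(mulrCA (de^-1 + 1)).
    apply: ler_sum => i _; rewrite Rintegral_sum//; last first.
      by move=> j; apply: integrable_addr => //; exact: integrable_mulr.
    apply: ler_sum => j _; rewrite RintegralD//; last 2 first.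
    - exact: integrable_mulr.
    - exact: integrable_mulr.
    rewrite !RintegralZl// lerD2l ler_wpM2l//; first by rewrite addr_ge0// invr_ge0 ltW.
    by have [_ _] := heta j; apply.
  apply: le_trans YE; rewrite -subr_ge0 opprK addrC; apply: le_trans pos _.
  have iX : lam.-integrable Omega (EFin \o (fun x => \sum_i \sum_j a i j x * a j i x)).
    by apply: integrable_Rsum => // i; exact: integrable_Rsum.
  rewrite -RintegralD//; apply: le_Rintegral => //.
  - by apply: integrable_Rsum => // i; exact: integrable_Rsum.
  - exact: integrable_addr.
  move=> x _; pose T i j := de * a i j x ^+ 2 + (de^-1 + 1) * x_ i j x ^+ 2.
  have sym : \sum_i \sum_j (T i j + T j i) = 2 * \sum_i \sum_j T i j.
    under eq_bigr do rewrite big_split/=.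
    by rewrite big_split/= [X in _ + X]exchange_big/= mulrDl mul1r.
  rewrite -(ler_pM2l (ltr0Sn R 1)) mulrDr -sym !mulr_sumr -big_split/=; apply: ler_sum => i _.
  rewrite !mulr_sumr -big_split/=; apply: ler_sum => j _.
  exact: mixed_term_le.
pose N : R := n%:R * n%:R; have N0 : 0 <= N by rewrite mulr_ge0.
rewrite -oppr_le0; apply/ler_addgt0Pr => eps eps0; rewrite add0r.
(* This gives eps = de S + de; the value of e taken next keeps the remaining term below de. *)
pose de := eps / (S + 1); have de0 : 0 < de by rewrite divr_gt0// ltr_wpDl.
have k0 : 0 < (de^-1 + 1) * (N + 1) by rewrite mulr_gt0 ?ltr_wpDl ?invr_ge0 ?(ltW de0).
apply: le_trans (key de (de / ((de^-1 + 1) * (N + 1))) de0 (divr_gt0 de0 k0)) _.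
have -> : eps = de * S + de by rewrite -[X in _ = _ + X]mulr1 -mulrDr /de divfK// gt_eqF// ltr_wpDl.
rewrite lerD2l (mulrA n%:R) -/N.
have c0 : 0 < de^-1 + 1 by rewrite ltr_wpDl// invr_ge0 ltW.
have N1 : 0 < N + 1 by rewrite ltr_wpDl.
have -> : (de^-1 + 1) * (N * (de / ((de^-1 + 1) * (N + 1)))) = de * (N / (N + 1)).
  move: (de^-1 + 1) (N + 1) c0 N1 => c M c0 M0; clearbody de N.
  by field; rewrite !gt_eqF.
by rewrite -[leRHS]mulr1 ler_pM2l// ler_pdivrMr// mul1r lerDl.
Qed.

End H10_space.

(** * Integration without measurability *)

Section lower_integral.
Context d (T : measurableType d) (R : realType) (mu : {measure set T -> \bar R}).
Implicit Types (D : set T) (f g : T -> \bar R).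
Import HBNNSimple.

Lemma le_integral_gen D f g : (forall x, D x -> (f x <= g x)%E) ->
  (\int[mu]_(x in D) f x <= \int[mu]_(x in D) g x)%E.
Proof.
move=> fg; rewrite integralE [leRHS]integralE; apply: leeB.
  by apply: ge0_le_integral_gen => x Dx; rewrite ?funepos_ge0// !funeposE ge_max !le_max lexx orbT andbT fg.
by apply: ge0_le_integral_gen => x Dx; rewrite ?funeneg_ge0// !funenegE ge_max !le_max lexx orbT andbT leeN2 fg.
Qed.

(* Holds for every nonnegative f, measurable or not: the integral is a lower integral. *)
Lemma ge0_integral_ub D f (c : \bar R) : measurable D -> (forall x, D x -> (0 <= f x)%E) ->
  (forall k : T -> R, measurable_fun setT k -> (forall x, 0 <= k x) ->
     (forall x, D x -> ((k x)%:E <= f x)%E) -> (\int[mu]_(x in D) (k x)%:E <= c)%E) ->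
  (\int[mu]_(x in D) f x <= c)%E.
Proof.
move=> mD f0 h; rewrite integral_mkcond ge0_integralTE; last first.
  by move=> x; rewrite patchE; case: ifP => // /set_mem /f0.
apply: ge_ereal_sup => _ [k /= kf <-]; rewrite -integralT_nnsfun.
apply: (@le_trans _ _ (\int[mu]_(x in D) (k x)%:E)%E).
  rewrite [leRHS]integral_mkcond; apply: ge0_le_integral_gen => x _; first by rewrite lee_fin.
  by rewrite patchE; have := kf x; rewrite patchE; case: ifP.
apply: h => // x Dx; have := kf x; by rewrite patchE mem_set.
Qed.

(** A measurable minorant of f may be set to 0 on the exceptional null set without changing its
    integral, and it then lies below g everywhere. *)
Lemma ge0_ae_le_integral_gen D f g : measurable D ->
  (forall x, D x -> (0 <= f x)%E) -> (forall x, D x -> (0 <= g x)%E) ->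
  (\forall x \ae mu, D x -> (f x <= g x)%E) ->
  (\int[mu]_(x in D) f x <= \int[mu]_(x in D) g x)%E.
Proof.
move=> mD f0 g0 [N [mN N0 hN]]; apply: ge0_integral_ub => // k mk k0 kf.
have mNC : measurable (~` N) by exact: measurableC.
apply: (@le_trans _ _ (\int[mu]_(x in D) (k x * \1_(~` N) x)%:E)%E).
  rewrite le_eqVlt; apply/orP; left; apply/eqP; apply: ae_eq_integral => //.
  - by apply/measurable_EFinP; exact: measurable_funTS.
  - apply/measurable_EFinP; apply: measurable_funTS; apply: measurable_funM => //; exact: measurable_indic.
  exists N; split => // x /= hx; apply: contrapT => nN; apply: hx => _.
  by rewrite indicE mem_set// mulr1.
apply: ge0_le_integral_gen => x Dx; first by rewrite lee_fin mulr_ge0.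
rewrite indicE; have [/set_mem nN|_] := boolP (x \in ~` N); last by rewrite mulr0 g0.
rewrite mulr1; apply: le_trans (kf _ Dx) _; apply: contrapT => nfg; apply: nN; apply: hN => /= h.
exact/nfg/h.
Qed.

Lemma ae_le_integral_gen D f g : measurable D ->
  (\forall x \ae mu, D x -> (f x <= g x)%E) ->
  (\int[mu]_(x in D) f x <= \int[mu]_(x in D) g x)%E.
Proof.
move=> mD fg; rewrite integralE [leRHS]integralE; apply: leeB.
  apply: ge0_ae_le_integral_gen => //; apply: filterS fg => x h Dx.
  by rewrite !funeposE ge_max !le_max lexx orbT andbT h.
apply: ge0_ae_le_integral_gen => //; apply: filterS fg => x h Dx.
by rewrite !funenegE ge_max !le_max lexx orbT andbT leeN2 h.
Qed.

Lemma ae_eq_integral_gen D f g : measurable D -> f = g %[ae mu in D] ->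
  (\int[mu]_(x in D) f x = \int[mu]_(x in D) g x)%E.
Proof.
move=> mD fg; apply/le_anti/andP; split; apply: ae_le_integral_gen => //.
- by apply: filterS fg => x h Dx; rewrite h.
- by apply: filterS fg => x h Dx; rewrite h.
Qed.

(** Measurable minorants of f and g add up to a minorant of f + g. When the right-hand side is
    finite, the suprema over the two minorants can be taken one after the other by subtraction. *)
Lemma ge0_integral_superadd D f g : measurable D ->
  (forall x, D x -> (0 <= f x)%E) -> (forall x, D x -> (0 <= g x)%E) ->
  (\int[mu]_(x in D) f x + \int[mu]_(x in D) g x <= \int[mu]_(x in D) (f x + g x))%E.
Proof.
move=> mD f0 g0; set I := (\int[mu]_(x in D) (f x + g x))%E.
have mE (k : T -> R) : measurable_fun setT k -> measurable_fun D (fun x => (k x)%:E).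
  by move=> mk; apply/measurable_EFinP; exact: measurable_funTS.
have IgeF (k l : T -> R) : measurable_fun setT k -> (forall x, 0 <= k x) ->
    (forall x, D x -> ((k x)%:E <= f x)%E) -> measurable_fun setT l -> (forall x, 0 <= l x) ->
    (forall x, D x -> ((l x)%:E <= g x)%E) ->
    (\int[mu]_(x in D) (k x)%:E + \int[mu]_(x in D) (l x)%:E <= I)%E.
  move=> mk k0 kf ml l0 lg; rewrite -ge0_integralD//.
  - by apply: ge0_le_integral_gen => x Dx; [rewrite adde_ge0// lee_fin|apply: leeD; [exact: kf|exact: lg]].
  - by move=> x _; rewrite lee_fin.
  - exact: mE.
  - by move=> x _; rewrite lee_fin.
  - exact: mE.
have I0 : (0 <= I)%E by apply: integral_ge0 => x Dx; rewrite adde_ge0 ?f0 ?g0.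
have [Ioo|] := ltP I +oo%E; last by rewrite leye_eq => /eqP ->; rewrite leey.
have fI : I \is a fin_num by rewrite ge0_fin_numE.
have ffin : (\int[mu]_(x in D) f x <= I)%E.
  by apply: ge0_le_integral_gen => // x Dx; rewrite leeDl// g0.
have fF : (\int[mu]_(x in D) f x)%E \is a fin_num.
  by rewrite ge0_fin_numE ?(le_lt_trans ffin)//; exact: integral_ge0.
rewrite addeC -leeBrDr//; apply: ge0_integral_ub => // l ml l0 lg.
have lI : (\int[mu]_(x in D) (l x)%:E <= I)%E.
  apply: ge0_le_integral_gen => x Dx; first by rewrite lee_fin.
  by apply: le_trans (lg _ Dx) _; rewrite leeDr// f0.
have lF : (\int[mu]_(x in D) (l x)%:E)%E \is a fin_num.
  by rewrite ge0_fin_numE ?(le_lt_trans lI)//; apply: integral_ge0 => x _; rewrite lee_fin.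
rewrite leeBrDr// addeC -leeBrDr//; apply: ge0_integral_ub => // k mk k0 kf.
by rewrite leeBrDr//; exact: IgeF.
Qed.

(** Measurability of b makes the reverse inequality true: if k is a measurable minorant of f + b,
    then max(k - b, 0) is one of f. *)
Lemma ge0_integral_subadd D f (b : T -> R) : measurable D ->
  (forall x, D x -> (0 <= f x)%E) -> measurable_fun setT b -> (forall x, 0 <= b x) ->
  (\int[mu]_(x in D) (f x + (b x)%:E) <= \int[mu]_(x in D) f x + \int[mu]_(x in D) (b x)%:E)%E.
Proof.
move=> mD f0 mb b0; apply: ge0_integral_ub => //.
  by move=> x Dx; rewrite adde_ge0 ?f0 ?lee_fin.
move=> k mk k0 kf; pose m x := Num.max (k x - b x) 0.
have mm : measurable_fun setT m.
  by apply: measurable_maxr => //; exact: measurable_funB.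
have m0 x : 0 <= m x by rewrite le_max lexx orbT.
apply: (@le_trans _ _ (\int[mu]_(x in D) (m x)%:E + \int[mu]_(x in D) (b x)%:E)%E).
  rewrite -ge0_integralD//.
  - apply: ge0_le_integral_gen => x Dx; first by rewrite lee_fin.
    by rewrite -EFinD lee_fin -lerBlDr le_max lexx.
  - by move=> x _; rewrite lee_fin.
  - by apply/measurable_EFinP; exact: measurable_funTS.
  - by move=> x _; rewrite lee_fin.
  - by apply/measurable_EFinP; exact: measurable_funTS.
rewrite leeD2r//; apply: ge0_le_integral_gen => x Dx; first by rewrite lee_fin.
have := kf x Dx; have := f0 x Dx; case: (f x) => [r||]//; last by move=> _ _; rewrite leey.
by rewrite -EFinD !lee_fin => r0 h; rewrite ge_max r0 lerBlDr h.
Qed.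

End lower_integral.

(** * The space Vdiv *)

Section solenoidal_space.
Variables (R : realType) (n : nat) (Omega : set 'rV[R]_n).
Local Notation pt := 'rV[R]_n.
Local Notation lam := (leb R n).
Hypothesis oO : open Omega.
Hypothesis bO : bounded_set Omega.
Let mO : measurable Omega := open_measurable_rV oO.
Let fO : (lam Omega < +oo)%E := leb_bounded mO bO.

Definition gradsq (u : pt -> pt) : R := ipm Omega (vgrad Omega u) (vgrad Omega u).

Lemma gradsq_ge0 u : 0 <= gradsq u.
Proof.
apply: Rintegral_ge0 => x _; rewrite mxdotE; apply: sumr_ge0 => i _; apply: sumr_ge0 => j _.
by rewrite -expr2 sqr_ge0.
Qed.

Definition H1v (u : pt -> pt) := forall i, H1 Omega (component u i).

Lemma Vdiv_H10 u : Vdiv Omega u -> forall i, H10 Omega (component u i).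
Proof. by case. Qed.

Lemma Vdiv_H1v u : Vdiv Omega u -> H1v u.
Proof. by move=> [h _] i; have [] := h i. Qed.

Lemma H1v_vgrad_L2 u i j : H1v u -> L2 Omega (fun x => vgrad Omega u x i j).
Proof.
move=> hu; rewrite (_ : (fun _ => _) = wpartial Omega i (component u j)).
  exact: H1_wpartial_L2.
by apply/funext => x; rewrite mxE.
Qed.

Lemma mxdot_integrable m k (A B : pt -> 'M[R]_(m, k)) :
  (forall i j, L2 Omega (fun x => A x i j)) -> (forall i j, L2 Omega (fun x => B x i j)) ->
  lam.-integrable Omega (EFin \o (fun x => mxdot (A x) (B x))).
Proof.
move=> hA hB; rewrite (_ : (fun _ => _) = (fun x => \sum_i \sum_j A x i j * B x i j)).
  by apply: integrable_Rsum => // i; apply: integrable_Rsum => // j; exact: L2_mul.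
by apply/funext => x; rewrite mxdotE.
Qed.

Lemma gradsqE u : H1v u ->
  gradsq u = \sum_i \sum_j \int[lam]_(x in Omega) (wpartial Omega i (component u j) x ^+ 2).
Proof.
move=> hu; have L i j := L2_sqr_integrable (H1_wpartial_L2 oO i (hu j)).
rewrite /gradsq /ipm.
under eq_Rintegral do rewrite mxdotE.
rewrite (eq_Rintegral lam (g := fun x => \sum_i \sum_j wpartial Omega i (component u j) x ^+ 2)); last first.
  by move=> x _; apply: eq_bigr => i _; apply: eq_bigr => j _; rewrite mxE expr2.
rewrite Rintegral_sum//; last by move=> i; exact: integrable_Rsum.
by apply: eq_bigr => i _; rewrite Rintegral_sum.
Qed.

Lemma Vdiv_norm_sqr u : H1v u -> (Vdiv_norm Omega u ^+ 2)%E = (gradsq u)%:E.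
Proof.
move=> hu; rewrite /Vdiv_norm Lp_norm2_enorm /gradsq /ipm -EFin_Rintegral//; last first.
  by apply: mxdot_integrable => i j; exact: H1v_vgrad_L2.
by apply: eq_integral => x _; rewrite mxdotE.
Qed.

Lemma Vdiv_normE u : H1v u -> Vdiv_norm Omega u = (Num.sqrt (gradsq u))%:E.
Proof.
move=> hu; have := Vdiv_norm_sqr hu; have : (0 <= Vdiv_norm Omega u)%E by exact: Lp_norm_ge0.
case: (Vdiv_norm Omega u) => [r||]//; rewrite ?expe2//.
rewrite lee_fin => r0 [<-]; congr EFin.
by rewrite -expr2 sqrtr_sqr ger0_norm.
Qed.

Lemma Vdiv_poincare : (0 < n)%N -> exists2 C : R, 0 <= C &
  forall u, Vdiv Omega u -> ipm Omega u u <= C * gradsq u.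
Proof.
move=> n0; have [C C0 hC] := H10_poincare oO bO n0; exists C => // u hu.
have hu1 := Vdiv_H1v hu; rewrite gradsqE// exchange_big/= mulr_sumr.
rewrite /ipm; under eq_Rintegral do rewrite mxdotE big_ord1.
have L j := L2_sqr_integrable (H1_L2 (hu1 j)).
rewrite (eq_Rintegral lam (g := fun x => \sum_j component u j x ^+ 2)); last first.
  by move=> x _; apply: eq_bigr => j _; rewrite expr2.
by rewrite Rintegral_sum//; apply: ler_sum => j _; apply: hC; exact: Vdiv_H10.
Qed.

Lemma mxdot_sym (A : 'M[R]_n) : let D := 2^-1 *: (A + A^T) in
  2 * mxdot D D = mxdot A A + \sum_i \sum_j A i j * A j i.
Proof.
move=> D; rewrite !mxdotE mulr_sumr.
have E : \sum_i \sum_j (A i j * A i j) = \sum_i \sum_j (2^-1 * (A i j ^+ 2 + A j i ^+ 2)).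
  under [RHS]eq_bigr do rewrite -mulr_sumr big_split/=.
  rewrite -mulr_sumr big_split/= [X in _ + X]exchange_big/=.
  set S := \sum_i _; have -> : 2^-1 * (S + S) = S by field.
  by [].
rewrite E -big_split/=; apply: eq_bigr => i _; rewrite mulr_sumr -big_split/=; apply: eq_bigr => j _.
by rewrite !mxE; field.
Qed.

(** Pointwise, 2 |Du|^2 is |grad u|^2 plus the contraction of grad u with its transpose, whose
    integral is nonnegative by [H10_mixed_ge0]. The lower bound nu1 then enters as a factor, and nu2
    provides integrability. *)
Lemma korn (m : pt -> R) (nu1 nu2 : R) u : (forall i, H10 Omega (component u i)) ->
  0 < nu1 -> measurable_fun Omega m -> (forall x, nu1 <= m x <= nu2) ->
  nu1 * gradsq u <= 2 * ipm Omega (fun x => Num.sqrt (m x) *: symgrad Omega u x)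
                                  (fun x => Num.sqrt (m x) *: symgrad Omega u x).
Proof.
move=> hu nu10 mm hm; have hu1 : H1v u by move=> i; have [] := hu i.
have Lg i j := H1v_vgrad_L2 i j hu1.
have LD i j : L2 Omega (fun x => symgrad Omega u x i j).
  rewrite (_ : (fun _ => _) = (fun x => 2^-1 * (vgrad Omega u x i j + vgrad Omega u x j i))).
    by apply: L2Z => //; exact: L2D.
  by apply/funext => x; rewrite !mxE.
have m0 x : 0 <= m x by have /andP[h _] := hm x; rewrite (le_trans _ h)// ltW.
have iD : lam.-integrable Omega (EFin \o (fun x => mxdot (symgrad Omega u x) (symgrad Omega u x))).
  exact: mxdot_integrable.
have D0 x : 0 <= mxdot (symgrad Omega u x) (symgrad Omega u x).
  by rewrite mxdotE; apply: sumr_ge0 => i _; apply: sumr_ge0 => j _; rewrite -expr2 sqr_ge0.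
have E : ipm Omega (fun x => Num.sqrt (m x) *: symgrad Omega u x) (fun x => Num.sqrt (m x) *: symgrad Omega u x) =
    \int[lam]_(x in Omega) (m x * mxdot (symgrad Omega u x) (symgrad Omega u x)).
  apply: eq_Rintegral => x _; rewrite !mxdotE mulr_sumr; apply: eq_bigr => i _.
  rewrite mulr_sumr; apply: eq_bigr => j _; rewrite !mxE mulrACA -expr2 sqr_sqrtr//.
rewrite E.
have imD : lam.-integrable Omega (EFin \o (fun x => m x * mxdot (symgrad Omega u x) (symgrad Omega u x))).
  have inD := integrable_mulr mO nu2 iD.
  apply: le_integrable inD => //.
    apply/measurable_EFinP; apply: measurable_funM => //.
    by apply/measurable_EFinP; exact: (measurable_int lam).
  move=> x _ /=; have /andP[h1 h2] := hm x.
  have nu20 : 0 <= nu2 by apply: le_trans (m0 x) h2.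
  by rewrite lee_fin !ger0_norm ?mulr_ge0// ler_wpM2r.
have ig := mxdot_integrable Lg Lg.
have iaa : lam.-integrable Omega (EFin \o (fun x => \sum_i \sum_j vgrad Omega u x i j * vgrad Omega u x j i)).
  by apply: integrable_Rsum => // i; apply: integrable_Rsum => // j; exact: L2_mul.
have pos := H10_mixed_ge0 oO hu.
apply: (@le_trans _ _ (nu1 * (2 * \int[lam]_(x in Omega) mxdot (symgrad Omega u x) (symgrad Omega u x)))).
  rewrite ler_pM2l// -RintegralZl//.
  rewrite (eq_Rintegral lam (g := fun x => mxdot (vgrad Omega u x) (vgrad Omega u x) +
     \sum_i \sum_j vgrad Omega u x i j * vgrad Omega u x j i)); last by move=> x _; rewrite -mxdot_sym.
  by rewrite RintegralD// lerDl.
rewrite mulrCA ler_pM2l// -RintegralZl//; apply: le_Rintegral => //.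
  exact: integrable_mulr.
by move=> x _; rewrite ler_wpM2r//; have /andP[] := hm x.
Qed.

Lemma weak_partialZ c i f g : is_weak_partial Omega i f g ->
  is_weak_partial Omega i (fun x => c * f x) (fun x => c * g x).
Proof.
move=> h; have := weak_partial_lin (c - 1) oO h h.
rewrite (_ : (fun x => f x + _) = (fun x => c * f x)); last by apply/funext => x; ring.
by rewrite (_ : (fun x => g x + _) = (fun x => c * g x))//; apply/funext => x; ring.
Qed.

Lemma iter_partialZ c s f : smooth f ->
  iter_partial s (fun x : pt => c * f x) = (fun x => c * iter_partial s f x).
Proof.
move=> sf; elim: s => [//|i s IH] /=; rewrite IH; apply/funext => x.
have [_ /(_ (ltnSn _)) h] := sf (size s).+1 s.
by rewrite /partial; have := deriveZ c (h x i); rewrite /GRing.scale/= => <-.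
Qed.

Lemma smoothZ c f : smooth f -> smooth (fun x : pt => c * f x).
Proof.
move=> sf k s; rewrite iter_partialZ//; have [h1 h2] := sf k s; split=> [/h1 cs x|/h2 ds x i].
  exact: (cvgM (cvg_cst c) (cs x)).
by have [] := is_deriveZ c (derivableP (ds x i)).
Qed.

Lemma test_functionZ c f : c != 0 -> test_function Omega f -> test_function Omega (fun x => c * f x).
Proof.
move=> c0 [sf h1 h2]; have E : [set x | c * f x != 0] = [set x | f x != 0].
  by apply/funext => x /=; rewrite mulf_eq0 (negbTE c0).
by split; [exact: smoothZ|rewrite E|rewrite E].
Qed.

Lemma H1Z c f : H1 Omega f -> H1 Omega (fun x => c * f x).
Proof.
move=> hf; split; first by apply: L2Z => //; exact: H1_L2.
move=> i; exists (fun x => c * wpartial Omega i f x).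
  by apply: weak_partialZ; exact: H1_weak_partial.
by apply: L2Z => //; exact: H1_wpartial_L2.
Qed.

Lemma wpartialZ c f i : H1 Omega f ->
  wpartial Omega i (fun x => c * f x) = (fun x => c * wpartial Omega i f x) %[ae lam in Omega].
Proof. by move=> hf; apply: wpartial_ae => //; apply: weak_partialZ; exact: H1_weak_partial. Qed.

Lemma ae_in_forall (I : finType) (f g : I -> pt -> R) :
  (forall i, f i = g i %[ae lam in Omega]) ->
  \forall x \ae lam, Omega x -> forall i, f i x = g i x.
Proof.
move=> h; have : \forall x \ae lam, forall i, Omega x -> f i x = g i x.
  by apply: filter_forall => i; exact: h.
by apply: filterS => x hx Ox i; exact: hx.
Qed.

Lemma H1_norm_sqrE f : H1 Omega f -> (H1_norm Omega f ^+ 2)%E =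
  (\int[lam]_(x in Omega) (f x ^+ 2) + \sum_i \int[lam]_(x in Omega) (wpartial Omega i f x ^+ 2))%:E.
Proof.
move=> hf; rewrite H1_norm_sqr (L2_fin mO (H1_L2 hf)).
have ig i := L2_sqr_integrable (H1_wpartial_L2 oO i hf).
rewrite /dirichlet EFin_Rintegral//; first by rewrite Rintegral_sum// -EFinD.
exact: integrable_Rsum.
Qed.

Lemma vgradZ c u : H1v u -> \forall x \ae lam, Omega x -> vgrad Omega (c *: u) x = c *: vgrad Omega u x.
Proof.
move=> hu; have := @ae_in_forall ('I_n * 'I_n)%type
  (fun ij => wpartial Omega ij.1 (fun x => c * component u ij.2 x))
  (fun ij x => c * wpartial Omega ij.1 (component u ij.2) x) (fun ij => wpartialZ c ij.1 (hu ij.2)).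
apply: filterS => x h Ox; apply/matrixP => i j; rewrite !mxE -(h Ox (i, j))/=.
by congr wpartial; apply/funext => y; rewrite /component mxE.
Qed.

Let X f : R := \int[lam]_(x in Omega) (f x ^+ 2) +
  \sum_i \int[lam]_(x in Omega) (wpartial Omega i f x ^+ 2).

Let H1_normE f : H1 Omega f -> H1_norm Omega f = (Num.sqrt (X f))%:E.
Proof.
move=> hf; have := H1_norm_sqrE hf; have : (0 <= H1_norm Omega f)%E by exact: poweR_ge0.
case: (H1_norm Omega f) => [r||]//; rewrite ?expe2//.
rewrite lee_fin => r0 [E]; congr EFin.
by rewrite /X -E -expr2 sqrtr_sqr ger0_norm.
Qed.

Lemma ae_eq_Rintegral_gen (f g : pt -> R) : f = g %[ae lam in Omega] ->
  \int[lam]_(x in Omega) f x = \int[lam]_(x in Omega) g x.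
Proof.
move=> fg; rewrite /Rintegral; congr fine; apply: ae_eq_integral_gen => //.
by apply: filterS fg => x h Ox; rewrite h.
Qed.

Lemma H1_normZ c f : H1 Omega f -> H1_norm Omega (fun x => c * f x) = (`|c|%:E * H1_norm Omega f)%E.
Proof.
move=> hf; rewrite (H1_normE hf) (H1_normE (H1Z c hf)) -EFinM; congr EFin.
rewrite -sqrtr_sqr -sqrtrM ?sqr_ge0//; congr Num.sqrt.
rewrite /X mulrDr mulr_sumr -RintegralZl//; last exact: L2_sqr_integrable (H1_L2 hf).
congr (_ + _); first by apply: eq_Rintegral => x _; rewrite exprMn.
apply: eq_bigr => i _; rewrite -RintegralZl//; last exact: L2_sqr_integrable (H1_wpartial_L2 oO i hf).
apply: ae_eq_Rintegral_gen; apply: filterS (wpartialZ c i hf) => x h Ox.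
by rewrite h// exprMn.
Qed.

Lemma test_H1 f : test_function Omega f -> H1 Omega f.
Proof.
move=> tf; split; first exact: test_L2.
move=> i; exists (partial i f); first by apply: smooth_weak_partial; case: tf.
exact/test_L2/test_function_partial.
Qed.

Lemma H1B f g : H1 Omega f -> H1 Omega g -> H1 Omega (fun x => f x + (-1) * g x).
Proof.
move=> hf hg; split.
  by apply: L2D => //; [exact: H1_L2|apply: L2Z => //; exact: H1_L2].
move=> i; exists (fun x => wpartial Omega i f x + (-1) * wpartial Omega i g x).
  by apply: weak_partial_lin => //; exact: H1_weak_partial.
by apply: L2D => //; [exact: H1_wpartial_L2|apply: L2Z => //; exact: H1_wpartial_L2].
Qed.

Lemma H10Z c f : c != 0 -> H10 Omega f -> H10 Omega (fun x => c * f x).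
Proof.
move=> c0 [hf happ]; split; first exact: H1Z.
move=> e e0; have nc : 0 < `|c| by rewrite normr_gt0.
have [eta teta hn] := happ (e / `|c|) (divr_gt0 e0 nc).
exists (fun x => c * eta x); first exact: test_functionZ.
have hw : H1 Omega (fun x => f x + (-1) * eta x) by apply: H1B => //; exact: test_H1.
have Ew : (f - eta)%R = (fun x => f x + (-1) * eta x) by apply/funext => x; rewrite mulN1r.
rewrite (_ : _ - _ = (fun x => c * (f x + (-1) * eta x))); last first.
  by apply/funext => x /=; rewrite mulrDr mulN1r mulrN.
move: hn; rewrite Ew (H1_normZ c hw) (H1_normE hw) -EFinM !lte_fin.
by rewrite ltr_pdivlMr// mulrC.
Qed.

Lemma VdivZ c u : c != 0 -> Vdiv Omega u -> Vdiv Omega (c *: u).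
Proof.
move=> c0 hu; have [h1 h2] := hu; split.
  move=> i; rewrite (_ : component (c *: u) i = (fun x => c * component u i x)).
    exact: H10Z.
  by apply/funext => x; rewrite /component mxE.
have hZ := vgradZ c (Vdiv_H1v hu).
by apply: filterS2 h2 hZ => x hx hZx Ox; rewrite hZx// mxtraceZ hx// mulr0.
Qed.

Lemma Vdiv_normZ c u : c != 0 -> Vdiv Omega u -> Vdiv_norm Omega (c *: u) = (`|c|%:E * Vdiv_norm Omega u)%E.
Proof.
move=> c0 hu; have hcu := VdivZ c0 hu.
rewrite (Vdiv_normE (Vdiv_H1v hu)) (Vdiv_normE (Vdiv_H1v hcu)) -EFinM; congr EFin.
rewrite -sqrtr_sqr -sqrtrM ?sqr_ge0//; congr Num.sqrt.
rewrite /gradsq /ipm -RintegralZl//; last first.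
  by apply: mxdot_integrable => i j; apply: H1v_vgrad_L2; exact: Vdiv_H1v.
apply: ae_eq_Rintegral_gen; apply: filterS (vgradZ c (Vdiv_H1v hu)) => x h Ox.
rewrite h// !mxdotE mulr_sumr; apply: eq_bigr => i _; rewrite mulr_sumr; apply: eq_bigr => j _.
by rewrite !mxE mulrACA -expr2.
Qed.

(** [dual_norm] only sees vectors of norm at most 1, so u is normalized. When its gradient vanishes,
    the bound contained in [dual] forces l u = 0. *)
Lemma dual_norm_bound (l : (pt -> pt) -> R) (u : pt -> pt) (dn : R) :
  dual (Vdiv Omega) (Vdiv_norm Omega) l -> (Vdiv_dual_norm Omega l <= dn%:E)%E ->
  Vdiv Omega u -> `|l u| <= dn * Num.sqrt (gradsq u).
Proof.
move=> [lin [C hC]] hdn hu; have nE := Vdiv_normE (Vdiv_H1v hu).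
have [g0|gn0] := eqVneq (Num.sqrt (gradsq u)) 0.
  by rewrite g0 mulr0; have := hC u hu; rewrite nE g0 mule0 lee_fin.
have g_gt0 : 0 < Num.sqrt (gradsq u) by rewrite lt_neqAle eq_sym gn0 sqrtr_ge0.
set g := Num.sqrt _ in nE gn0 g_gt0 *.
have gi0 : g^-1 != 0 by rewrite invr_eq0.
have hcu := VdivZ gi0 hu.
have lZ : l (g^-1 *: u) = g^-1 * l u.
  (* Linearity is given only in the form l (c x + y), so the multiple of u is written as (1/g - 1) u
     + u. *)
  have := lin (g^-1 - 1) u u hu hu; rewrite scalerBl scale1r subrK => ->.
  by rewrite mulrBl mul1r subrK.
have : `|l (g^-1 *: u)| <= dn.
  rewrite -lee_fin; apply: le_trans hdn; apply: ereal_sup_ubound; exists (g^-1 *: u) => //; split=> //.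
  by rewrite Vdiv_normZ// nE -EFinM lee_fin gtr0_norm ?invr_gt0// mulVf.
by rewrite lZ normrM gtr0_norm ?invr_gt0// ler_pdivrMl// mulrC.
Qed.

End solenoidal_space.

(** * Energy bounds *)

Section double_well.
Variables (R : realType) (F : R -> R).
Hypothesis dF : forall s : R, derivable F s 1.
Hypothesis ddF : forall s : R, derivable (derive1 F) s 1.
Variable kap : R.
Hypothesis kap0 : 0 <= kap.
Hypothesis F2_lb : forall s, - kap <= derive1 (derive1 F) s.
Hypothesis F2_coercive : forall L, exists2 S, 0 <= S & forall s, S <= `|s| -> L <= derive1 (derive1 F) s.

Lemma derive1_increment (a b c : R) : a <= b ->
  (forall s, a < s < b -> c <= derive1 (derive1 F) s) ->
  c * (b - a) <= derive1 F b - derive1 F a.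
Proof.
move=> ab h; have [->|anb] := eqVneq a b; first by rewrite !subrr mulr0.
have {ab anb} ab : a < b by rewrite lt_neqAle anb.
have cF : {within `[a, b], continuous (derive1 F)}.
  by apply: continuous_subspaceT => x; apply/differentiable_continuous/derivable1_diffP.
have dd (x : R) : x \in `]a, b[ -> is_derive x 1 (derive1 F) (derive1 (derive1 F) x).
  by move=> _; apply: DeriveDef; [exact: ddF|rewrite derive1E].
have [x xab ->] := MVT ab dd cF.
by rewrite ler_wpM2r ?subr_ge0 ?(ltW ab)//; apply: h; move: xab; rewrite in_itv.
Qed.

(* F' - L id is increasing outside [-S, S], and loses at most D inside. *)
Lemma derive1_almost_monotone L : 0 <= L -> exists2 D, 0 <= D &
  forall a b, a <= b -> L * (b - a) - D <= derive1 F b - derive1 F a.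
Proof.
move=> L0; have [S S0 hS] := F2_coercive L.
exists ((L + kap) * (2 * S)); first by rewrite mulr_ge0 ?addr_ge0// mulr_ge0.
move=> a b ab; set D := _ * (2 * S).
have D0 : 0 <= D by rewrite mulr_ge0 ?addr_ge0// mulr_ge0.
have up x y : S <= x -> x <= y -> L * (y - x) <= derive1 F y - derive1 F x.
  move=> Sx xy; apply: derive1_increment => // s /andP[xs _]; apply: hS.
  by rewrite (le_trans Sx)// (le_trans (ltW xs))// ler_norm.
have dn x y : y <= - S -> x <= y -> L * (y - x) <= derive1 F y - derive1 F x.
  move=> Sy xy; apply: derive1_increment => // s /andP[_ sy]; apply: hS.
  by rewrite -normrN (le_trans _ (ler_norm _))// lerNr (le_trans (ltW sy)).
have mid x y : - S <= x -> x <= y -> y <= S -> L * (y - x) - D <= derive1 F y - derive1 F x.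
  move=> Sx xy yS; apply: (@le_trans _ _ (- kap * (y - x))); last exact: derive1_increment.
  rewrite mulNr lerBlDr -lerBlDl opprK -mulrDl /D; apply: ler_wpM2l; first by rewrite addr_ge0.
  by lra.
have [Sa|aS] := leP S a; first by have := up a b Sa ab; lra.
have [bS|Sb] := leP b (- S); first by have := dn a b bS ab; lra.
pose a1 := Num.max a (- S); pose b1 := Num.min b S.
have ha : L * (a1 - a) <= derive1 F a1 - derive1 F a.
  rewrite /a1; have [h|h] := leP a (- S); last by rewrite !subrr mulr0.
  exact: dn.
have hb : L * (b - b1) <= derive1 F b - derive1 F b1.
  rewrite /b1; have [h|h] := leP b S; first by rewrite !subrr mulr0.
  exact: up (ltW h).
have hm : L * (b1 - a1) - D <= derive1 F b1 - derive1 F a1.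
  apply: mid.
  - by rewrite le_max lexx orbT.
  - by rewrite le_min !ge_max ab (ltW Sb) (ltW aS) ge0_cp.
  - by rewrite ge_min lexx orbT.
have -> : L * (b - a) - D = L * (b - b1) + (L * (b1 - a1) - D) + L * (a1 - a) by ring.
lra.
Qed.

(** P = F - (L + 1) r^2 has a derivative that increases up to a loss D, hence lies above its
    tangents up to D |m - s|. Taking L + 1 instead of L leaves a spare (m - s)^2, which absorbs this
    error at the price D^2. The constant is uniform in m, hence in the initial mass. *)
Lemma tangent_inequality L : 0 <= L -> exists2 C, 0 <= C &
  forall m s, F s + derive1 F s * (m - s) + L * (m - s) ^+ 2 - C <= F m.
Proof.
move=> L0; have L1 : 0 <= L + 1 by rewrite addr_ge0.
have [D D0 hD] := derive1_almost_monotone (mulr_ge0 (ler0n R 2) L1).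
exists (D ^+ 2); first exact: sqr_ge0.
move=> m s; pose P (r : R) := F r - (L + 1) * r ^+ 2.
pose dP (r : R) := derive1 F r - 2 * (L + 1) * r.
have dPE (r : R) : is_derive r 1 P (dP r).
  have h : is_derive r 1 F (derive1 F r) by apply: DeriveDef; [exact: dF|rewrite derive1E].
  rewrite /P /dP; apply: is_derive_eq; rewrite /GRing.scale/=; ring.
have cP : continuous P.
  by move=> x; apply/differentiable_continuous/derivable1_diffP; case: (dPE x).
have mvt a b : a <= b -> exists2 c, a <= c <= b & P b - P a = dP c * (b - a).
  move=> ab; have [|c cab E] := MVT_segment ab (fun x _ => dPE x); first exact: continuous_subspaceT.
  by exists c => //; move: cab; rewrite in_itv.
have mono a b : a <= b -> dP a - D <= dP b by move=> ab; have := hD a b ab; rewrite /dP; lra.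
have key : P s + dP s * (m - s) - D * `|m - s| <= P m.
  have [sm|/ltW ms] := leP s m.
    have [c /andP[sc cm] E] := mvt s m sm.
    have h : 0 <= (dP c - (dP s - D)) * (m - s).
      by rewrite mulr_ge0 ?subr_ge0//; exact: mono.
    rewrite ger0_norm ?subr_ge0//; move: h; rewrite mulrBl -E mulrBl; lra.
  have [c /andP[mc cs] E] := mvt m s ms.
  have h : 0 <= (dP s - (dP c - D)) * (s - m).
    by rewrite mulr_ge0 ?subr_ge0//; exact: mono.
  have n : `|m - s| = s - m by rewrite distrC ger0_norm ?subr_ge0.
  have {}h : 0 <= dP s * (s - m) - (dP c * (s - m) - D * (s - m)) by rewrite -!mulrBl.
  by rewrite n -(opprB s m) mulrN; move: h; rewrite -E; lra.
have : D * `|m - s| <= D ^+ 2 + (m - s) ^+ 2.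
  rewrite -(real_normK (num_real (m - s))); move: (normr_ge0 (m - s)); move: `|m - s| => t t0.
  have := sqr_ge0 (D - t); have := mulr_ge0 D0 t0; rewrite !expr2; lra.
move: key; rewrite /P /dP; move: `|m - s| => t; rewrite !expr2; lra.
Qed.

(** The tangent inequality at 0 for L + 1; the spare s^2 absorbs the linear term. It is used with L
    = j against the kernel and with L = 0 to bound F from below. *)
Lemma quadratic_lower_bound L : 0 <= L -> exists2 C, 0 <= C & forall s, L * s ^+ 2 - C <= F s.
Proof.
move=> L0; have L1 : 0 <= L + 1 by rewrite addr_ge0.
have [C C0 hC] := tangent_inequality L1.
exists (C + `|F 0| + derive1 F 0 ^+ 2); first by rewrite !addr_ge0// sqr_ge0.
move=> s; have := hC s 0; rewrite subr0 => h.
have := sqr_ge0 (derive1 F 0 + s); have := sqr_ge0 (derive1 F 0); have := sqr_ge0 s.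
have : - `|F 0| <= F 0 by have := ler_norm (- F 0); rewrite normrN; lra.
move: h; move: (`|F 0|) => z; rewrite !expr2; lra.
Qed.

End double_well.

(* Also holds for non-integrable f: then Rintegral is fine of an infinity, i.e. 0. *)
Lemma abs_Rintegral_le d (T : measurableType d) (R : realType) (mu : {measure set T -> \bar R})
    (D : set T) (f : T -> R) :
  (`|\int[mu]_(x in D) f x|%:E <= \int[mu]_(x in D) `|f x|%:E)%E.
Proof.
have -> : \int[mu]_(x in D) f x = fine (\int[mu]_(x in D) (EFin \o f)^\+ x - \int[mu]_(x in D) (EFin \o f)^\- x)%E.
  by rewrite /Rintegral integralE.
have p : (\int[mu]_(x in D) (EFin \o f)^\+ x <= \int[mu]_(x in D) `|f x|%:E)%E.
  apply: ge0_le_integral_gen => x _; first exact: funepos_ge0.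
  by rewrite funeposE /= -EFin_max lee_fin ge_max ler_norm normr_ge0.
have m : (\int[mu]_(x in D) (EFin \o f)^\- x <= \int[mu]_(x in D) `|f x|%:E)%E.
  apply: ge0_le_integral_gen => x _; first exact: funeneg_ge0.
  by rewrite funenegE /= -EFin_max lee_fin ge_max normr_ge0 -normrN ler_norm.
have p0 : (0 <= \int[mu]_(x in D) (EFin \o f)^\+ x)%E by apply: integral_ge0 => x _; exact: funepos_ge0.
have m0 : (0 <= \int[mu]_(x in D) (EFin \o f)^\- x)%E by apply: integral_ge0 => x _; exact: funeneg_ge0.
have a0 : (0 <= \int[mu]_(x in D) `|f x|%:E)%E by apply: le_trans p.
set P := integral _ _ _ in p p0 *; set M := integral _ _ _ in m m0 *.
set A := integral _ _ _ in p m a0 *.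
clearbody P M A; case: P p p0 => [p||]; case: M m m0 => [m||]; rewrite /= ?normr0//.
case: A a0 => [a||]//; last by move=> *; rewrite leey.
by rewrite !lee_fin ler_norml => *; apply/andP; split; lra.
Qed.

(** * Bounds on the nonlocal terms *)

Section kernel_bounds.
Variables (R : realType) (n : nat) (Omega : set 'rV[R]_n).
Local Notation pt := 'rV[R]_n.
Local Notation lam := (leb R n).
Hypothesis mO : measurable Omega.
Hypothesis fO : (lam Omega < +oo)%E.
Variables (J : pt -> R) (j : R).
Hypothesis mJ : measurable_fun setT J.
Hypothesis hJ : (\int[lam]_x `|J x|%:E <= j%:E)%E.

Lemma kernel_norm_ge0 : 0 <= j.
Proof. by rewrite -lee_fin; apply: le_trans hJ; apply: integral_ge0 => x _; rewrite lee_fin. Qed.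

Let mJd : measurable_fun setT (fun p : pt * pt => J (p.1 - p.2)).
Proof.
apply: (measurableT_comp mJ); apply: measurable_addf_rV; first exact: measurable_fst.
exact: (measurableT_comp (@measurable_opp_rV R n) measurable_snd).
Qed.

Let mJx x : measurable_fun setT (fun y : pt => J (x - y)).
Proof.
rewrite (_ : (fun y => _) = J \o ((fun y : pt => y + x) \o -%R)).
  by apply: (measurableT_comp mJ); apply: (measurableT_comp (measurable_shift_rV x)); exact: measurable_opp_rV.
by apply/funext => y /=; rewrite addrC.
Qed.

Let Jrow x : (\int[lam]_y `|J (x - y)|%:E <= j%:E)%E.
Proof.
have m1 : measurable_fun setT (fun y : pt => `|J (y + x)|%:E).
  apply/measurable_EFinP; apply: measurableT_comp => //.
  exact: (measurableT_comp mJ (measurable_shift_rV x)).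
have -> : (\int[lam]_y `|J (x - y)|%:E = \int[lam]_y `|J (y + x)|%:E)%E.
  by rewrite -(ge0_integral_opp m1)//; apply: eq_integral => y _; rewrite addrC.
rewrite (ge0_integral_shift x (f := fun y => `|J y|%:E))//.
by apply/measurable_EFinP; exact: measurableT_comp.
Qed.

Let Jcol y : (\int[lam]_x `|J (x - y)|%:E <= j%:E)%E.
Proof.
rewrite (ge0_integral_shift (- y) (f := fun y => `|J y|%:E))//.
by apply/measurable_EFinP; exact: measurableT_comp.
Qed.

Let JrowO x : (\int[lam]_(y in Omega) `|J (x - y)|%:E <= j%:E)%E.
Proof.
apply: le_trans (Jrow x); apply: ge0_subset_integral => //.
by apply/measurable_EFinP; exact: measurableT_comp.
Qed.

Lemma afun_bound x : `|afun Omega J x| <= j.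
Proof. by rewrite -lee_fin; apply: le_trans (abs_Rintegral_le _ _ _) _; exact: JrowO. Qed.

Let Jconv_le (a : pt -> R) : measurable_fun setT a -> (forall x, 0 <= a x) ->
  (\int[lam]_x \int[lam]_y (`|J (x - y)| * a y)%:E <= j%:E * \int[lam]_y (a y)%:E)%E.
Proof.
move=> ma a0; pose f (p : pt * pt) := (`|J (p.1 - p.2)| * a p.2)%:E.
have mf : measurable_fun setT f.
  apply/measurable_EFinP; apply: measurable_funM; first exact: measurableT_comp.
  exact: (measurableT_comp ma measurable_snd).
have f0 p : (0 <= f p)%E by rewrite lee_fin mulr_ge0.
have -> : (\int[lam]_x \int[lam]_y (`|J (x - y)| * a y)%:E = \int[lam]_y \int[lam]_x f (x, y))%E.
  exact: (@fubini_tonelli _ _ _ _ _ lam lam f mf f0).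
rewrite -ge0_integralZl//; last 3 first.
- exact/measurable_EFinP.
- by move=> y _; rewrite lee_fin.
- by rewrite lee_fin kernel_norm_ge0.
apply: ge0_le_integral_gen => y _; first by apply: integral_ge0.
rewrite /f/=; under eq_integral do rewrite EFinM.
rewrite ge0_integralZr//; last 2 first.
- apply/measurable_EFinP; apply: measurableT_comp => //.
  exact: (measurableT_comp mJ (measurable_shift_rV (- y))).
- by rewrite lee_fin.
by rewrite lee_wpmul2r ?lee_fin.
Qed.

(** Common majorant of the nonlocal terms once Young's inequality has split a product; al and be are
    the weights left on the points x and y. *)
Definition kernel_form (al be : R) (a : pt -> R) (x : pt) : \bar R :=
  (\int[lam]_(y in Omega) (`|J (x - y)| * (al * a x + be * a y))%:E)%E.

(** Schur's test: |J(x - y)| has integral at most j both in y and in x; the weight al goes with the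
    first bound and be with the second. *)
Lemma kernel_form_le al be (a : pt -> R) : 0 <= al -> 0 <= be ->
  measurable_fun Omega a -> (forall x, 0 <= a x) ->
  (\int[lam]_(x in Omega) kernel_form al be a x <=
   ((al + be) * j)%:E * \int[lam]_(x in Omega) (a x)%:E)%E.
Proof.
move=> al0 be0 ma a0; have j0 := kernel_norm_ge0.
have maO : measurable_fun setT (a \_ Omega) by exact: restrict_measurable.
have aO0 x : 0 <= (a \_ Omega) x by rewrite patchE; case: ifP.
have mJr x : measurable_fun Omega (fun y => `|J (x - y)|).
  by apply: measurable_funTS; exact: measurableT_comp.
have mJO x : measurable_fun Omega (fun y => `|J (x - y)|%:E) by exact/measurable_EFinP.
apply: (@le_trans _ _ (\int[lam]_(x in Omega) ((al * j)%:E * (a x)%:E +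
    be%:E * \int[lam]_y (`|J (x - y)| * (a \_ Omega) y)%:E))%E).
  apply: ge0_le_integral_gen => x Ox.
    apply: integral_ge0 => y _; rewrite lee_fin mulr_ge0// addr_ge0// mulr_ge0//.
  have -> : kernel_form al be a x = (\int[lam]_(y in Omega) ((al * a x)%:E * `|J (x - y)|%:E +
      be%:E * (`|J (x - y)| * a y)%:E))%E.
    by apply: eq_integral => y _; rewrite -!EFinM -EFinD; congr EFin; ring.
  rewrite ge0_integralD//; last 4 first.
  - by move=> y _; rewrite lee_fin mulr_ge0// mulr_ge0.
  - exact: measurable_funeM.
  - by move=> y _; rewrite lee_fin mulr_ge0// mulr_ge0.
  - apply: measurable_funeM; apply/measurable_EFinP; exact: measurable_funM.
  rewrite ge0_integralZl//; last by rewrite lee_fin mulr_ge0.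
  rewrite ge0_integralZl//; last 2 first.
  - by apply/measurable_EFinP; exact: measurable_funM.
  - by move=> y _; rewrite lee_fin mulr_ge0.
  apply: leeD.
    apply: le_trans (lee_wpmul2l _ (JrowO x)) _; first by rewrite lee_fin mulr_ge0.
    by rewrite -!EFinM lee_fin mulrAC.
  apply: lee_wpmul2l; first by rewrite lee_fin.
  rewrite integral_mkcond; apply: ge0_le_integral_gen => y _.
    by rewrite patchE; case: ifP => // _; rewrite lee_fin mulr_ge0.
  by rewrite !patchE; case: ifP => // _; rewrite mulr0.
have mI : measurable_fun setT (fun x : pt => \int[lam]_y (`|J (x - y)| * (a \_ Omega) y)%:E)%E.
  apply: (@measurable_fun_fubini_tonelli_F _ _ _ _ _ lam (fun p : pt * pt => (`|J (p.1 - p.2)| * (a \_ Omega) p.2)%:E)).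
  - apply/measurable_EFinP; apply: measurable_funM; first exact: measurableT_comp.
    exact: (measurableT_comp maO measurable_snd).
  - by move=> p; rewrite lee_fin mulr_ge0.
have I0 x : (0 <= \int[lam]_y (`|J (x - y)| * (a \_ Omega) y)%:E)%E.
  by apply: integral_ge0 => y _; rewrite lee_fin mulr_ge0.
rewrite ge0_integralD//; last 4 first.
- by move=> x _; rewrite -EFinM lee_fin mulr_ge0// mulr_ge0.
- by apply: measurable_funeM; exact/measurable_EFinP.
- by move=> x _; rewrite mule_ge0// lee_fin.
- by apply: measurable_funeM; exact: measurable_funTS.
rewrite ge0_integralZl//; last 3 first.
- exact/measurable_EFinP.
- by move=> x _; rewrite lee_fin.
- by rewrite lee_fin mulr_ge0.
rewrite ge0_integralZl//; last by exact: measurable_funTS.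
have A0 : (0 <= \int[lam]_(x in Omega) (a x)%:E)%E by apply: integral_ge0 => x _; rewrite lee_fin.
rewrite mulrDl EFinD ge0_muleDl ?lee_fin ?mulr_ge0//; apply: leeD => //.
rewrite EFinM -muleA; apply: lee_wpmul2l; first by rewrite lee_fin.
apply: (@le_trans _ _ (\int[lam]_x \int[lam]_y (`|J (x - y)| * (a \_ Omega) y)%:E)%E).
  by apply: ge0_subset_integral.
apply: le_trans (Jconv_le maO aO0) _; apply: lee_wpmul2l; first by rewrite lee_fin.
rewrite [leRHS]integral_mkcond; apply: ge0_le_integral_gen => x _; first by rewrite lee_fin.
by rewrite !patchE; case: ifP.
Qed.

Lemma kernel_quadratic_le (w : pt -> R) : L2 Omega w ->
  `|\int[lam]_(x in Omega) \int[lam]_(y in Omega) (J (x - y) * (w x - w y) ^+ 2)| <=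
  4 * j * \int[lam]_(x in Omega) (w x ^+ 2).
Proof.
move=> hw; rewrite -lee_fin; apply: le_trans (abs_Rintegral_le _ _ _) _.
apply: (@le_trans _ _ (\int[lam]_(x in Omega) kernel_form 2 2 (fun x => w x ^+ 2)%R x)%E).
  apply: ge0_le_integral_gen => x Ox; first by rewrite lee_fin.
  apply: le_trans (abs_Rintegral_le _ _ _) _; apply: ge0_le_integral_gen => y _; rewrite lee_fin//.
  rewrite normrM ler_wpM2l// ger0_norm ?sqr_ge0//.
  by have := sqr_ge0 (w x + w y); rewrite !expr2; lra.
apply: le_trans (kernel_form_le _ _ _ _) _ => //.
- by apply: measurable_funX; exact: L2_measurable.
- by move=> x; exact: sqr_ge0.
by rewrite EFin_Rintegral ?(L2_sqr_integrable hw)// -EFinM lee_fin -natrD.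
Qed.

(** Since a(x) integrates J(x - y), the constant m drops out: with w = phi - m, the first factor is
    the integral of J(x - y) (w x - w y), and |w x (w x - w y)| <= 3/2 (w x)^2 + 1/2 (w y)^2.
    Integrability of J(x - y) phi y in y, from Fubini, holds only for almost every x. *)
Lemma kernel_coupling (phi : pt -> R) (m : R) : L2 Omega phi ->
  \forall x \ae lam, Omega x ->
  (`|(afun Omega J x * phi x - Defs.conv Omega J phi x) * (phi x - m)|%:E <=
   kernel_form (3 / 2) (1 / 2) (fun x => (phi x - m) ^+ 2)%R x)%E.
Proof.
move=> hphi; have j0 := kernel_norm_ge0.
have mphi : measurable_fun setT (phi \_ Omega) by apply: restrict_measurable => //; exact: L2_measurable hphi.
have iphi := L2_integrable mO fO hphi.
pose K (p : pt * pt) := J (p.1 - p.2) * (phi \_ Omega) p.2.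
have mK : measurable_fun setT K.
  by apply: measurable_funM => //; exact: (measurableT_comp mphi measurable_snd).
have iK : (lam \x lam)%E.-integrable setT (EFin \o K).
  apply/integrable12ltyP; first exact/measurable_EFinP.
  apply: (@le_lt_trans _ _ (j%:E * \int[lam]_y (`|(phi \_ Omega) y|)%:E)%E).
    apply: le_trans (Jconv_le (a := fun y => `|(phi \_ Omega) y|) _ _) => //; last exact: measurableT_comp.
    rewrite le_eqVlt; apply/orP; left; apply/eqP; apply: eq_integral => x _; apply: eq_integral => y _.
    by rewrite /K/= normrM.
  have -> : (\int[lam]_y (`|(phi \_ Omega) y|)%:E = \int[lam]_(y in Omega) `|(EFin \o phi) y|)%E.
    rewrite [RHS]integral_mkcond; apply: eq_integral => y _; rewrite !patchE.
    by case: ifP => //; rewrite normr0.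
  by move/integrableP : iphi => [_ h]; apply: lte_mul_pinfty.
apply: filterS (ae_integrable_section iK) => x hx Ox.
have iJ : lam.-integrable Omega (EFin \o (fun y => J (x - y))).
  apply/integrableP; split; first by apply/measurable_EFinP; exact: measurable_funTS.
  by apply: le_lt_trans (JrowO x) _; rewrite ltry.
have iJp : lam.-integrable Omega (EFin \o (fun y => J (x - y) * phi y)).
  have := integrableS measurableT mO (@subsetT _ Omega) hx.
  apply: eq_integrable => // y /set_mem Oy.
  by rewrite /K/= patchE mem_set.
have E : afun Omega J x * phi x - Defs.conv Omega J phi x =
    \int[lam]_(y in Omega) (J (x - y) * ((phi x - m) - (phi y - m))).
  rewrite /afun /conv mulrC -RintegralZl// -RintegralB//; last exact: integrable_mulr.
  by apply: eq_Rintegral => y _; ring.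
rewrite E normrM EFinM muleC.
apply: le_trans (lee_wpmul2l _ (abs_Rintegral_le _ _ _)) _; first by rewrite lee_fin.
rewrite -ge0_integralZl//; last first.
  apply/measurable_EFinP; apply: measurableT_comp => //; apply: measurable_funM.
    exact: measurable_funTS.
  apply: measurable_funB => //; apply: measurable_funB => //; exact: L2_measurable hphi.
apply: ge0_le_integral_gen => y _; first by rewrite lee_fin mulr_ge0.
rewrite -EFinM lee_fin normrM mulrCA ler_wpM2l//.
move: (phi x - m) (phi y - m) => a b; rewrite -normrM.
apply: (@le_trans _ _ (`|a * a| + `|a * b|)); first by rewrite mulrBr; exact: ler_normB.
rewrite (ger0_norm (_ : 0 <= a * a)) -?expr2 ?sqr_ge0// normrM.
rewrite -(real_normK (num_real a)) -(real_normK (num_real b)).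
have := sqr_ge0 (`|a| - `|b|); move: `|a| `|b| => p r; rewrite !expr2; lra.
Qed.

End kernel_bounds.

(** * Energy bounds from below and above *)

Section energy_bounds.
Variables (R : realType) (n : nat) (Omega : set 'rV[R]_n).
Local Notation pt := 'rV[R]_n.
Local Notation lam := (leb R n).
Hypothesis hOmega : C1_bounded_domain Omega.
Let oO := domain_open hOmega.
Let mO := domain_measurable hOmega.
Let fO := domain_finite hOmega.
Local Notation vol := (fine (lam Omega)).
Variables (J : pt -> R) (j : R).
Hypothesis mJ : measurable_fun setT J.
Hypothesis hJ : (\int[lam]_x `|J x|%:E <= j%:E)%E.
Variables (F : R -> R) (kap : R).
Hypothesis dF : forall s : R, derivable F s 1.
Hypothesis ddF : forall s : R, derivable (derive1 F) s 1.
Hypothesis kap0 : 0 <= kap.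
Hypothesis F2_lb : forall s, - kap <= derive1 (derive1 F) s.
Hypothesis F2_coercive : forall L, exists2 S, 0 <= S & forall s, S <= `|s| -> L <= derive1 (derive1 F) s.

Let j0 : 0 <= j := kernel_norm_ge0 hJ.

Let mF : measurable_fun setT F.
Proof. by apply: continuous_measurable_fun => x; apply/differentiable_continuous/derivable1_diffP. Qed.

Let mF' : measurable_fun setT (derive1 F).
Proof. by apply: continuous_measurable_fun => x; apply/differentiable_continuous/derivable1_diffP. Qed.

Lemma ipm_ge0 m k (W : pt -> 'M[R]_(m, k)) : 0 <= ipm Omega W W.
Proof.
apply: Rintegral_ge0 => x _; rewrite mxdotE; apply: sumr_ge0 => i _; apply: sumr_ge0 => l _.
by rewrite -expr2 sqr_ge0.
Qed.

(** J may change sign, so the kernel energy is only known to be at least - j |phi|^2; F grows faster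
    than j s^2 and makes up for it. *)
Lemma energy_lower_bound : exists2 C, 0 <= C & forall (u : pt -> pt) (phi : pt -> R),
  L2 Omega phi -> ((- C)%:E <= energy Omega J F u phi)%E.
Proof.
have [C C0 hC] := quadratic_lower_bound dF ddF kap0 F2_lb F2_coercive j0.
have V0 := vol_gt0 hOmega.
exists (C * vol); first by rewrite mulr_ge0// ltW.
move=> u phi hphi; have iphi := L2_sqr_integrable hphi.
have i1 := integrable_mulr mO j iphi.
have i2 := integrable_cst_fin mO (- C) fO.
have FE : ((j * \int[lam]_(x in Omega) (phi x ^+ 2) - C * vol)%:E <= \int[lam]_(x in Omega) (F (phi x))%:E)%E.
  have -> : j * \int[lam]_(x in Omega) (phi x ^+ 2) - C * vol =
      \int[lam]_(x in Omega) (j * phi x ^+ 2 + - C).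
    by rewrite RintegralD// RintegralZl// Rintegral_cstO// mulNr.
  rewrite -EFin_Rintegral//; last exact: integrable_addr.
  by apply: le_integral_gen => x _; rewrite lee_fin.
have q := kernel_quadratic_le mO mJ hJ hphi.
have := ipm_ge0 u; move: q; rewrite ler_norml /energy => /andP[q _] U0.
set Q := \int[lam]_(x in Omega) \int[lam]_(y in Omega) _ in q *.
apply: le_trans (leeD2l _ FE); rewrite -EFinD lee_fin; lra.
Qed.

Lemma energy_upper_bound : exists2 C, 0 <= C & forall (u : pt -> pt) (phi mu : pt -> R) (m : R),
  L2 Omega phi -> mu = chemical_potential Omega J F phi -> H1 Omega mu ->
  m = vol^-1 * \int[lam]_(x in Omega) phi x ->
  (energy Omega J F u phi <= (2^-1 * ipm Omega u u + F m * vol + C +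
     2^-1 * ipm Omega (wgrad Omega mu) (wgrad Omega mu))%:E)%E.
Proof.
have V0 := vol_gt0 hOmega; have [Cp Cp0 hCp] := poincare_wirtinger hOmega.
(* L has to pay, in multiples of |phi - m|^2, for the product of mu with phi - m (Cp + 1), for the
   nonlocal part [G] of that product (2 j), and for the kernel energy (j). *)
pose L := Cp + 1 + 3 * j.
have L0 : 0 <= L by rewrite !addr_ge0// mulr_ge0.
have [C C0 hC] := tangent_inequality dF ddF kap0 F2_lb F2_coercive L0.
exists (C * vol); first by rewrite mulr_ge0// ltW.
move=> u phi mu m hphi muE hmu mE; have Lmu := H1_L2 hmu.
have iphi := L2_integrable mO fO hphi.
have mphi := L2_measurable hphi.
pose w x := phi x - m.
have Lw : L2 Omega w by apply: L2B => //; exact: L2_cst.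
have w0 : \int[lam]_(x in Omega) w x = 0.
  rewrite RintegralB//; last exact: integrable_cst_fin.
  by rewrite Rintegral_cstO// mE mulrAC mulVf ?gt_eqF// mul1r subrr.
(* The nonlocal part of mu times w, so that F'(phi) w = mu w - G. *)
pose G x := (afun Omega J x * phi x - Defs.conv Omega J phi x) * w x.
have GE x : G x = (mu x - derive1 F (phi x)) * w x.
  by rewrite /G muE /chemical_potential; congr (_ * _); rewrite addrK.
have mG : measurable_fun Omega G.
  rewrite (_ : G = fun x => (mu x - derive1 F (phi x)) * w x); last exact/funext.
  apply: measurable_funM; last exact: L2_measurable Lw.
  by apply: measurable_funB; [exact: L2_measurable Lmu|exact: measurableT_comp].
have iw2 := L2_sqr_integrable Lw.
set W := \int[lam]_(x in Omega) (w x ^+ 2).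
have W0 : 0 <= W by apply: Rintegral_ge0 => x _; exact: sqr_ge0.
have absG : (\int[lam]_(x in Omega) `|G x|%:E <= (2 * j * W)%:E)%E.
  apply: (@le_trans _ _ (\int[lam]_(x in Omega) kernel_form Omega J (3 / 2) (1 / 2) (fun x => w x ^+ 2)%R x)%E).
    by apply: ae_le_integral_gen => //; exact: (kernel_coupling mO fO mJ hJ m hphi).
  apply: le_trans (kernel_form_le mO mJ hJ _ _ _ _) _ => //.
  - by apply: measurable_funX; exact: L2_measurable Lw.
  - by move=> x; exact: sqr_ge0.
  rewrite EFin_Rintegral// -EFinM lee_fin -/W le_eqVlt; apply/orP; left; apply/eqP; by field.
have iG : lam.-integrable Omega (EFin \o G).
  by apply/integrableP; split; [exact/measurable_EFinP|apply: le_lt_trans absG _; rewrite ltry].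
have hG : (- \int[lam]_(x in Omega) G x) <= 2 * j * W.
  apply: le_trans (ler_norm _) _; rewrite normrN -lee_fin.
  exact: le_trans (abs_Rintegral_le _ _ _) absG.
pose S := \sum_i \int[lam]_(x in Omega) (wpartial Omega i mu x ^+ 2).
have SE : ipm Omega (wgrad Omega mu) (wgrad Omega mu) = S.
  rewrite /S -Rintegral_sum//; last first.
    by move=> i; apply: L2_sqr_integrable; exact: H1_wpartial_L2.
  apply: eq_Rintegral => x _; rewrite mxdotE big_ord1; apply: eq_bigr => i _.
  by rewrite mxE expr2.
have S0 : 0 <= S by rewrite -SE; exact: ipm_ge0.
have C1 : 0 < 2 * (Cp + 1) by rewrite mulr_gt0// ltr_wpDl.
have pw : \int[lam]_(x in Omega) (mu x * w x) <= 2^-1 * S + (Cp + 1) * W.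
  (* With this weight al, the gradient of mu gets a coefficient al Cp <= 1/2 and the term in w the
     coefficient Cp + 1; adding 1 to Cp avoids dividing by zero. *)
  have al0 : 0 < (2 * (Cp + 1))^-1 by rewrite invr_gt0.
  apply: le_trans (hCp mu w _ al0 hmu Lw w0) _; rewrite -/S -/W; apply: lerD.
    apply: ler_wpM2r => //; rewrite mulrC invfM mulrCA ler_piMr ?invr_ge0//.
    by rewrite ler_pdivrMr ?mul1r ?lerDl// ltr_wpDl.
  by apply: ler_wpM2r => //; rewrite le_eqVlt; apply/orP; left; apply/eqP; field; rewrite gt_eqF// ltr_wpDl.
have imw := L2_mul mO Lmu Lw.
have ic := integrable_cst_fin mO (F m + C) fO.
have iLw := integrable_mulr mO (- L) iw2.
have iNG := integrable_mulr mO (-1) iG.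
have i12 := integrable_addr mO imw iNG.
have i34 := integrable_addr mO iLw ic.
have iR := integrable_addr mO i12 i34.
have FE : (\int[lam]_(x in Omega) (F (phi x))%:E <=
   (\int[lam]_(x in Omega) (mu x * w x) - \int[lam]_(x in Omega) G x - L * W + (F m + C) * vol)%:E)%E.
  have -> : \int[lam]_(x in Omega) (mu x * w x) - \int[lam]_(x in Omega) G x - L * W + (F m + C) * vol =
     \int[lam]_(x in Omega) (mu x * w x + -1 * G x + (- L * w x ^+ 2 + (F m + C))).
    rewrite (RintegralD mO i12 i34) (RintegralD mO imw iNG) (RintegralD mO iLw ic).
    by rewrite (RintegralZl (-1) mO iG) (RintegralZl (- L) mO iw2) Rintegral_cstO// mulN1r mulNr -/W !addrA.
  rewrite -EFin_Rintegral//; apply: le_integral_gen => x _; rewrite lee_fin.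
  have := hC m (phi x); rewrite GE /w.
  rewrite (_ : m - phi x = - (phi x - m)); last by rewrite opprB.
  rewrite sqrrN mulrN mulN1r mulrBl; lra.
have q := kernel_quadratic_le mO mJ hJ Lw.
have qE : \int[lam]_(x in Omega) \int[lam]_(y in Omega) (J (x - y) * (w x - w y) ^+ 2) =
    \int[lam]_(x in Omega) \int[lam]_(y in Omega) (J (x - y) * (phi x - phi y) ^+ 2).
  apply: eq_Rintegral => x _; apply: eq_Rintegral => y _.
  by rewrite /w opprB addrA subrK.
rewrite qE in q; move: q; rewrite ler_norml /energy -/W SE => /andP[_ q].
set Q := \int[lam]_(x in Omega) \int[lam]_(y in Omega) _ in q *.
apply: le_trans (leeD2l _ FE) _; rewrite -EFinD lee_fin; move: pw hG; rewrite /L.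
move: (\int[lam]_(x in Omega) (mu x * w x)) (\int[lam]_(x in Omega) G x) => A B.
have -> : (Cp + 1 + 3 * j) * W = (Cp + 1) * W + 3 * (j * W) by ring.
rewrite (mulrDl (F m)) -!(mulrA _ j W) in q *.
move: q; move: ((Cp + 1) * W) (j * W) (F m * _) (C * _) (2^-1 * ipm _ _ _) => a b c e g.
lra.
Qed.

End energy_bounds.

Section widen.
Context d (T : measurableType d) (R : realType) (mu : {measure set T -> \bar R}).
Variables (D E : set T) (f : T -> R).
Hypotheses (mD : measurable D) (mE : measurable E) (DE : D `<=` E).
Hypothesis f0 : forall x, ~ D x -> f x = 0.

Let patch_widen : (EFin \o f) \_ E = (EFin \o f) \_ D.
Proof.
apply/funext => x; rewrite !patchE; have [Dx|nDx] := pselect (D x).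
  by rewrite !mem_set//; exact: DE.
by rewrite [in RHS]memNset//; case: ifP => // _ /=; rewrite f0.
Qed.

Lemma integrable_widen : mu.-integrable D (EFin \o f) -> mu.-integrable E (EFin \o f).
Proof. by move=> /(integrable_mkcond _ mD); rewrite -patch_widen => /(integrable_mkcond _ mE). Qed.

Lemma Rintegral_widen : \int[mu]_(x in E) f x = \int[mu]_(x in D) f x.
Proof.
rewrite /Rintegral integral_mkcond [in RHS]integral_mkcond; congr fine.
by apply: eq_integral => x _; rewrite patch_widen.
Qed.

End widen.

(** * Conservation of mass *)

Section constant_in_time.
Variable R : realType.
Local Notation lam1 := (@lebesgue_measure R).

Let S := @smooth_step R.

Lemma smooth_step_derive_out (x : R) : ~~ (0 <= x <= 1) -> derive1 (@smooth_step R) x = 0.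
Proof.
rewrite negb_and -!ltNge => /orP[x0|x1]; rewrite derive1E.
  rewrite (@near_eq_derive _ _ _ _ (cst (0 : R))) ?derive_cst//.
  by near=> y; rewrite smooth_step_le0// ltW//; near: y; exact: lt_nbhsl.
rewrite (@near_eq_derive _ _ _ _ (cst (1 : R))) ?derive_cst//.
by near=> y; rewrite smooth_step_ge1// ltW//; near: y; exact: lt_nbhsr.
Unshelve. all: by end_near. Qed.

Lemma smooth_step_derive_bound : exists2 K : R, 0 < K & forall x, `|derive1 (@smooth_step R) x| <= K.
Proof.
have c : continuous (fun x : R => `|derive1 (@smooth_step R) x|).
  move=> x; apply: cvg_norm; apply: (smooth1_continuous (smooth1_derive (smooth_step_smooth R))).
have [z _ hz] := EVT_max ler01 (continuous_subspaceT c).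
exists (`|derive1 (@smooth_step R) z| + 1); first by rewrite ltr_wpDl.
move=> x; have [x01|x01] := boolP (0 <= x <= 1).
  by apply: le_trans (hz x _) _; [rewrite in_itv|rewrite lerDl].
by rewrite smooth_step_derive_out// normr0 addr_ge0.
Qed.

(** A transition over [s, s + 1/k] for k > 0; the factor 1 gives it the shape expected by
    [smooth1_affine]. *)
Definition ramp (s k : R) (x : R) : R := 1 * @smooth_step R (k * x + - (k * s)).

Lemma ramp_smooth s k : smooth1 (ramp s k).
Proof. exact: (smooth1_affine 1 k (- (k * s)) (smooth_step_smooth R)). Qed.

Lemma derive1_ramp (s k x : R) : derive1 (ramp s k) x = k * derive1 (@smooth_step R) (k * (x - s)).
Proof.
have h1 : is_derive x 1 (fun x : R => k * x + - (k * s)) k.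
  by apply: is_derive_eq; rewrite subr0 [_ *: _]mulr1.
have h2 := smooth1_is_derive (k * x + - (k * s)) (smooth_step_smooth R).
have := @is_derive1_comp R _ (fun y : R => k * y + - (k * s)) x _ _ h2 h1 => h3.
rewrite (_ : ramp s k = @smooth_step R \o (fun y : R => k * y + - (k * s))).
  by rewrite derive1E; have [_ ->] := h3; rewrite mulrC mulrBr.
by apply/funext => y; rewrite /ramp mul1r.
Qed.

(* The derivative of a steep ramp is an approximation of the Dirac mass at s. *)
Lemma ramp_average (m : R -> R) (T s e del K : R) : 0 < s -> 0 < e -> s + e < T ->
  {within `[0, +oo[, continuous m} -> (forall x, `|derive1 (@smooth_step R) x| <= K) ->
  (forall x, s <= x <= s + e -> `|m x - m s| <= del) ->
  lam1.-integrable `]0, T[ (EFin \o (fun x => m x * derive1 (ramp s e^-1) x)) /\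
  `|\int[lam1]_(x in `]0, T[) (m x * derive1 (ramp s e^-1) x) - m s| <= K * del.
Proof.
move=> s0 e0 sT cm hK hm; pose I : set R := `[s, s + e]%classic; pose d := derive1 (ramp s e^-1).
have sse : s < s + e by rewrite ltrDl.
have cd : continuous d by exact: smooth1_continuous (smooth1_derive (ramp_smooth s e^-1)).
have d0 x : ~ I x -> d x = 0.
  move=> nI; rewrite /d derive1_ramp smooth_step_derive_out ?mulr0//; apply/negP => /andP[h1 h2].
  apply: nI; rewrite /I/= in_itv/=; move: h1 h2.
  rewrite pmulr_rge0 ?invr_gt0// subr_ge0 => -> /=.
  by rewrite ler_pdivrMl// mulr1 lerBlDl.
have IO : I `<=` `]0, T[%classic.
  move=> x; rewrite /I/= !in_itv/= => /andP[h1 h2].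
  by rewrite (lt_le_trans s0 h1) (le_lt_trans h2 sT).
have cmI : {within I, continuous m}.
  apply: continuous_subspaceW cm => x; rewrite /I/= !in_itv/= => /andP[h1 _].
  by rewrite (le_trans (ltW s0) h1).
have ipt : {within I, continuous (fun x => m x * d x)}.
  move=> x; apply: cvgM; first exact: cmI.
  exact: (continuous_subspaceT cd).
have iI : lam1.-integrable I (EFin \o (fun x => m x * d x)).
  by apply: continuous_compact_integrable => //; exact: segment_compact.
have id : lam1.-integrable I (EFin \o d).
  apply: continuous_compact_integrable; first exact: segment_compact.
  exact: continuous_subspaceT.
have f0 x : ~ I x -> m x * d x = 0 by move=> /d0 ->; rewrite mulr0.
have iT := @integrable_widen _ _ _ lam1 I _ _ (measurable_itv _) (measurable_itv _) IO f0 iI.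
split; first by [].
rewrite (@Rintegral_widen _ _ _ lam1 I _ _ IO f0).
have int1 : \int[lam1]_(x in I) d x = 1.
  apply: EFin_inj; rewrite -EFin_Rintegral//.
  rewrite (@continuous_FTC2 _ d (ramp s e^-1))//.
  - have -> : ramp s e^-1 s = 0 by rewrite /ramp mul1r subrr smooth_step_le0.
    have -> : ramp s e^-1 (s + e) = 1.
      by rewrite /ramp mul1r mulrDr mulVf ?gt_eqF// addrAC subrr add0r smooth_step_ge1.
    by rewrite -EFinB subr0.
  - exact: continuous_subspaceT.
  - have cr := smooth1_continuous (ramp_smooth s e^-1).
    split.
    + by move=> x _; exact: (@derivable_smooth1 _ _ (ramp_smooth s e^-1) 0%N).
    + by apply: cvg_at_right_filter; exact: cr.
    + by apply: cvg_at_left_filter; exact: cr.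
  - exact: measurable_itv.
have E : \int[lam1]_(x in I) (m x * d x) - m s = \int[lam1]_(x in I) ((m x - m s) * d x).
  have im := @integrable_mulr _ _ _ lam1 _ (measurable_itv _) (m s) _ id.
  under [RHS]eq_Rintegral do rewrite mulrBl.
  rewrite (RintegralB _ iI im); last exact: measurable_itv.
  by rewrite (RintegralZl _ _ id) ?int1 ?mulr1//; exact: measurable_itv.
rewrite E -lee_fin; apply: le_trans (abs_Rintegral_le _ _ _) _.
have del0 : 0 <= del by apply: le_trans (hm s _); rewrite ?normr_ge0// lexx ltW.
have K0 : 0 <= K by apply: le_trans (hK 0).
apply: (@le_trans _ _ (\int[lam1]_(x in I) (cst (del * (e^-1 * K))%:E x))%E).
  apply: ge0_le_integral_gen => x Ix; rewrite lee_fin// normrM; apply: ler_pM => //.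
    by apply: hm; move: Ix; rewrite /I/= in_itv.
  by rewrite /d derive1_ramp normrM ler_pM// ger0_norm// invr_ge0 ltW.
rewrite integral_cst; last exact: measurable_itv.
have lI : lam1 I = e%:E.
  by rewrite /I lebesgue_measure_itv/= lte_fin sse -EFinB addrAC subrr add0r.
apply: (@le_trans _ _ ((del * (e^-1 * K))%:E * e%:E)%E).
  by apply: lee_wpmul2l; rewrite ?lee_fin ?mulr_ge0 ?invr_ge0 ?(ltW e0)//; rewrite -lI.
rewrite -EFinM lee_fin.
rewrite le_eqVlt; apply/orP; left; apply/eqP.
by field; rewrite gt_eqF.
Qed.

(** The difference of a ramp at s and a ramp at t > s has compact support in the open interval, and
    its derivative is nearly a Dirac mass at s minus one at t. Each averaging error is at most K d,
    with d chosen so that they sum to ep. Since test functions vanish near 0, time 0 is reached by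
    right continuity. *)
Lemma constant_of_weak_derivative (m : R -> R) : {within `[0, +oo[, continuous m} ->
  (forall T, 0 < T -> forall eta, test_function1 T eta ->
    \int[lam1]_(x in `]0, T[) (m x * derive1 eta x) = 0) ->
  forall t, 0 <= t -> m t = m 0.
Proof.
move=> cm hm.
have near_right (s d : R) : 0 <= s -> 0 < d -> exists2 e, 0 < e & forall x, s <= x <= s + e -> `|m x - m s| <= d.
  move=> s0 d0; have /subspace_continuousP/(_ s) h := cm.
  have {}h : m x @[x --> within `[0, +oo[%classic (nbhs s)] --> m s.
    by apply: h; rewrite /= in_itv/= s0.
  have /nbhs_ballP[e /= e0 he] : \forall x \near s, 0 <= x -> `|m s - m x| <= d.
    have := h _ (nbhsx_ballx (m s) d d0); rewrite /nbhs/= /within/= => -[e /= e0 he].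
    exists e => // x /he hx x0; apply: ltW; apply: hx; by rewrite /= in_itv/= x0.
  exists (e / 2); first by rewrite divr_gt0.
  move=> x /andP[sx xe]; rewrite distrC; apply: he; last exact: le_trans sx.
  rewrite /ball/= distrC ger0_norm ?subr_ge0//; apply: (@le_lt_trans _ _ (e / 2)); first by rewrite lerBlDl.
  by rewrite ltr_pdivrMr// ltr_pMr// ltr1n.
have [K K0 hK] := smooth_step_derive_bound.
have pos s t : 0 < s -> s < t -> m s = m t.
  move=> s0 st; apply/eqP; rewrite -subr_eq0 -normr_le0; apply/ler_addgt0Pr => ep ep0; rewrite add0r.
  pose d := ep / (2 * K); have d0 : 0 < d by rewrite divr_gt0// mulr_gt0.
  have t0 := lt_trans s0 st.
  have [e1 e10 h1] := near_right s d (ltW s0) d0.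
  have [e2 e20 h2] := near_right t d (ltW t0) d0.
  pose e := Num.min e1 e2; have e0 : 0 < e by rewrite lt_min e10.
  have ee1 : e <= e1 by rewrite ge_min lexx.
  have ee2 : e <= e2 by rewrite ge_min lexx orbT.
  pose T := t + e + 1; have T0 : 0 < T by rewrite !addr_gt0.
  have tT : t + e < T by rewrite /T ltrDl.
  have sT : s + e < T by apply: lt_trans tT; rewrite ltrD2r.
  have h1' x : s <= x <= s + e -> `|m x - m s| <= d.
    by move=> /andP[a b]; apply: h1; rewrite a (le_trans b)// lerD2l.
  have h2' x : t <= x <= t + e -> `|m x - m t| <= d.
    by move=> /andP[a b]; apply: h2; rewrite a (le_trans b)// lerD2l.
  have [i1 a1] := @ramp_average m T s e d K s0 e0 sT cm hK h1'.
  have [i2 a2] := @ramp_average m T t e d K t0 e0 tT cm hK h2'.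
  pose eta x := ramp s e^-1 x + (-1) * ramp t e^-1 (1 * x + 0).
  have seta : smooth1 eta by apply: smooth1D; [exact: ramp_smooth|exact: smooth1_affine (ramp_smooth _ _)].
  have etaE x : eta x = ramp s e^-1 x - ramp t e^-1 x by rewrite /eta mul1r addr0 mulN1r.
  have teta : test_function1 T eta.
    split; first by move=> k x; exact: derivable_smooth1.
    exists s, (t + e); split => // x; rewrite etaE /ramp !mul1r; apply: contraR.
    rewrite negb_and -!ltNge -!mulrBr => /orP[xs|xt].
      rewrite !smooth_step_le0 ?subr0// pmulr_rle0 ?invr_gt0// subr_le0 ltW//.
      exact: lt_trans st.
    have xt' : e <= x - t by rewrite lerBrDl ltW.
    rewrite !smooth_step_ge1 ?subrr// ler_pdivlMl// mulr1//.
    by apply: le_trans xt' _; rewrite lerD2l lerN2 ltW.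
  have deta x : derive1 eta x = derive1 (ramp s e^-1) x - derive1 (ramp t e^-1) x.
    have h := is_deriveB (smooth1_is_derive x (ramp_smooth s e^-1)) (smooth1_is_derive x (ramp_smooth t e^-1)).
    rewrite (_ : eta = ramp s e^-1 - ramp t e^-1); last by apply/funext => y; rewrite etaE.
    by rewrite derive1E; have [_ ->] := h.
  have := hm T T0 eta teta.
  under eq_Rintegral do rewrite deta mulrBr.
  rewrite (RintegralB _ i1 i2) => [/subr0_eq AB|]; last exact: measurable_itv.
  have tri (A a b c : R) : `|A - a| <= c -> `|A - b| <= c -> `|a - b| <= c + c.
    move=> h1'' h2''; have -> : a - b = (A - b) - (A - a) by ring.
    by apply: le_trans (ler_normB _ _) _; exact: lerD.
  have -> : ep = K * d + K * d by rewrite /d; field; rewrite gt_eqF.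
  exact: (tri _ _ _ _ a1 (eq_ind_r (fun z => `|z - m t| <= K * d) a2 AB)).
move=> t; rewrite le_eqVlt => /orP[/eqP <- //|t0].
apply/eqP; rewrite -subr_eq0 -normr_le0; apply/ler_addgt0Pr => ep ep0; rewrite add0r.
have [e e0 he] := near_right 0 ep (lexx 0) ep0.
have [et|te] := ltP e t.
  by rewrite -(pos e t)//; apply: he; rewrite add0r lexx ltW.
by apply: he; rewrite add0r te ltW.
Qed.

End constant_in_time.

Lemma ae_impl d (T : semiRingOfSetsType d) (R : realFieldType) (mu : set T -> \bar R) (P Q : T -> Prop) :
  (forall t, P t -> Q t) -> (\forall t \ae mu, P t) -> \forall t \ae mu, Q t.
Proof. by move=> PQ [N [mN N0 hN]]; exists N; split => // t nQ; apply: hN => /PQ. Qed.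

Lemma ae_conj d (T : measurableType d) (R : realType) (mu : {measure set T -> \bar R}) (P Q : T -> Prop) :
  (\forall t \ae mu, P t) -> (\forall t \ae mu, Q t) -> \forall t \ae mu, P t /\ Q t.
Proof. by move=> hP hQ; apply: filterS2 hP hQ. Qed.

Lemma ae_exists_itv (R : realType) (a b : R) (P : R -> Prop) : a < b ->
  (\forall t \ae (@lebesgue_measure R), a < t < b -> P t) -> exists2 t, a < t < b & P t.
Proof.
move=> ab [N [mN N0 hN]]; apply: contrapT => hex.
have sub : `]a, b[%classic `<=` N.
  move=> t /=; rewrite in_itv/= => tab; apply: hN => /= h; apply: hex.
  by exists t => //; exact: h.
have : (@lebesgue_measure R `]a, b[%classic <= @lebesgue_measure R N)%E.
  by apply: le_measure; rewrite ?inE//; exact: measurable_itv.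
by rewrite N0 lebesgue_measure_itv/= lte_fin ab -EFinB lee_fin leNgt subr_gt0 ab.
Qed.

Section mass.
Variables (R : realType) (n : nat) (Omega : set 'rV[R]_n).
Local Notation pt := 'rV[R]_n.
Local Notation lam := (leb R n).
Hypothesis hOmega : C1_bounded_domain Omega.
Let oO := domain_open hOmega.
Let mO := domain_measurable hOmega.
Let fO := domain_finite hOmega.
Let bO : bounded_set Omega. Proof. by case: hOmega. Qed.

Let weak_partial_cst i : is_weak_partial Omega i (fun=> 1 : R) (fun=> 0 : R).
Proof.
split.
- by apply: continuous_locally_integrable; exact: cst_continuous.
- by apply: continuous_locally_integrable; exact: cst_continuous.
move=> eta teta; have [seta _ _] := teta.
rewrite /ip; under eq_Rintegral do rewrite mul1r.
under [X in - X]eq_Rintegral do rewrite mul0r.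
rewrite Rintegral_supp; last by move=> x nO; exact: test_function_supp (test_function_partial i teta) nO.
rewrite (integral_C1dir (smooth_C1dir i seta) (test_function_bounded_support teta)).
by rewrite Rintegral_cstO// mul0r oppr0.
Qed.

Lemma H1_cst : H1 Omega (fun=> 1 : R).
Proof.
split; first exact: L2_cst.
by move=> i; exists (fun=> 0); [exact: weak_partial_cst|exact: L2_cst].
Qed.

Lemma wgrad_cst : \forall x \ae lam, Omega x -> wgrad Omega (fun=> 1 : R) x = 0.
Proof.
have := @ae_in_forall R n Omega 'I_n (fun i => wpartial Omega i (fun=> 1)) (fun _ _ => 0)
  (fun i => wpartial_ae oO (weak_partial_cst i)).
by apply: filterS => x h Ox; apply/rowP => i; rewrite !mxE h.
Qed.

Lemma mxdot0 m k (A : 'M[R]_(m, k)) : mxdot A 0 = 0.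
Proof. by rewrite mxdotE; apply: big1 => i _; apply: big1 => j _; rewrite mxE mulr0. Qed.

Lemma ipm_scale_wgrad_cst (v : pt -> pt) (c : pt -> R) :
  ipm Omega v (fun x => c x *: wgrad Omega (fun=> 1 : R) x) = 0.
Proof.
rewrite /ipm (@ae_eq_Rintegral_gen _ _ _ oO _ (fun=> 0)); first by rewrite Rintegral_cstO// mul0r.
by apply: filterS wgrad_cst => x hx Ox; rewrite hx// scaler0 mxdot0.
Qed.

Lemma ipm_wgrad_cst (v : pt -> pt) : ipm Omega v (wgrad Omega (fun=> 1 : R)) = 0.
Proof.
have := ipm_scale_wgrad_cst v (fun=> 1); under [X in ipm _ _ X]eq_fun do rewrite scale1r.
by [].
Qed.

(** With psi = 1, whose weak gradient vanishes almost everywhere, the equation says that the mass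
    has zero distributional derivative. Weak continuity in time makes the mass a continuous
    function, hence a constant one. *)
Lemma mass_conservation J nu F q h u0 phi0 (u : R -> pt -> pt) (phi : R -> pt -> R) :
  global_weak_solution Omega J nu F q h u0 phi0 u phi -> L2 Omega phi0 ->
  forall t, 0 <= t -> \int[lam]_(x in Omega) phi t x = \int[lam]_(x in Omega) phi0 x.
Proof.
move=> [_ [phiL2 wphi] ws] L2phi0 t t0.
have ip1 (f : pt -> R) : ip Omega f (fun=> 1) = \int[lam]_(x in Omega) f x.
  by apply: eq_Rintegral => x _; rewrite mulr1.
have cm := wphi (fun=> 1) (L2_cst mO fO 1).
have const : forall t, 0 <= t -> ip Omega (phi t) (fun=> 1) = ip Omega (phi 0) (fun=> 1).
  apply: (constant_of_weak_derivative cm) => T T0 eta teta.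
  have [_ [vdiv _ _] _ _ _ _ [ut [phit [_ td _ _ eqs]]] _ _] := ws T T0.
  (* The weak formulation bundles the two equations; an element of [Vdiv] is required to extract the
     first, and the velocity at some time provides one. *)
  have [s _ hs] : exists2 s, 0 < s < T & Vdiv Omega (u s).
    by apply: ae_exists_itv => //; apply: filterS vdiv => s hs s0T; apply: hs; rewrite /= in_itv.
  rewrite (td _ H1_cst eta teta).
  have := eqs _ _ H1_cst hs => {}eqs.
  have z : (\int[@lebesgue_measure R]_(t in `]0%R, T[) (phit t (fun=> 1) * eta t)%:E = 0)%E.
    rewrite -[RHS](@integral0 _ _ _ (@lebesgue_measure R) `]0%R, T[%classic).
    apply: ae_eq_integral_gen; first exact: measurable_itv.
    apply: ae_impl eqs => s' e; rewrite /= in_itv/= => /e[e1 _].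
    by move: e1; rewrite ipm_wgrad_cst ipm_scale_wgrad_cst addr0 => ->; rewrite mul0r.
  by rewrite /Rintegral z oppr0.
have [_ _ _ _ _ _ _ _ init] := ws 1 ltr01.
rewrite -!ip1 const// !ip1; apply: ae_eq_Rintegral_gen => //.
Qed.

End mass.

(** * Measurability in time of the norm of the force *)

Section dual_norm_measurable.
Variables (R : realType) (E : lmodType R) (X : set E) (N : E -> \bar R).
Local Notation lam1 := (@lebesgue_measure R).
Implicit Types l : E -> R.

Lemma dual_normD l l' : (dual_norm X N (l + l')%R <= dual_norm X N l + dual_norm X N l')%E.
Proof.
apply: ge_ereal_sup => _ [x [Xx Nx] <-].
apply: (@le_trans _ _ (`|l x|%:E + `|l' x|%:E)%E); first by rewrite -EFinD lee_fin ler_normD.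
by apply: leeD; apply: ereal_sup_ubound; exists x.
Qed.

Lemma dual_normN l : dual_norm X N (- l)%R = dual_norm X N l.
Proof. by congr ereal_sup; apply: eq_imagel => x _ /=; rewrite normrN. Qed.

(** The norms of the approximating simple functions take finitely many values on measurable sets,
    and by the triangle inequality they converge to the norm of h at almost every time; their upper
    limit is the measurable version b. *)
Lemma dual_norm_measurable (h : R -> E -> R) (Y : set (E -> R)) :
  strongly_measurable Y (dual_norm X N) `[0%R, +oo[ h ->
  (\forall t \ae lam1, 0 <= t -> dual_norm X N (h t) \is a fin_num) ->
  exists2 b : R -> R, measurable_fun setT b & \forall t \ae lam1, 0 <= t -> dual_norm X N (h t) = (b t)%:E.
Proof.
move=> [s [fs ms Xs cs]] hfin; pose g n t := dual_norm X N (s n t).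
have mg n : measurable_fun [set: measurableTypeR R] (g n).
  move=> _ Y' mY'; rewrite setTI.
  have -> : g n @^-1` Y' = \bigcup_(y in range (s n) `&` [set y | Y' (dual_norm X N y)]) (s n @^-1` [set y]).
    apply/seteqP; split=> [t /= Yt|t [y [_ Yy] /= sy]]; first by exists (s n t).
    by rewrite /g sy.
  apply: fin_bigcup_measurable; last by move=> y _; exact: ms.
  by apply: sub_finite_set (fs n) => y [].
pose b t := fine (limn_esup (g ^~ t)).
exists b.
  apply: (measurableT_comp (fine_measurable measurableT)).
  exact: (measurable_fun_limn_esup mg).
have := ae_conj cs hfin; apply: ae_impl => t [ct ft] t0.
have {}ct : (fun n => dual_norm X N (s n t - h t)) @ \oo --> (0 : \bar R).
  by apply: ct; rewrite /= in_itv/= t0.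
have {}ft := ft t0.
have cg : (g n t) @[n --> \oo] --> dual_norm X N (h t).
  apply: (@squeeze_cvge _ _ _ _ (fun n => dual_norm X N (h t) - dual_norm X N (s n t - h t)%R)%E _
    (fun n => dual_norm X N (h t) + dual_norm X N (s n t - h t)%R)%E).
  - apply: nearW => n; apply/andP; split.
      have := dual_normD (s n t) (- (s n t - h t)); rewrite dual_normN opprB subrKC.
      rewrite /g; move: ft; case: (dual_norm X N (h t)) => [x||]// _.
      case: (dual_norm X N (s n t)) => [y||]//; case: (dual_norm X N _) => [z||]//=.
      - by rewrite -EFinD -EFinB !lee_fin => ?; rewrite lerBlDr.
      - by rewrite addeNy leNye.
      - by move=> _; exact: leey.
    by have := dual_normD (h t) (s n t - h t); rewrite subrKC.
  - rewrite -[X in _ --> X]sube0; apply: cvgeB => //; [by rewrite oppe0 fin_num_adde_defl|exact: cvg_cst].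
  - rewrite -[X in _ --> X]adde0; apply: cvgeD => //; [by rewrite fin_num_adde_defl|exact: cvg_cst].
by rewrite /b (cvg_limn_einf_sup cg).2 fineK.
Qed.

End dual_norm_measurable.

(** * Decay of the energy *)

Section gronwall.
Variables (R : realType) (e b : R -> R) (A k' beta : R) (S : set R).
Local Notation lam1 := (@lebesgue_measure R).
Hypothesis k'0 : 0 < k'.
Hypothesis b0 : forall t, 0 <= b t.
Hypothesis mb : measurable_fun setT b.
Hypothesis hb : forall t, 0 <= t -> (\int[lam1]_(r in `[t, (t + 1)%R]) (b r)%:E <= beta%:E)%E.
Hypothesis S0 : S 0.
Hypothesis aeS : \forall s \ae lam1, 0 <= s -> S s.
Hypothesis hS : forall s t, 0 <= s -> S s -> s <= t ->
  ((e t)%:E + \int[lam1]_(r in `[s, t]) (k' * Num.max (e r - A) 0)%:E <=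
   (e s)%:E + \int[lam1]_(r in `[s, t]) (b r)%:E)%E.

Let y t := Num.max (e t - A) 0.
(** The largest k such that 1 / (1 + k' tau) <= 1 - k tau for all tau in [0, 1], with equality at
    tau = 1; the right-hand side is at most exp (- k tau). *)
Let k := k' / (1 + k').

Let k0 : 0 < k. Proof. by rewrite divr_gt0// addr_gt0. Qed.

Let beta0 : 0 <= beta.
Proof. by rewrite -lee_fin; apply: le_trans (hb (lexx 0)); apply: integral_ge0 => r _; rewrite lee_fin. Qed.

Let y0 t : 0 <= y t. Proof. by rewrite le_max lexx orbT. Qed.

Let int_b s t : 0 <= s -> t <= s + 1 -> (\int[lam1]_(r in `[s, t]) (b r)%:E <= beta%:E)%E.
Proof.
move=> s0 ts; apply: le_trans (hb s0); apply: ge0_subset_integral => //; try exact: measurable_itv.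
- by apply/measurable_EFinP; exact: measurable_funTS.
- by move=> r _; rewrite lee_fin.
- by move=> r /=; rewrite !in_itv/= => /andP[-> /le_trans ->].
Qed.

(** Let X = e t - A. Within a time at most 1 the force adds at most beta, so e r - A >= X - beta at
    every admissible r in [s, t], that is, at almost every one. If X > beta, the dissipation is then
    at least k' (X - beta) (t - s), which gives (X - beta) (1 + k' (t - s)) <= y s. *)
Let step s t : 0 <= s -> S s -> s <= t -> t <= s + 1 -> y t <= expR (- k * (t - s)) * y s + beta.
Proof.
move=> s0 Ss st ts1.
have ey0 : 0 <= expR (- k * (t - s)) * y s by rewrite mulr_ge0 ?expR_ge0.
rewrite {1}/y ge_max addr_ge0 ?andbT//; set X := e t - A.
have [Xb|bX] := leP X beta; first by rewrite (le_trans Xb)// lerDr.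
pose c := k' * (X - beta).
have c0 : 0 <= c by rewrite mulr_ge0 ?(ltW k'0)// subr_ge0 ltW.
have low : ((c * (t - s))%:E <= \int[lam1]_(r in `[s, t]) (k' * Num.max (e r - A) 0)%:E)%E.
  apply: (@le_trans _ _ (\int[lam1]_(r in `[s, t]) (cst c%:E r))%E).
    rewrite integral_cst; last exact: measurable_itv.
    have lE : lam1 `[s, t]%classic = (t - s)%:E.
      rewrite lebesgue_measure_itv/= lte_fin lt_neqAle st andbT.
      by case: eqP => [->|_] /=; rewrite ?subrr ?EFinB.
    by rewrite EFinM -lE.
  apply: ae_le_integral_gen; first exact: measurable_itv.
  apply: ae_impl aeS => r Sr; rewrite /= in_itv/= => /andP[sr rt].
  have r0 : 0 <= r by exact: le_trans sr.
  rewrite lee_fin ler_pM2l// le_max; apply/orP; left.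
  have rt1 : t <= r + 1 by apply: le_trans ts1 _; rewrite lerD2r.
  have := hS r0 (Sr r0) rt => h.
  have : ((e t)%:E <= (e r + beta)%:E)%E.
    apply: (@le_trans _ _ ((e t)%:E + \int[lam1]_(r in `[r, t]) (k' * Num.max (e r - A) 0)%:E)%E).
      by rewrite leeDl//; apply: integral_ge0 => z _; rewrite lee_fin mulr_ge0 ?y0// ltW.
    by apply: le_trans h _; rewrite EFinD leeD2l//; exact: int_b.
  by rewrite lee_fin /X; lra.
have {}low : e t + c * (t - s) <= e s + beta.
  rewrite -lee_fin !EFinD; apply: (le_trans (leeD2l _ low)); apply: le_trans (hS s0 Ss st) _.
  by rewrite leeD2l//; exact: int_b.
have es : e s - A <= y s by rewrite le_max lexx.
have tau0 : 0 <= t - s by rewrite subr_ge0.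
set tau := t - s in tau0 low *.
have tau1 : tau <= 1 by rewrite lerBlDl.
have kt0 : 0 < 1 + k' * tau by rewrite ltr_pwDl// mulr_ge0// ltW.
have h1 : (X - beta) * (1 + k' * tau) <= y s.
  have -> : (X - beta) * (1 + k' * tau) = X - beta + c * tau by rewrite /c; ring.
  by rewrite /X; lra.
have h2 : (1 + k' * tau)^-1 <= expR (- k * tau).
  apply: (@le_trans _ _ (1 - k * tau)); last by rewrite -mulNr; exact: expR_ge1Dx.
  rewrite -[X in X <= _]mul1r ler_pdivrMr//.
  have -> : (1 - k * tau) * (1 + k' * tau) = 1 + tau * (k' - k * (1 + k' * tau)) by ring.
  rewrite lerDl mulr_ge0// subr_ge0 /k mulrAC ler_pdivrMr ?addr_gt0//.
  by rewrite ler_pM2l// lerD2l ler_piMr// ltW.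
rewrite -lerBlDr; apply: (@le_trans _ _ ((1 + k' * tau)^-1 * y s)).
  by rewrite mulrC ler_pdivlMr.
by rewrite ler_wpM2r.
Qed.

Let rho := expR (- k / 2).
Let rho1 : rho < 1. Proof. by rewrite expR_lt1 mulNr oppr_lt0 divr_gt0. Qed.

(** A step ending at t starts at an admissible s; as almost every time is admissible, one is found
    in ]t - 1, t - 1/2[. Steps longer than 1/2 contract by rho < 1, and B = beta / (1 - rho) is the
    fixed point of z -> rho z + beta. Times up to 1 are reached directly from 0. *)
Lemma gronwall t : 0 <= t ->
  e t - A <= Num.max (e 0 - A) 0 * expR (- (k' / (1 + k')) * t) + beta / (1 - expR (- (k' / (1 + k')) / 2)).
Proof.
move=> t0; rewrite -/k -/rho -/(y 0); set B := beta / (1 - rho).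
have r10 : 0 < 1 - rho by rewrite subr_gt0.
have B0 : 0 <= B by rewrite divr_ge0// ltW.
have betaE : beta = B - rho * B by rewrite /B -[X in X - _]mul1r -mulrBl mulrC divfK// gt_eqF.
have betaB : beta <= B by rewrite betaE gerBl mulr_ge0// expR_ge0.
suff H n : forall t, 0 <= t -> t <= 1 + n%:R / 2 -> y t <= y 0 * expR (- k * t) + B.
  have [n hn] : exists n : nat, t <= 1 + n%:R / 2.
    exists (Num.trunc (2 * t)).+1; have := truncnS_gt (2 * t).
    by move: ((Num.trunc (2 * t)).+1%:R : R) => m hm; lra.
  by apply: le_trans (H n t t0 hn); rewrite le_max lexx.
elim: n => [|n IH] {t0}t t0 tn.
  have := step (lexx 0) S0 t0; rewrite add0r subr0 => h.
  rewrite mulrC; apply: le_trans (h _) _; last by rewrite lerD2l.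
  by apply: le_trans tn _; rewrite mul0r addr0.
have [t1|t1] := leP t 1.
  have := step (lexx 0) S0 t0; rewrite add0r subr0 => h.
  by rewrite mulrC; apply: le_trans (h t1) _; rewrite lerD2l.
have [s /andP[s1 s2] Ss] : exists2 s, t - 1 < s < t - 1 / 2 & (0 <= s -> S s).
  apply: ae_exists_itv; first by lra.
  by apply: ae_impl aeS => s Ss _.
have s0 : 0 <= s by lra.
have st : s <= t by lra.
have sn : s <= 1 + n%:R / 2.
  have : (n.+1%:R : R) = n%:R + 1 by rewrite -natr1.
  by move: tn => /[swap] ->; lra.
apply: le_trans (step s0 (Ss s0) st _) _; first by lra.
apply: (@le_trans _ _ (expR (- k * (t - s)) * (y 0 * expR (- k * s) + B) + beta)).
  by rewrite lerD2r ler_wpM2l ?expR_ge0//; exact: IH.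
rewrite mulrDr mulrCA -expRD -mulrDr subrK -addrA lerD2l betaE.
have : expR (- k * (t - s)) * B <= rho * B.
  rewrite ler_wpM2r// ler_expR !mulNr lerN2 ler_pM2l//; lra.
by move: (rho * B) => z; lra.
Qed.

End gronwall.

Lemma ge0_integralZl_le d (T : measurableType d) (R : realType) (mu : {measure set T -> \bar R})
    (D : set T) (f : T -> \bar R) (c : R) : measurable D -> 0 < c ->
  (forall x, D x -> (0 <= f x)%E) ->
  (\int[mu]_(x in D) (c%:E * f x) <= c%:E * \int[mu]_(x in D) f x)%E.
Proof.
move=> mD c0 f0; apply: ge0_integral_ub => //.
  by move=> x Dx; rewrite mule_ge0 ?f0// lee_fin ltW.
move=> k mk k0 kf.
have -> : (\int[mu]_(x in D) (k x)%:E = c%:E * \int[mu]_(x in D) (c^-1 * k x)%:E)%E.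
  rewrite -ge0_integralZl//.
  - by apply: eq_integral => x _; rewrite -EFinM mulrA divff ?gt_eqF// mul1r.
  - by apply/measurable_EFinP; apply: measurable_funTS; exact: measurable_funM.
  - by move=> x _; rewrite lee_fin mulr_ge0// invr_ge0 ltW.
  - by rewrite lee_fin ltW.
apply: lee_wpmul2l; first by rewrite lee_fin ltW.
apply: ge0_le_integral_gen => x Dx; first by rewrite lee_fin mulr_ge0// invr_ge0 ltW.
by rewrite EFinM lee_pdivrMl// kf.
Qed.

(** In [energy_step], p is the integral of the part of the dissipation spent on the force. It occurs
    on both sides and must be finite to cancel, whereas the energies e and e' may be infinite. *)
Lemma lee_cancel_middle (R : realType) (e e' p x y a b : \bar R) : p \is a fin_num ->
  (p + a <= x)%E -> (y <= p + b)%E -> (e + x <= e' + y)%E -> (e + a <= e' + b)%E.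
Proof.
move=> fp ax yb exy; rewrite -(@leeD2rE _ p)//.
by rewrite -!addeA (addeC a) (addeC b) (le_trans (leeD2l _ ax))// (le_trans exy)// leeD2l.
Qed.

(** * Consequences of the hypotheses on J and F *)

Section potential_facts.
Variables (R : realType) (n : nat) (Omega : set 'rV[R]_n).
Local Notation lam := (leb R n).
Hypothesis hOmega : C1_bounded_domain Omega.
Variables (J : 'rV[R]_n -> R) (F : R -> R) (q : R).

Lemma ae_exists_domain (P : 'rV[R]_n -> Prop) :
  (\forall x \ae lam, Omega x -> P x) -> exists2 x, Omega x & P x.
Proof.
move=> [N [mN N0 hN]]; apply: contrapT => hex.
have sub : Omega `<=` N by move=> x Ox; apply: hN => /= h; apply: hex; exists x => //; exact: h.
have : (lam Omega <= lam N)%E by apply: le_measure; rewrite ?inE//; exact: domain_measurable hOmega.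
by rewrite N0 leNgt domain_gt0.
Qed.

Lemma kernel_L1 : kernel_assumption Omega J -> measurable_fun setT J /\
  exists j : R, (\int[lam]_x `|J x|%:E <= j%:E)%E.
Proof.
move=> [[[mJ lJ] _] _ _]; split=> //; move: lJ; rewrite /Lp_norm Lnorm1 patch_setT => lJ.
exists (fine (\int[lam]_x `|J x|%:E)); rewrite fineK// ge0_fin_numE//.
by apply: integral_ge0 => x _; rewrite lee_fin.
Qed.

(** F'' does not depend on x, so for each s the hypothesis is read at a single point of Omega, where
    a is at most j. *)
Lemma potential_second_derivative (j : R) : (forall x, `|afun Omega J x| <= j) ->
  coercivity_assumption Omega J F q ->
  exists2 kap, 0 <= kap & (forall s, - kap <= derive1 (derive1 F) s) /\
    forall L, exists2 S, 0 <= S & forall s, S <= `|s| -> L <= derive1 (derive1 F) s.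
Proof.
move=> hj [q0 [c7 [c8 [c70 c80 hc]]]].
have j0 : 0 <= j by apply: le_trans (hj 0).
have lb s : c7 * `|s| `^ (2 * q) - (c8 + j) <= derive1 (derive1 F) s.
  have [x _] := ae_exists_domain (hc s); have := hj x; rewrite ler_norml => /andP[_ ax].
  by rewrite (_ : derive1n 2 F s = derive1 (derive1 F) s)//; lra.
exists (c8 + j); first by rewrite addr_ge0// ltW.
split=> [s|L].
  by apply: le_trans (lb s); rewrite lerDr mulr_ge0 ?powR_ge0// ltW.
(* The threshold S solves c7 S^(2q) = |L| + c8 + j. *)
pose a := (`|L| + (c8 + j)) / c7.
have a0 : 0 <= a by rewrite divr_ge0 ?(ltW c70)// !addr_ge0// ltW.
have q20 : 0 < 2 * q by rewrite mulr_gt0.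
exists (a `^ (2 * q)^-1); first exact: powR_ge0.
move=> s sS; apply: le_trans (lb s).
have : a <= `|s| `^ (2 * q).
  have -> : a = (a `^ (2 * q)^-1) `^ (2 * q) by rewrite -powRrM mulVf ?gt_eqF// powRr1.
  by apply: ge0_ler_powR => //; rewrite ?nnegrE ?powR_ge0// ltW.
rewrite -(ler_pM2l c70) /a mulrC divfK ?gt_eqF//.
by have := ler_norm L; lra.
Qed.

End potential_facts.

(** * Dissipation along a weak solution *)

Section dissipation.
Variables (R : realType) (n : nat) (Omega : set 'rV[R]_n).
Local Notation pt := 'rV[R]_n.
Local Notation lam := (leb R n).
Local Notation lam1 := (@lebesgue_measure R).
Local Notation vol := (fine (lam Omega)).
Hypothesis hOmega : C1_bounded_domain Omega.
Let oO := domain_open hOmega.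
Let mO := domain_measurable hOmega.
Let fO := domain_finite hOmega.
Let bO : bounded_set Omega. Proof. by case: hOmega. Qed.
Variables (J : pt -> R) (F : R -> R) (q nu1 M : R) (nu : R -> R) (h : R -> (pt -> pt) -> R).
Hypothesis nu10 : 0 < nu1.
Hypothesis hnu : viscosity_assumption nu1 nu.
Variables (u0 : pt -> pt) (phi0 : pt -> R) (u : R -> pt -> pt) (phi : R -> pt -> R).
Hypothesis hsol : global_weak_solution Omega J nu F q h u0 phi0 u phi.
Hypothesis hphi0 : L2 Omega phi0.
Variables (CP C1 C2 : R).
Hypothesis CP0 : 0 <= CP.
Hypothesis hCP : forall u, Vdiv Omega u -> ipm Omega u u <= CP * gradsq Omega u.
Local Notation mu r := (chemical_potential Omega J F (phi r)).
Local Notation m0 := (vol^-1 * \int[lam]_(x in Omega) phi0 x).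
Hypothesis hC1 : forall (u : pt -> pt) (phi mu : pt -> R) (m : R),
  L2 Omega phi -> mu = chemical_potential Omega J F phi -> H1 Omega mu ->
  m = vol^-1 * \int[lam]_(x in Omega) phi x ->
  (energy Omega J F u phi <= (2^-1 * ipm Omega u u + F m * vol + C1 +
     2^-1 * ipm Omega (wgrad Omega mu) (wgrad Omega mu))%:E)%E.
Hypothesis hC2 : forall (u : pt -> pt) (phi : pt -> R), L2 Omega phi ->
  ((- C2)%:E <= energy Omega J F u phi)%E.

(** The two terms of the minimum serve the two dissipations: k' <= 1 for the gradient of mu, and k'
    CP <= nu1 for the kinetic energy through the Poincare inequality. The 1 added to CP keeps the
    quotient meaningful when CP = 0. *)
Definition decay_rate : R := Num.min 1 (nu1 / (CP + 1)).
Local Notation k' := decay_rate.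

Lemma decay_rate_gt0 : 0 < k'.
Proof. by rewrite lt_min ltr01 divr_gt0// ltr_wpDl. Qed.

Local Notation A := (F m0 * vol + C1).
Let E r := energy Omega J F (u r) (phi r).
Let G r := gradsq Omega (u r).
Let g r := ipm Omega (wgrad Omega (mu r)) (wgrad Omega (mu r)).
(** Half of the viscous dissipation granted by Korn's inequality: one copy of [P] controls the
    kinetic energy in [energy_excess], the other absorbs the force in [forcing_le]. *)
Let P r := 2^-1 * nu1 * G r.
Let D r := 2 * ipm Omega (fun x => Num.sqrt (nu (phi r x)) *: symgrad Omega (u r) x)
                         (fun x => Num.sqrt (nu (phi r x)) *: symgrad Omega (u r) x) + g r.

Let phiL2 r : 0 <= r -> L2 Omega (phi r).
Proof. by move=> r0; case: hsol => _ [+ _] _; apply. Qed.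

Let mass r : 0 <= r -> vol^-1 * \int[lam]_(x in Omega) phi r x = m0.
Proof. by move=> r0; rewrite (mass_conservation hOmega hsol hphi0 r0). Qed.

Let P0 r : 0 <= P r. Proof. by rewrite mulr_ge0 ?gradsq_ge0// mulr_ge0// ltW. Qed.

Let good T : 0 < T -> \forall r \ae lam1, 0 < r < T -> Vdiv Omega (u r) /\ H1 Omega (mu r).
Proof.
move=> T0; have [_ _ /(_ T T0) ws] := hsol.
have [v _ _] := ws_u_L2 ws; have [m _ _] := ws_mu_L2 ws.
have := ae_conj v m; apply: ae_impl => r [hv hm] rT.
by split; [apply: hv|apply: hm]; rewrite /= in_itv.
Qed.

Let energy_excess r : 0 <= r -> Vdiv Omega (u r) -> H1 Omega (mu r) ->
  k' * Num.max (fine (E r) - A) 0 <= P r + g r.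
Proof.
move=> r0 hv hm; have g0 : 0 <= g r by exact: ipm_ge0.
have up := hC1 (u r) (phiL2 r0) erefl hm (esym (mass r0)).
have lo := hC2 (u r) (phiL2 r0).
have Efin : E r \is a fin_num.
  rewrite fin_numE; apply/andP; split; apply/negP => /eqP EE; rewrite -/(E r) EE in up lo.
    by rewrite leeNy_eq in lo.
  by rewrite leye_eq in up.
have : fine (E r) <= 2^-1 * ipm Omega (u r) (u r) + F m0 * vol + C1 + 2^-1 * g r.
  by rewrite -lee_fin fineK.
have hG := hCP hv; have G0 : 0 <= G r := gradsq_ge0 _ _.
move=> Eup; have k0 := decay_rate_gt0.
have k1 : k' <= 1 by rewrite ge_min lexx.
have k2 : k' * CP <= nu1.
  apply: (@le_trans _ _ (nu1 / (CP + 1) * CP)).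
    by apply: ler_wpM2r => //; rewrite ge_min lexx orbT.
  by rewrite mulrAC ler_pdivrMr ?ltr_wpDl// ler_pM2l// lerDl.
have X0 : 0 <= 2^-1 * (CP * G r) + 2^-1 * g r by rewrite addr_ge0 ?mulr_ge0.
apply: (@le_trans _ _ (k' * (2^-1 * (CP * G r) + 2^-1 * g r))).
  rewrite ler_pM2l// ge_max X0 andbT; move: hG; rewrite -/(G r); lra.
have a1 : k' * CP * G r <= nu1 * G r by exact: ler_wpM2r.
have a2 : k' * g r <= 1 * g r by exact: ler_wpM2r.
have -> : k' * (2^-1 * (CP * G r) + 2^-1 * g r) = 2^-1 * (k' * CP * G r) + 2^-1 * (k' * g r) by ring.
rewrite /P; lra.
Qed.

Let mnu r : 0 <= r -> measurable_fun Omega (fun x => nu (phi r x)).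
Proof.
move=> r0; apply: measurableT_comp; last exact: L2_measurable (phiL2 r0).
have [lnu _ _] := hnu; apply: continuous_measurable_fun => s.
have [B nB [Mb [Mbr hMb]]] := lnu s.
apply/cvgrPdist_lt => ep ep0.
pose K := Num.max (Mb + 1) 1; have K0 : 0 < K by rewrite lt_max ltr01 orbT.
have MK : Mb < K by rewrite lt_max ltrDl ltr01.
have nb : \forall t \near s, `|s - t| < ep / K
  by apply: (nbhsx_ballx s (ep / K)); rewrite divr_gt0.
near=> t.
have tB : B t by near: t.
have sB : B s by exact: nbhs_singleton.
have := hMb K MK (s, t) (conj sB tB) => /= H.
apply: le_lt_trans H _; rewrite mulrC -ltr_pdivlMr//; near: t; exact: nb.
Unshelve. all: by end_near. Qed.

Let dissipation_ge r : 0 <= r -> Vdiv Omega (u r) -> H1 Omega (mu r) ->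
  P r + k' * Num.max (fine (E r) - A) 0 <= D r.
Proof.
move=> r0 hv hm; have [_ _ [nu2 _ hnu2]] := hnu.
have := korn oO (Vdiv_H10 hv) nu10 (mnu r0) (fun x => hnu2 (phi r x)).
have := energy_excess r0 hv hm; rewrite /D /P -/(G r); lra.
Qed.

Let forcing_le (dn : R) r : Vdiv Omega (u r) -> dual (Vdiv Omega) (Vdiv_norm Omega) (h r) ->
  Vdiv_dual_norm Omega (h r) = dn%:E -> h r (u r) <= P r + dn ^+ 2 / (2 * nu1).
Proof.
move=> hv hd hn; have := dual_norm_bound oO hd (eq_ind_r (fun z => (z <= dn%:E)%E) (lexx _) hn) hv.
move=> hb; apply: le_trans (ler_norm _) _; apply: le_trans hb _.
have G0 : 0 <= G r := gradsq_ge0 _ _.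
have : 0 <= (nu1 * Num.sqrt (G r) - dn) ^+ 2 / (2 * nu1).
  by rewrite divr_ge0 ?sqr_ge0// mulr_ge0// ltW.
have -> : (nu1 * Num.sqrt (G r) - dn) ^+ 2 / (2 * nu1) =
    2^-1 * nu1 * Num.sqrt (G r) ^+ 2 + dn ^+ 2 / (2 * nu1) - dn * Num.sqrt (G r).
  by field; rewrite gt_eqF.
by rewrite sqr_sqrtr// subr_ge0.
Qed.

(** Finiteness, needed to cancel this integral in [energy_step], comes from u in L^2(0, T; Vdiv)
    with T = t + 1, so that the open interval reaches beyond t. *)
Let intP_finite s t : 0 <= s -> s <= t -> (\int[lam1]_(r in `[s, t]) (P r)%:E < +oo)%E.
Proof.
move=> s0 st; pose T := t + 1; have t0 := le_trans s0 st.
have T0 : 0 < T by rewrite ltr_wpDl.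
have [_ _ /(_ T T0) ws] := hsol.
have [_ _] := ws_u_L2 ws; rewrite unlock => Lfin.
have {}Lfin := lty_poweRy (invr_neq0 (lt0r_neq0 (ltr0Sn R 1))) Lfin.
pose f r := (`|((fun t => Vdiv_norm Omega (u t)) \_ `]0%R, T[%classic) r| `^ 2)%E.
have f0 r : (0 <= f r)%E by exact: poweR_ge0.
have c0 : 0 < 2^-1 * nu1 by rewrite mulr_gt0.
apply: (@le_lt_trans _ _ ((2^-1 * nu1)%:E * \int[lam1]_r f r)%E); last first.
  by rewrite lte_mul_pinfty// lee_fin ltW.
apply: le_trans (@ge0_integralZl_le _ _ _ lam1 setT f (2^-1 * nu1) measurableT c0 (fun r _ => f0 r)).
rewrite [X in (X <= _)%E]integral_mkcond.
(* The Bochner spaces live on the open interval, but s = 0 is allowed; time 0 is discarded as a null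
   set. *)
have n0' : \forall r \ae lam1, r <> 0.
  by exists [set 0]; split => //; [exact: lebesgue_measure_set1|move=> r /=; rewrite not_notE].
have := ae_conj n0' (good T0) => gd.
apply: ae_le_integral_gen => //; apply: ae_impl gd => r [rn0 hr] _.
rewrite patchE; case: ifPn => [|_]; last by rewrite mule_ge0 ?f0// lee_fin ltW.
rewrite inE/= in_itv/= => /andP[sr rt].
have r0 : 0 < r by rewrite lt_neqAle (le_trans s0 sr) andbT; apply/eqP => /esym.
have rT : r < T by apply: le_lt_trans rt _; rewrite ltrDl.
have [|hv _] := hr; first by rewrite r0 rT.
rewrite /f patchE mem_set; last by rewrite /= in_itv/= r0 rT.
rewrite (Vdiv_normE oO (Vdiv_H1v hv)) /= ger0_norm ?sqrtr_ge0//.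
by rewrite powR_mulrn ?sqrtr_ge0// sqr_sqrtr ?gradsq_ge0// -EFinM lee_fin.
Qed.

(** The dissipation is split by superadditivity of the lower integral, the work of the force by
    subadditivity, where the term in b is measurable; the integral of [P] then cancels. *)
Lemma energy_step (b : R -> R) : measurable_fun setT b ->
  (\forall r \ae lam1, 0 <= r -> dual (Vdiv Omega) (Vdiv_norm Omega) (h r)) ->
  (\forall r \ae lam1, 0 <= r -> Vdiv_dual_norm Omega (h r) = (b r)%:E) ->
  forall s t, 0 <= s -> energy_inequality_from Omega J nu F h u phi s -> s <= t ->
  (E t + \int[lam1]_(r in `[s, t]) (k' * Num.max (fine (E r) - A) 0)%:E <=
   E s + \int[lam1]_(r in `[s, t]) (b r ^+ 2 / (2 * nu1))%:E)%E.
Proof.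
move=> mb hdual hb s t s0 hs st; pose T := t + 1; have t0 := le_trans s0 st.
have T0 : 0 < T by rewrite ltr_wpDl.
have n0' : \forall r \ae lam1, r <> 0.
  by exists [set 0]; split => //; [exact: lebesgue_measure_set1|move=> r /=; rewrite not_notE].
have gd := ae_conj (ae_conj n0' (good T0)) (ae_conj hdual hb).
have {}gd : \forall r \ae lam1, `[s, t]%classic r -> [/\ 0 <= r, Vdiv Omega (u r), H1 Omega (mu r),
    dual (Vdiv Omega) (Vdiv_norm Omega) (h r) & Vdiv_dual_norm Omega (h r) = (b r)%:E].
  apply: ae_impl gd => r [[rn0 hr] [hd hn]]; rewrite /= in_itv/= => /andP[sr rt].
  have r0 : 0 <= r by exact: le_trans sr.
  have [|hv hm] := hr; last by split=> //; [exact: hd|exact: hn].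
  rewrite lt_neqAle r0 andbT (le_lt_trans rt) ?ltrDl// andbT.
  by apply/eqP => /esym.
have k0 := decay_rate_gt0.
have Q0 r : 0 <= k' * Num.max (fine (E r) - A) 0.
  by rewrite mulr_ge0 ?(ltW k0)// le_max lexx orbT.
have bb0 r : 0 <= b r ^+ 2 / (2 * nu1) by rewrite divr_ge0 ?sqr_ge0// mulr_ge0// ltW.
have mI : measurable (`[s, t]%classic : set (measurableTypeR R)) by exact: measurable_itv.
set IP := (\int[lam1]_(r in `[s, t]) (P r)%:E)%E.
have fP : IP \is a fin_num.
  rewrite ge0_fin_numE ?intP_finite//; apply: integral_ge0 => r _; rewrite lee_fin//; exact: P0.
have low : (IP + \int[lam1]_(r in `[s, t]) (k' * Num.max (fine (E r) - A) 0)%:E <=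
    \int[lam1]_(r in `[s, t]) (D r)%:E)%E.
  apply: le_trans (@ge0_integral_superadd _ _ _ lam1 _ (fun r => (P r)%:E)
      (fun r => (k' * Num.max (fine (E r) - A) 0)%:E) mI _ _) _.
  - by move=> r _; rewrite lee_fin; exact: P0.
  - by move=> r _; rewrite lee_fin.
  apply: ae_le_integral_gen => //; apply: ae_impl gd => r hr Ir.
  by have [r0 hv hm _ _] := hr Ir; rewrite -EFinD lee_fin; exact: dissipation_ge.
have upp : (\int[lam1]_(r in `[s, t]) (h r (u r))%:E <=
    IP + \int[lam1]_(r in `[s, t]) (b r ^+ 2 / (2 * nu1))%:E)%E.
  apply: (@le_trans _ _ (\int[lam1]_(r in `[s, t]) ((P r)%:E + (b r ^+ 2 / (2 * nu1))%:E))%E).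
    apply: ae_le_integral_gen => //; apply: ae_impl gd => r hr Ir.
    by have [_ hv _ hd hn] := hr Ir; rewrite -EFinD lee_fin; exact: forcing_le.
  apply: (@ge0_integral_subadd _ _ _ lam1 _ (fun r => (P r)%:E) (fun r => b r ^+ 2 / (2 * nu1))) => //.
  - by move=> r _; rewrite lee_fin; exact: P0.
  - by apply: measurable_funM => //; exact: measurable_funX.
exact: lee_cancel_middle fP low upp (hs t st).
Qed.

End dissipation.

Lemma integral_itv_fin (R : realType) (b : R -> R) (beta : R) : measurable_fun setT b ->
  (forall r, 0 <= b r) ->
  (forall t, 0 <= t -> (\int[@lebesgue_measure R]_(r in `[t, (t + 1)%R]) (b r)%:E <= beta%:E)%E) ->
  forall t, (\int[@lebesgue_measure R]_(r in `[0%R, t]) (b r)%:E < +oo)%E.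
Proof.
move=> mb b0 hb t; set lam1 := @lebesgue_measure R.
have mE (D : set (measurableTypeR R)) : measurable_fun D (EFin \o b).
  by apply/measurable_EFinP; exact: measurable_funTS.
have bE0 (D : set (measurableTypeR R)) r : D r -> (0 <= (EFin \o b) r)%E by rewrite lee_fin.
pose n := (Num.trunc t).+1.
have tn : t <= n%:R by apply: ltW; exact: truncnS_gt.
apply: (@le_lt_trans _ _ (\int[lam1]_(r in `[0%R, n%:R]) (b r)%:E)%E).
  apply: (@ge0_subset_integral _ _ _ lam1 `[0%R, t]%classic `[0%R, n%:R]%classic) => //.
    by move=> r _; rewrite lee_fin.
  by apply: subset_itvl; rewrite bnd_simp.
elim: n {tn} => [|n IH].
  rewrite set_itv1 integral_set1//.
apply: (@le_lt_trans _ _ (\int[lam1]_(r in `[0%R, n%:R]) (b r)%:E +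
   \int[lam1]_(r in `[n%:R, (n%:R + 1)%R]) (b r)%:E)%E); last first.
  by rewrite lte_add_pinfty// (le_lt_trans (hb _ _))// ltry.
have -> : (`[0%R, n.+1%:R]%classic : set R) = `[0%R, n%:R[%classic `|` `[n%:R, (n%:R + 1)%R]%classic.
  by rewrite -natr1 -itv_bndbnd_setU// bnd_simp// lerDl.
rewrite (@ge0_integral_setU _ _ _ lam1)//.
- rewrite leeD2r//; apply: (@ge0_subset_integral _ _ _ lam1 `[0%R, n%:R[%classic `[0%R, n%:R]%classic) => //.
    by move=> r _; rewrite lee_fin.
  by apply: subset_itvl; rewrite bnd_simp.
- by move=> r _; rewrite lee_fin.
- apply/disj_setPS => x [] /=; rewrite !in_itv/= => /andP[_ a] /andP[b' _].
  by move: a; rewrite ltNge b'.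
Qed.

(** * Finiteness and time averages of the norm of the force *)

Section dual_norm_of_force.
Variables (R : realType) (n : nat) (Omega : set 'rV[R]_n).
Hypothesis oO : open Omega.

(** An empty supremum would be minus infinity; an element of [Vdiv] makes the unit ball inhabited
    and the norm nonnegative. *)
Lemma Vdiv_dual_norm_fin l : Vdiv Omega !=set0 -> dual (Vdiv Omega) (Vdiv_norm Omega) l ->
  (0 <= Vdiv_dual_norm Omega l)%E /\ Vdiv_dual_norm Omega l \is a fin_num.
Proof.
move=> [v hv] [_ [C hC]]; have nE := Vdiv_normE oO (Vdiv_H1v hv).
set g := Num.sqrt _ in nE; have g0 : 0 <= g by exact: sqrtr_ge0.
(* Dividing by g + 1 instead of g brings v into the unit ball even when g = 0. *)
have c0 : (g + 1)^-1 != 0 by rewrite invr_eq0 gt_eqF// ltr_wpDl.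
have hcv := VdivZ oO c0 hv.
have ge0 : (0 <= Vdiv_dual_norm Omega l)%E.
  apply: (@le_trans _ _ (`|l ((g + 1)^-1 *: v)|%:E)%E); first by rewrite lee_fin.
  apply: ereal_sup_ubound; exists ((g + 1)^-1 *: v) => //; split=> //.
  rewrite (Vdiv_normZ oO c0 hv) nE -EFinM lee_fin ger0_norm ?invr_ge0 ?addr_ge0//.
  by rewrite ler_pdivrMl ?ltr_wpDl// mulr1 lerDl.
split=> //; rewrite ge0_fin_numE//; apply: (@le_lt_trans _ _ `|C|%:E); last exact: ltry.
apply: ge_ereal_sup => _ [x [hx x1] <-]; apply: le_trans (hC x hx) _.
have N0 : (0 <= Vdiv_norm Omega x)%E by exact: Lp_norm_ge0.
apply: (@le_trans _ _ (`|C|%:E * Vdiv_norm Omega x)%E).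
  by apply: lee_wpmul2r => //; rewrite lee_fin ler_norm.
by rewrite -[leRHS]mule1; apply: lee_wpmul2l.
Qed.

(** Replaces the norm of the force by a measurable real function b, which provides the measurable
    summand in [energy_step] and the forcing in [gronwall]. *)
Lemma force_bound (h : R -> ('rV[R]_n -> 'rV[R]_n) -> R) (M : R) : Vdiv Omega !=set0 ->
  L2tb Omega h -> tb_norm Omega h = M%:E ->
  exists b : R -> R, [/\ measurable_fun setT b,
    \forall r \ae @lebesgue_measure R, 0 <= r -> dual (Vdiv Omega) (Vdiv_norm Omega) (h r),
    \forall r \ae @lebesgue_measure R, 0 <= r -> Vdiv_dual_norm Omega (h r) = (b r)%:E &
    forall t, 0 <= t -> (\int[@lebesgue_measure R]_(r in `[t, (t + 1)%R]) (b r ^+ 2)%:E <= (M ^+ 2)%:E)%E].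
Proof.
move=> V0 [hd sm _] hM.
have [|b mb hb] := dual_norm_measurable sm.
  apply: ae_impl hd => r h1 r0; have [] := Vdiv_dual_norm_fin V0 (h1 r0); by [].
exists b; split => // t t0.
rewrite -(@ae_eq_integral_gen _ _ _ (@lebesgue_measure R) _
  (fun r => Vdiv_dual_norm Omega (h r) ^+ 2)%E)//; last first.
  apply: ae_impl hb => r h1; rewrite /= in_itv/= => /andP[tr _].
  by rewrite /Vdiv_dual_norm h1 ?(le_trans t0 tr)// -EFin_expe.
have -> : ((M ^+ 2)%:E = tb_norm Omega h ^+ 2)%E by rewrite hM EFin_expe.
have I0 s : (0 <= \int[@lebesgue_measure R]_(r in `[s, (s + 1)%R]) (Vdiv_dual_norm Omega (h r) ^+ 2))%E.
  by apply: integral_ge0 => r _; exact: sqre_ge0.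
rewrite /tb_norm sqre_half.
  by apply: ereal_sup_ubound; exists t => //=; rewrite in_itv/= t0.
apply: le_trans (I0 0) _; apply: ereal_sup_ubound; exists 0 => //=.
by rewrite in_itv/= lexx.
Qed.

End dual_norm_of_force.

(** The initial data are attained almost everywhere only, so the energy at time 0 and the energy of
    the data are identified through this invariance. *)
Lemma energy_ae_eq (R : realType) (n : nat) (Omega : set 'rV[R]_n) J F u u' phi phi' :
  open Omega -> (\forall x \ae leb R n, Omega x -> u x = u' x) ->
  (\forall x \ae leb R n, Omega x -> phi x = phi' x) ->
  energy Omega J F u phi = energy Omega J F u' phi'.
Proof.
move=> oO hu hphi; rewrite /energy.
have -> : ipm Omega u u = ipm Omega u' u'.
  by apply: (ae_eq_Rintegral_gen oO); apply: ae_impl hu => x h Ox; rewrite h.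
have -> : \int[leb R n]_(x in Omega) \int[leb R n]_(y in Omega) (J (x - y) * (phi x - phi y) ^+ 2) =
    \int[leb R n]_(x in Omega) \int[leb R n]_(y in Omega) (J (x - y) * (phi' x - phi' y) ^+ 2).
  apply: (ae_eq_Rintegral_gen oO); apply: ae_impl (hphi) => x h Ox.
  apply: (ae_eq_Rintegral_gen oO); apply: ae_impl hphi => y h' Oy.
  by rewrite h// h'.
congr (_ + _)%E; apply: ae_eq_integral_gen; first exact: open_measurable_rV.
by apply: ae_impl (hphi) => x h Ox; rewrite h.
Qed.

(* The case distinction on the sign of [e0 - A]: when it is negative, [e0] still
   has to dominate [- C2] after multiplication by [Ex]. *)
Lemma decay_estimate (R : realDomainType) (et e0 A Ex B C1 C2 Fm CF : R) :
  A = Fm + C1 -> 0 <= C1 -> 0 <= C2 -> 0 <= CF -> - CF <= Fm -> - C2 <= e0 -> 0 <= Ex <= 1 -> 0 <= B ->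
  et - A <= Num.max (e0 - A) 0 * Ex + B -> et <= e0 * Ex + (Fm + (C1 + CF + C2 + B + 1)).
Proof.
move=> AE C10 C20 CF0 Fm0 e0C /andP[Ex0 Ex1] B0.
have C2Ex : C2 * Ex <= C2 by rewrite ler_piMr.
have CFEx : CF * Ex <= CF by rewrite ler_piMr.
have C1Ex : 0 <= C1 * Ex by rewrite mulr_ge0.
have FmEx : - CF * Ex <= Fm * Ex by rewrite ler_wpM2r.
have e0Ex : - C2 * Ex <= e0 * Ex by rewrite ler_wpM2r.
case: (leP (e0 - A) 0) => _; rewrite AE; lra.
Qed.

(** The energy is an extended real a priori. The inequality started at the admissible time 0 bounds
    it above at every later time, the uniform lower bound handles the other side, and the
    real-valued [gronwall] applies. *)
Lemma extended_gronwall (R : realType) (E : R -> \bar R) (b : R -> R) (A k' beta C : R) (S : set R) :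
  0 < k' -> (forall t, 0 <= b t) -> measurable_fun setT b ->
  (forall t, 0 <= t -> (\int[@lebesgue_measure R]_(r in `[t, (t + 1)%R]) (b r)%:E <= beta%:E)%E) ->
  E 0 \is a fin_num -> (forall t, 0 <= t -> ((- C)%:E <= E t)%E) ->
  S 0 -> (\forall s \ae @lebesgue_measure R, 0 <= s -> S s) ->
  (forall s t, 0 <= s -> S s -> s <= t ->
    (E t + \int[@lebesgue_measure R]_(r in `[s, t]) (k' * Num.max (fine (E r) - A) 0)%:E <=
     E s + \int[@lebesgue_measure R]_(r in `[s, t]) (b r)%:E)%E) ->
  forall t, 0 <= t -> E t \is a fin_num /\
    fine (E t) - A <= Num.max (fine (E 0) - A) 0 * expR (- (k' / (1 + k')) * t) +
      beta / (1 - expR (- (k' / (1 + k')) / 2)).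
Proof.
move=> k'0 b0 mb hb E0fin Elow S0 aeS step.
have Efin r : 0 <= r -> E r \is a fin_num.
  move=> r0; rewrite fin_numElt (lt_le_trans (ltNyr _) (Elow r r0))/=.
  apply: (@le_lt_trans _ _ (E 0%R + \int[@lebesgue_measure R]_(s in `[0%R, r]) (b s)%:E)%E).
    apply: le_trans (step 0 r (lexx 0) S0 r0); rewrite leeDl//; apply: integral_ge0 => s _.
    by rewrite lee_fin mulr_ge0 ?(ltW k'0)// le_max lexx orbT.
  by rewrite lte_add_pinfty ?(integral_itv_fin mb b0 hb)// ltey_eq E0fin.
move=> t t0; split; first exact: Efin.
apply: (@gronwall R (fun r => fine (E r)) b A k' beta S) => // s r s0 Ss sr.
by rewrite !fineK ?Efin ?(le_trans s0 sr)//; exact: step.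
Qed.

(** The order of the quantifiers encodes the dependence of the constants: K is chosen knowing nu1
    and the norm M, before nu and h; k comes after nu and h, and before the initial data. *)
Theorem theorem5 (R : realType) (d : nat) (hd : d = 2%N \/ d = 3%N)
    (Omega : set 'rV[R]_d) (hOmega : C1_bounded_domain Omega)
    (J : 'rV[R]_d -> R) (hJ : kernel_assumption Omega J)
    (F : R -> R) (hF : convexity_assumption Omega J F)
    (hF' : growth_assumption F)
    (q : R) (hq : coercivity_assumption Omega J F q)
    (nu1 M : R) :
  exists2 K : R, 0 < K &
  forall nu : R -> R, viscosity_assumption nu1 nu ->
  forall h : R -> ('rV[R]_d -> 'rV[R]_d) -> R,
    L2tb Omega h -> tb_norm Omega h = M%:E ->
  exists2 k : R, 0 < k &
  forall (u0 : 'rV[R]_d -> 'rV[R]_d) (phi0 : 'rV[R]_d -> R)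
    (u : R -> 'rV[R]_d -> 'rV[R]_d) (phi : R -> 'rV[R]_d -> R),
    initial_data Omega F u0 phi0 ->
    global_weak_solution Omega J nu F q h u0 phi0 u phi ->
    energy_inequality Omega J nu F h u phi ->
  forall t : R, 0 <= t ->
    let vol := fine (leb R d Omega) in
    let m0 := vol^-1 * \int[leb R d]_(x in Omega) phi0 x in
    (energy Omega J F (u t) (phi t) <=
       energy Omega J F u0 phi0 * (expR (- k * t))%:E + (F m0 * vol + K)%:E)%E.
Proof.
(* For nu1 <= 0 there is no admissible viscosity, and any K will do. *)
have [nu10|nu10] := leP nu1 0.
  by exists 1 => // nu [_ + _]; rewrite ltNge nu10.
have d0 : (0 < d)%N by case: hd => ->.
have [mJ [j hj]] := kernel_L1 hJ.
have oO := domain_open hOmega.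
have [bO _] : bounded_set Omega /\ True by case: hOmega.
have aj := afun_bound (domain_measurable hOmega) mJ hj.
have [dF ddF _] := proj1 hF.
have [kap kap0 [F2lb F2co]] := potential_second_derivative hOmega aj hq.
have [C1 C10 hC1] := energy_upper_bound hOmega mJ hj dF ddF kap0 F2lb F2co.
have [C2 C20 hC2] := energy_lower_bound hOmega mJ hj dF ddF kap0 F2lb F2co.
(* With L = 0 this is a lower bound for F itself, hence for F(m0) independently of m0. *)
have [CF CF0 hCF] := quadratic_lower_bound dF ddF kap0 F2lb F2co (lexx 0).
have [CP CP0 hCP] := Vdiv_poincare oO bO d0.
set vol := fine (leb R d Omega); have vol0 : 0 < vol by exact: vol_gt0 hOmega.
pose k' := decay_rate nu1 CP; have k'0 : 0 < k' by exact: decay_rate_gt0.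
pose k := k' / (1 + k'); have k0 : 0 < k by rewrite divr_gt0// addr_gt0.
pose beta := M ^+ 2 / (2 * nu1); have beta0 : 0 <= beta by rewrite divr_ge0 ?sqr_ge0// mulr_ge0// ltW.
pose B := beta / (1 - expR (- k / 2)).
have B0 : 0 <= B.
  by rewrite divr_ge0// subr_ge0 -expR0 ler_expR mulNr oppr_le0 divr_ge0// ltW.
have kt t : 0 <= t -> 0 <= expR (- k * t) <= 1.
  by move=> t0; rewrite expR_ge0 -expR0 ler_expR mulNr oppr_le0 mulr_ge0// ltW.
have CFm m : - (CF * vol) <= F m * vol.
  by rewrite -mulNr ler_pM2r//; have := hCF m; rewrite mul0r add0r.
(* C1 comes from the level A, and B is the asymptotic contribution of the force. CF and C2 bound F
   and the energy from below, which lets e0 replace the positive part of e0 - A. The last 1 makes K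
   positive. *)
exists (C1 + CF * vol + C2 + B + 1).
  by rewrite ltr_wpDl// !addr_ge0// mulr_ge0// ltW.
move=> nu hnu h h2tb hM; exists k => // u0 phi0 u phi hini hsol [hE0 hE] t t0 /=.
rewrite -/vol; set m0 := vol^-1 * _.
have hphi0 := initial_phase hini.
have V0 : Vdiv Omega !=set0.
  have [_ _ /(_ 1 ltr01) ws] := hsol; have [v _ _] := ws_u_L2 ws.
  have [r rI hr] := ae_exists_itv (ltr01 : (0 : R) < 1) v.
  by exists (u r); apply: hr; rewrite /= in_itv.
have [b [mb hdual hb hbM]] := force_bound oO V0 h2tb hM.
pose b2 r := b r ^+ 2 / (2 * nu1).
have nu20 : 0 <= (2 * nu1)^-1 by rewrite invr_ge0 mulr_ge0// ltW.
have b20 r : 0 <= b2 r by rewrite mulr_ge0 ?sqr_ge0.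
have mb2 : measurable_fun setT b2.
  by apply: measurable_funM => //; exact: measurable_funX.
have hb2 r : 0 <= r -> (\int[@lebesgue_measure R]_(s in `[r, (r + 1)%R]) (b2 s)%:E <= beta%:E)%E.
  move=> r0; rewrite (_ : (fun s => _) = (fun s => ((2 * nu1)^-1)%:E * (b s ^+ 2)%:E)%E); last first.
    by apply/funext => s; rewrite -EFinM mulrC.
  rewrite ge0_integralZl//.
  - have -> : beta%:E = ((2 * nu1)^-1%:E * (M ^+ 2)%:E)%E by rewrite -EFinM mulrC.
    by apply: lee_wpmul2l; [rewrite lee_fin|exact: hbM].
  - by apply/measurable_EFinP; apply: measurable_funTS; exact: measurable_funX.
  - by move=> s _; rewrite lee_fin sqr_ge0.
pose E r := energy Omega J F (u r) (phi r).
have step := energy_step hOmega nu10 hnu hsol hphi0 CP0 hCP hC1 hC2 mb hdual hb.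
have Elow r : 0 <= r -> ((- C2)%:E <= E r)%E.
  by move=> r0; apply: hC2; case: hsol => _ [+ _] _; apply.
have E0 : E 0 = energy Omega J F u0 phi0.
  have [_ _ /(_ 1 ltr01) ws] := hsol.
  by apply: energy_ae_eq oO _ _; [exact: ws_u_initial ws|exact: ws_phi_initial ws].
have E0fin : E 0 \is a fin_num.
  rewrite E0 /energy fin_numD; apply/andP; split; first exact: isT.
  by apply: integrable_fin_num; [exact: domain_measurable hOmega|exact: initial_potential hini].
have [Efin gr] := extended_gronwall k'0 b20 mb2 hb2 E0fin Elow hE0 hE step t0.
rewrite -E0 -/(E t) -(fineK Efin) -(fineK E0fin) -EFinM -EFinD lee_fin.
have e0 : - C2 <= fine (E 0) by rewrite -lee_fin (fineK E0fin); exact: Elow (lexx 0).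
exact: decay_estimate erefl C10 C20 (mulr_ge0 CF0 (ltW vol0)) (CFm m0) e0 (kt t t0) B0 gr.
Qed.
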